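(* Consider a network of $N$ non-redundant Euler–Lagrange systems with uncertain parameters and joint-space dynamics $$M_i(q_i)\ddot q_i+C_i(q_i,\dot q_i)\dot q_i+g_i(q_i)=J_i^{\mathsf T}(q_i)f_i,\qquad i=1,\dots,N,$$ with bounded task-space actuation $|f_i^k|\le\bar f_i^k$ ($k=1,\dots,n$), satisfying the standing properties and assumptions (including A.1–A.4) listed in the context. Let $x_i$ be the end-effector configuration of system $i$, $x_{ij}=x_i-x_j$, let $\mathcal N_i(0)$ be the initial neighbour set of system $i$ and $\mathcal E(0)$ the initial edge set, and let $\psi$ be the potential function described in the context, with parameter $Q>0$ and bounds $\sigma,\nu$. Set $$e_i=\sum_{j\in\mathcal N_i(0)}\nabla_i\psi(\|x_{ij}\|),\qquad s_i=\dot x_i+\alpha e_i .$$ Let the computed control be the adaptive law $$\hat f_i=\Phi_i(q_i,\dot q_i,e_i,\dot e_i)\hat\theta_i-\kappa_is_i-\mu_i\dot x_i,\qquad \dot{\hat\theta}_i=\mathrm{Proj}_{\hat\theta_i}(\omega_i),\qquad \omega_i=-\beta_i\Phi_i^{\mathsf T}(q_i,\dot q_i,e_i,\dot e_i)s_i,$$ with $\underline\theta_i\le\hat\theta_i(0)\le\overline\theta_i$ (component-wise), $i=1,\dots,N$. Suppose that the positive constants $Q,\alpha,\mu_i,\kappa_i,\beta_i$ ($i=1,\dots,N$) satisfy (a) for all $i=1,\dots,N$ and all $k=1,\dots,n$, $$\Big[(2\nu\lambda^*_{i2}+c_ir\sigma)\alpha|\mathcal N_i(0)|+\mu_i\Big]\Big[\sqrt{\tfrac{2\alpha\mu_i\psi(r)}{\lambda^*_{i1}}}+\alpha\sigma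 r|\mathcal N_i(0)|\Big]+\gamma_i^k+\kappa_i\sqrt{\tfrac{2\alpha\mu_i\psi(r)}{\lambda^*_{i1}}}<\bar f_i^k;$$ (b) with $\hat\lambda^*_{i20}$ the maximum eigenvalue of $\mathfrak M_i(q_i(0))$ and $\Delta\theta_i=|\overline\theta_i-\underline\theta_i|$, $$\frac12\sum_{i=1}^N\frac1{\alpha\mu_i}\Big(\hat\lambda^*_{i20}\|s_i(0)\|^2+\frac1{\beta_i}\|\Delta\theta_i\|^2\Big)+\frac12\sum_{i=1}^N\sum_{j\in\mathcal N_i(0)}\psi(\|x_{ij}(0)\|)<\psi(r).$$ Then this control is a connectivity-preserving coordination strategy for the network, i.e.: 1) all initial communication links are maintained: $\|x_{ij}(t)\|<r$ for all $(i,j)\in\mathcal E(0)$ and all $t\ge0$; 2) all end effectors are driven to the same task-space configuration: $x_i(t)-x_j(t)\to0$ as $t\to\infty$ for all $i,j\in\{1,\dots,N\}$.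
   Context: Systems. For agent $i$, $q_i,\dot q_i,\ddot q_i$ are joint position, velocity and acceleration; $M_i,C_i,J_i$ are the inertia matrix, the matrix of Coriolis and centrifugal effects, and the Jacobian; $g_i$ is the gravity torque; $f_i$ is the control wrench applied in task space; $\dot x_i=J_i(q_i)\dot q_i$ is the end-effector velocity in task space, of dimension $n$. A superscript $k$ denotes the $k$-th component of a vector. All joints are revolute, and the systems operate away from kinematic singularities, i.e. through configurations where $J_i(q_i)$ is full rank (nonsingular). There the dynamics are equivalent to the task-space dynamics $$\mathfrak M_i(q_i)\ddot x_i+\mathfrak C_i(q_i,\dot q_i)\dot x_i+\mathfrak g_i(q_i)=f_i,$$ with $\mathfrak M_i=J_i^{-\mathsf T}M_iJ_i^{-1}$, $\mathfrak C_i=J_i^{-\mathsf T}C_iJ_i^{-1}-J_i^{-\mathsf T}M_iJ_i^{-1}\dot J_iJ_i^{-1}$, $\mathfrak g_i=J_i^{-\mathsf T}g_i$. Standing properties: P.1: $M_i(q_i)$ is symmetric with $0\prec\lambda_{i1}I\preceq M_i(q_i)\preceq\lambda_{i2}I$ for constants $\lambda_{i1},\lambda_{i2}>0$. P.2: $\dot{\mathfrak M}_i-2\mathfrak C_i$ is skew-symmetric. P.3: $\mathfrak M_i(q_i)$ is symmetric with $0\prec\lambda^*_{i1}I\preceq\mathfrak M_i(q_i)\preceq\lambda^*_{i2}I$ for constants $\lambda^*_{i1},\lambda^*_{i2}>0$. P.4: there is $c_i>0$ such that $\|\mathfrak C_i(q_i,\dot q_i)y\|\le c_i\|\dot x_i\|\|y\|$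 for all $q_i,\dot q_i,y$ with $J_i(q_i)$ nonsingular. P.5: the dynamics admit a linear parameterization $\mathfrak M_i(q_i)\ddot x_r+\mathfrak C_i(q_i,\dot q_i)\dot x_r+\mathfrak g_i(q_i)=\Phi_i(q_i,\dot q_i,\dot x_r,\ddot x_r)\theta_i$, where $\Phi_i$ is a regressor matrix of known functions and $\theta_i$ is a constant (unknown) vector of system parameters with known component-wise bounds $\underline\theta_i\le\theta_i\le\overline\theta_i$. Communication graph. $\mathcal G(t)=(\mathcal V,\mathcal E(t))$ with $\mathcal V=\{1,\dots,N\}$; $(j,i)\in\mathcal E(t)$ iff systems $i$ and $j$ exchange state information at time $t$; $\mathcal N_i(t)$ is the set of systems adjacent to $i$. Communications are bidirectional (undirected graph). Assumptions: A.1: there exist $\gamma_i$ with $|\mathfrak g_i^k(q_i)|\le\gamma_i^k<\bar f_i^k$ for all $k=1,\dots,n$ throughout the task space, where $\bar f_i$ is the maximum task-space actuation wrench of system $i$. A.2: no edges are created during coordination: $(j,i)\notin\mathcal E(0)\Rightarrow(j,i)\notin\mathcal E(t)$ for all $t\ge0$. A.3: the systems have communication radius $r>0$; adjacent systems are at distance less than $r$, so preserving an initial link $(i,j)$ means keeping $\|x_{ij}(t)\|<r$. A.4: at $t=0$ the graph is connected and $\|x_{ij}(0)\|\le r-\epsilon$ for all $(i,j)\in\mathcal E(0)$, for some $\epsilon>0$ (with $\epsilon<r$). Potential function. $\psi$ is a smooth function (with tunable parameter $Q>0$) of the inter-system distance such that: (1) $\psi(\|x_{ij}\|)$ is positive definite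 for $\|x_{ij}\|\in[0,r]$; (2) $\psi$ is strictly increasing and bounded above on $[0,r]$; (3) $\frac{\partial\psi(\|x_{ij}\|)}{\partial(\|x_{ij}\|^2)}\in[0,\sigma)$ for $\|x_{ij}\|\in[0,r]$; (4) the Hessian $\nabla^2_{ij}\psi(\|x_{ij}\|)$ with respect to $x_{ij}$ is positive definite and bounded above by $\nu I$ for $\|x_{ij}\|\in[0,r]$; (5) given $\|x_{ij}(0)\|\in[0,r-\epsilon]$ and $N>0$ with $0<\epsilon<r$, $N\psi(\|x_{ij}(0)\|)<\psi(r)$ can be guaranteed by properly tuning the parameter. The constants $\sigma,\nu$ may depend on $Q$. A particular such function is $\psi(\|x_{ij}\|)=\frac{\|x_{ij}\|^2}{r^2-\|x_{ij}\|^2+Q}$. The gradient with respect to $x_i$ is $\nabla_i\psi(\|x_{ij}\|)=2\frac{\partial\psi(\|x_{ij}\|)}{\partial(\|x_{ij}\|^2)}(x_i-x_j)$. Adaptive terms. $\hat\theta_i$ is the estimate of $\theta_i$ and $$\Phi_i(q_i,\dot q_i,e_i,\dot e_i)\hat\theta_i=\hat{\mathfrak M}_i(q_i)[-\alpha\dot e_i]+\hat{\mathfrak C}_i(q_i,\dot q_i)[-\alpha e_i]+\hat{\mathfrak g}_i(q_i),$$ where hats on $\mathfrak M_i,\mathfrak C_i,\mathfrak g_i$ denote these quantities with $\theta_i$ replaced by $\hat\theta_i$ (so the same identity holds without hats); here $\dot e_i=\sum_{j\in\mathcal N_i(0)}\nabla^2_{ij}\psi(\|x_{ij}\|)(\dot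 x_i-\dot x_j)$. The projection operator is defined component-wise, for each component $k$ of $\hat\theta_i$, by $$\dot{\hat\theta}{}_i^k=\begin{cases}[1-\upsilon_{lb}(\hat\theta_i^k)]\,\omega_i^k,&\underline\theta_i^k\le\hat\theta_i^k\le\underline\theta_i^k+\delta\text{ and }\omega_i^k<0,\\ [1-\upsilon_{ub}(\hat\theta_i^k)]\,\omega_i^k,&\overline\theta_i^k-\delta\le\hat\theta_i^k\le\overline\theta_i^k\text{ and }\omega_i^k>0,\\ \omega_i^k,&\text{otherwise},\end{cases}$$ with $\upsilon_{lb}(\hat\theta_i^k)=\min\{1,(\underline\theta_i^k+\delta-\hat\theta_i^k)/\delta\}$, $\upsilon_{ub}(\hat\theta_i^k)=\min\{1,(\hat\theta_i^k-\overline\theta_i^k+\delta)/\delta\}$ and $0<\delta<\frac12(\overline\theta_i^k-\underline\theta_i^k)$. Bounded actuation. $\hat f_i$ is the computed control and $f_i$ is the wrench actually applied, with $|f_i^k|\le\bar f_i^k$; $f_i=\hat f_i$ whenever $|\hat f_i^k|\le\bar f_i^k$ for all $k$. When actuators saturate, the terms $\Phi_i\hat\theta_i$ and $-\mu_i\dot x_i$ are implemented with priority and the remaining actuation is used for the other term, giving $f_i=\Phi_i\hat\theta_i-\hat\kappa_i(t)s_i-\mu_i\dot x_i$ with $0<\hat\kappa_i(t)\le\kappa_i$.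
   Formalization: The formal theorem additionally assumes that each true parameter lies outside the projection bands, i.e. lower bound + δ ≤ θ_i^k ≤ upper bound − δ; with only lower ≤ θ_i ≤ upper the claim fails (e.g. θ_i at its lower bound, where the slowed estimate lets a link reach r). *)

(* Defs.v *)
(* MathComp / MathComp-Analysis; the reals are an arbitrary [R : realType]. *)
From HB Require Import structures.
From mathcomp Require Import all_boot all_order all_algebra.
From mathcomp Require Import all_classical all_reals all_analysis.
Set Implicit Arguments.
Unset Strict Implicit.
Unset Printing Implicit Defensive.
Import Order.TTheory GRing.Theory Num.Theory.
Import numFieldNormedType.Exports.
Local Open Scope classical_set_scope.
Local Open Scope ring_scope.

Section LinearAlgebra.
Variable R : realType.

(* The library's norm on ['cV_n] is the sup norm (same topology, hence same
   limits and derivatives); all norms in the control problem are Euclidean. *)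
Definition enorm n (v : 'cV[R]_n) : R := Num.sqrt (\sum_k (v k 0) ^+ 2).

Definition qform n (A : 'M[R]_n) (v : 'cV[R]_n) : R := (v^T *m A *m v) 0 0.

Definition posdef n (A : 'M[R]_n) : Prop := forall v, v != 0 -> 0 < qform A v.

(* Loewner order; only used between symmetric matrices. *)
Definition loewner_le n (A B : 'M[R]_n) : Prop :=
  forall v, 0 <= qform (B - A) v.

Definition skew n (A : 'M[R]_n) : Prop := A^T = - A.

Definition max_eigenvalue n (A : 'M[R]_n) (a : R) : Prop :=
  eigenvalue A a /\ forall b, eigenvalue A b -> b <= a.

Definition vle n (u v : 'cV[R]_n) : Prop := forall k, u k 0 <= v k 0.

End LinearAlgebra.

Section Calculus.
Variable R : realType.

(* Class C^k; directional derivatives suffice for the successor case because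
   this is only used on finite-dimensional domains. *)
Fixpoint Cn (V W : normedModType R) (k : nat) (f : V -> W) : Prop :=
  match k with
  | 0 => continuous f
  | k'.+1 => (forall x, differentiable f x) /\
             forall v, Cn k' (fun x => 'D_v f x)
  end.

Definition jac m n (h : 'cV[R]_n -> 'cV[R]_m) (q : 'cV[R]_n) : 'M[R]_(m, n) :=
  \matrix_(k, l) ('D_(delta_mx l 0) h q) k 0.

Definition grad n (f : 'cV[R]_n -> R) (x : 'cV[R]_n) : 'cV[R]_n :=
  \col_k 'D_(delta_mx k 0) f x.

Definition hess n (f : 'cV[R]_n -> R) (x : 'cV[R]_n) : 'M[R]_n :=
  \matrix_(k, l) 'D_(delta_mx k 0) (fun y => 'D_(delta_mx l 0) f y) x.

Definition periodic2pi n (T : Type) (f : 'cV[R]_n -> T) : Prop :=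
  forall q l, f (q + (2 * pi) *: delta_mx l 0) = f q.

End Calculus.

(* A non-redundant manipulator (as many joints as task-space coordinates).
   Inertia, Coriolis and gravity terms are given as functions of the vector
   [th] of system parameters: the plant is obtained at [th = theta S], and the
   "hatted" quantities at [th] = the current estimate.  [region S] is the set
   of joint configurations, away from singularities, in which the system
   operates. *)
Record el_system (R : realType) (n : nat) := ElSystem {
  npar : nat;
  fkin : 'cV[R]_n -> 'cV[R]_n;
  inertia : 'cV[R]_npar -> 'cV[R]_n -> 'M[R]_n;
  coriolis : 'cV[R]_npar -> 'cV[R]_n -> 'cV[R]_n -> 'M[R]_n;
  gravity : 'cV[R]_npar -> 'cV[R]_n -> 'cV[R]_n;
  (* arguments: q, dq, reference velocity, reference acceleration *)
  regressor : 'cV[R]_n -> 'cV[R]_n -> 'cV[R]_n -> 'cV[R]_n -> 'M[R]_(n, npar);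
  theta : 'cV[R]_npar;
  theta_lb : 'cV[R]_npar;
  theta_ub : 'cV[R]_npar;
  fbar : 'cV[R]_n;
  region : set 'cV[R]_n }.

Section System.
Variables (R : realType) (n : nat) (S : el_system R n).
Implicit Types (th : 'cV[R]_(npar S)) (q dq : 'cV[R]_n).

Definition J q : 'M[R]_n := jac (@fkin R n S) q.

Definition Jdot q dq : 'M[R]_n := 'D_dq J q.

Definition tinertia th q : 'M[R]_n :=
  (invmx (J q))^T *m inertia th q *m invmx (J q).

Definition tcoriolis th q dq : 'M[R]_n :=
  (invmx (J q))^T *m coriolis th q dq *m invmx (J q)
  - (invmx (J q))^T *m inertia th q *m invmx (J q) *m Jdot q dq *m invmx (J q).

Definition tgravity th q : 'cV[R]_n := (invmx (J q))^T *m gravity th q.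

(* Smooth rigid-body model; a revolute joint makes the model 2*pi-periodic in
   its angle.  [fkin] itself need not be periodic (task-space orientations). *)
Record revolute_model : Prop := RevoluteModel {
  fkin_C2 : Cn 2 (@fkin R n S);
  inertia_C1 : forall th, Cn 1 (inertia th);
  coriolis_C0 : forall th,
    continuous (fun z : 'cV[R]_n * 'cV[R]_n => coriolis th z.1 z.2);
  gravity_C0 : forall th, continuous (gravity th);
  J_periodic : periodic2pi J;
  inertia_periodic : forall th, periodic2pi (inertia th);
  coriolis_periodic : forall th dq, periodic2pi (fun q => coriolis th q dq);
  gravity_periodic : forall th, periodic2pi (gravity th) }.

(* The task-space bounds are required on the operating region only: for a
   revolute manipulator they cannot hold uniformly up to the singularities.
   Taking [region S] to be all nonsingular configurations is allowed. *)
Record el_properties (lam1 lam2 c : R) (gamma : 'cV[R]_n) : Prop :=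
  ElProperties {
  region_nonsingular : forall q, region S q -> J q \in unitmx;
  inertia_bounds : exists l1 l2 : R,
    [/\ 0 < l1, 0 < l2
      & forall q, [/\ (inertia (theta S) q)^T = inertia (theta S) q,
                      loewner_le l1%:M (inertia (theta S) q)
                    & loewner_le (inertia (theta S) q) l2%:M]];
  tinertia_skew : forall q dq, region S q ->
    skew ('D_dq (tinertia (theta S)) q - 2 *: tcoriolis (theta S) q dq);
  lam1_gt0 : 0 < lam1;
  lam2_gt0 : 0 < lam2;
  tinertia_bounds : forall q, region S q ->
    [/\ (tinertia (theta S) q)^T = tinertia (theta S) q,
        loewner_le lam1%:M (tinertia (theta S) q)
      & loewner_le (tinertia (theta S) q) lam2%:M];
  c_gt0 : 0 < c;
  tcoriolis_bound : forall q dq y, region S q ->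
    enorm (tcoriolis (theta S) q dq *m y) <= c * enorm (J q *m dq) * enorm y;
  (* for every parameter vector, so that it also covers the estimates *)
  linear_param : forall th q dq v a, region S q ->
    tinertia th q *m a + tcoriolis th q dq *m v + tgravity th q
    = regressor S q dq v a *m th;
  theta_in_box : vle (theta_lb S) (theta S) /\ vle (theta S) (theta_ub S);
  tgravity_bound : forall q k, region S q ->
    `|tgravity (theta S) q k 0| <= gamma k 0;
  gamma_lt_fbar : forall k, gamma k 0 < fbar S k 0 }.

End System.

Section Potential.
Variable R : realType.

(* [phi Q] is the potential as a function of the SQUARED distance (smooth at
   the origin exactly when the potential is a smooth function of the relative
   position), so that d psi / d (|x|^2) is the derivative of [phi Q]. *)
Definition psi (phi : R -> R -> R) (Q d : R) : R := phi Q (d ^+ 2).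

Definition psi_vec n phi Q (y : 'cV[R]_n) : R := psi phi Q (enorm y).

Record potential (n : nat) (r : R) (phi : R -> R -> R) (sigma nu : R -> R) :
    Prop := IsPotential {
  pot_smooth : forall Q, 0 < Q -> forall k u, 0 <= u <= r ^+ 2 ->
    derivable (derive1n k (phi Q)) u 1;
  pot_posdef : forall Q, 0 < Q ->
    psi phi Q 0 = 0 /\ forall d, 0 < d <= r -> 0 < psi phi Q d;
  pot_increasing : forall Q, 0 < Q -> forall d d', 0 <= d -> d < d' -> d' <= r ->
    psi phi Q d < psi phi Q d';
  pot_bounded : forall Q, 0 < Q ->
    exists B, forall d, 0 <= d <= r -> psi phi Q d <= B;
  pot_slope : forall Q, 0 < Q -> forall d, 0 <= d <= r ->
    0 <= derive1 (phi Q) (d ^+ 2) < sigma Q;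
  pot_hess : forall Q, 0 < Q -> forall y : 'cV[R]_n, enorm y <= r ->
    posdef (hess (@psi_vec n phi Q) y) /\
    loewner_le (hess (@psi_vec n phi Q) y) (nu Q)%:M;
  pot_tunable : forall (eps : R) (K : nat), 0 < eps < r -> (0 < K)%N ->
    exists2 Q, 0 < Q &
      forall d, 0 <= d <= r - eps -> K%:R * psi phi Q d < psi phi Q r }.

End Potential.

Section Projection.
Variable R : realType.
Implicit Types lb ub delta th w : R.

Definition ups_lb lb delta th : R := Num.min 1 ((lb + delta - th) / delta).
Definition ups_ub ub delta th : R := Num.min 1 ((th - ub + delta) / delta).

Definition proj1 lb ub delta th w : R :=
  if (lb <= th <= lb + delta) && (w < 0) then (1 - ups_lb lb delta th) * w
  else if (ub - delta <= th <= ub) && (0 < w) then (1 - ups_ub ub delta th) * w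
  else w.

Definition proj p (lb ub : 'cV[R]_p) delta (th w : 'cV[R]_p) : 'cV[R]_p :=
  \col_k proj1 (lb k 0) (ub k 0) delta (th k 0) (w k 0).

End Projection.

Record trajectory (R : realType) (n N : nat) (S : 'I_N -> el_system R n) :=
  Trajectory {
  tq : 'I_N -> R -> 'cV[R]_n;
  tdq : 'I_N -> R -> 'cV[R]_n;
  tddq : 'I_N -> R -> 'cV[R]_n;
  that : forall i, R -> 'cV[R]_(npar (S i));
  tf : 'I_N -> R -> 'cV[R]_n }.

Section Network.
Variables (R : realType) (n N : nat) (S : 'I_N -> el_system R n).
Variables (E0 : rel 'I_N) (phi : R -> R -> R) (Q alpha : R).
Variables (mu kappa beta : 'I_N -> R) (delta : R).
Variable X : trajectory S.
Implicit Types (i j : 'I_N) (t : R).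

Definition nbrs i : {set 'I_N} := [set j | E0 j i].

Definition pos i t : 'cV[R]_n := fkin (S i) (tq X i t).
Definition vel i t : 'cV[R]_n := J (S i) (tq X i t) *m tdq X i t.
Definition relpos i j t : 'cV[R]_n := pos i t - pos j t.

Definition err i t : 'cV[R]_n :=
  \sum_(j in nbrs i) grad (fun y => psi_vec phi Q (y - pos j t)) (pos i t).

Definition derr i t : 'cV[R]_n :=
  \sum_(j in nbrs i)
    hess (@psi_vec R n phi Q) (relpos i j t) *m (vel i t - vel j t).

Definition slide i t : 'cV[R]_n := vel i t + alpha *: err i t.

(* The regressor used by the controller, at reference velocity -alpha e and
   reference acceleration -alpha de. *)
Definition Phi i t : 'M[R]_(n, npar (S i)) :=
  regressor (S i) (tq X i t) (tdq X i t)
    (- (alpha *: err i t)) (- (alpha *: derr i t)).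

Definition fhat i t : 'cV[R]_n :=
  Phi i t *m that X i t - kappa i *: slide i t - mu i *: vel i t.

Definition omega i t : 'cV[R]_(npar (S i)) :=
  - (beta i *: ((Phi i t)^T *m slide i t)).

Definition within_limits i (f : 'cV[R]_n) : Prop :=
  forall k, `|f k 0| <= fbar (S i) k 0.

(* Applied wrench under bounded actuation: on saturation the adaptive and
   damping terms keep priority and the gain of the remaining term is reduced. *)
Definition saturated_actuation : Prop := forall i t, 0 <= t ->
  [/\ within_limits i (tf X i t),
      within_limits i (fhat i t) -> tf X i t = fhat i t
    & ~ within_limits i (fhat i t) ->
      exists2 kh, 0 < kh <= kappa i &
        tf X i t = Phi i t *m that X i t - kh *: slide i t - mu i *: vel i t].

(* Classical solution on [0, +oo[ staying in the operating regions: the states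
   are continuous on [0, +oo[ and differentiable on ]0, +oo[. *)
Record closed_loop : Prop := ClosedLoop {
  in_region : forall i t, 0 <= t -> region (S i) (tq X i t);
  q_cont : forall i, {within `[0, +oo[%classic, continuous (tq X i)};
  dq_cont : forall i, {within `[0, +oo[%classic, continuous (tdq X i)};
  that_cont : forall i, {within `[0, +oo[%classic, continuous (that X i)};
  q_deriv : forall i t, 0 < t -> is_derive t 1 (tq X i) (tdq X i t);
  dq_deriv : forall i t, 0 < t -> is_derive t 1 (tdq X i) (tddq X i t);
  dynamics : forall i t, 0 < t ->
    inertia (theta (S i)) (tq X i t) *m tddq X i t
    + coriolis (theta (S i)) (tq X i t) (tdq X i t) *m tdq X i t
    + gravity (theta (S i)) (tq X i t)
    = (J (S i) (tq X i t))^T *m tf X i t;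
  actuation : saturated_actuation;
  adaptation : forall i t, 0 < t ->
    is_derive t 1 (that X i)
      (proj (theta_lb (S i)) (theta_ub (S i)) delta (that X i t) (omega i t));
  that_init : forall i,
    vle (theta_lb (S i)) (that X i 0) /\ vle (that X i 0) (theta_ub (S i)) }.

End Network.

(* Main.v *)
Require Import Defs.
From HB Require Import structures.
From mathcomp Require Import all_boot all_order all_algebra.
From mathcomp Require Import all_classical all_reals all_analysis.
From mathcomp Require Import ring lra.
Set Implicit Arguments.
Unset Strict Implicit.
Unset Printing Implicit Defensive.
Import Order.TTheory GRing.Theory Num.Theory.
Import numFieldNormedType.Exports.
Local Open Scope classical_set_scope.
Local Open Scope ring_scope.

(** The network has a Lyapunov function [lyapunov]: the kinetic energy
    [s^T M s] of the sliding variables [s = v + alpha * e], the squared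
    estimation errors and the potentials of the initial links, weighted by
    [(alpha * mu i)^-1] and [(beta i)^-1].  Along the closed loop, the skew
    symmetry of [dM/dt - 2 C] and the projected adaptation cancel the parametric
    errors, and the damping [- mu i * v] returns exactly the power exchanged with
    the potential; what is left is dissipation, [|v|^2 / alpha] plus a positive
    multiple of the gain actually applied times [|s|^2] ([der_lyapunov]).  This
    holds whether or not the actuators saturate.

    Preservation of the links follows from the energy alone.  By condition (b)
    the initial energy is less than [psi r], the energy of a single link of length
    [r]; since the energy does not increase while all links are shorter than [r],
    no link can be the first to reach that length ([stays_connected]).

    Convergence needs more, because under saturation the gain of [s] may become
    arbitrarily small.  First, the dissipation and the boundedness of the
    accelerations make the velocities vanish by Barbalat's lemma
    ([vel_vanishing]).  The joint angles then move ever more slowly, and as the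
    model is periodic in them, the computed wrench is asymptotically uniformly
    continuous ([mtame_fhat]).  Now suppose that some component of the computed
    wrench exceeded its limit at a late time.  The applied wrench differs from it
    by at most [kappa i * |s|], hence by condition (a) it would exceed gravity by
    a fixed margin, and would do so for a fixed duration by uniform continuity;
    the momentum [M v] would change by a fixed amount, although it vanishes.  So
    saturation eventually stops ([eventually_within_limits]), the gain is
    [kappa i], and Barbalat's lemma applies to [s] ([slide_vanishing]).

    Finally [e = (s - v) / alpha] vanishes.  Forces being opposite along each
    link, the work of the errors along the displacements to a common system is a
    sum of nonnegative contributions of the links, which therefore vanish
    ([attraction_vanishing]).  Positive definiteness of the Hessian of the
    potential makes the attraction increase with the distance
    ([attraction_incr]), so the links shrink to zero, and the graph is
    connected. *)

(** * Calculus of matrix-valued functions *)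

Section MatrixCalculus.
Context {R : realType}.

Lemma cvg_mxP (T : Type) (F : set_system T) {FF : Filter F} m n
    (f : T -> 'M[R]_(m, n)) (M : 'M[R]_(m, n)) :
  f @ F --> M <-> forall i j, f x i j @[x --> F] --> M i j.
Proof.
split=> [fM i j|fM].
  apply: (@cvg_comp _ _ _ f (fun N : 'M[R]_(m, n) => N i j) F (nbhs M)) => //.
  exact: coord_continuous.
move=> A [P MP PA].
rewrite nbhs_filterE /=; near=> x; apply: PA => /= i j.
by move: i j; near: x; do 2! apply: filter_forall => ?; apply: fM; exact: MP.
Unshelve. all: by end_near. Qed.

Lemma continuous_mxP (T : topologicalType) m n (f : T -> 'M[R]_(m, n)) x :
  {for x, continuous f} <-> forall i j, {for x, continuous (fun y => f y i j)}.
Proof. exact: (@cvg_mxP _ (nbhs x) _ _ _ f (f x)). Qed.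

Lemma is_derive_mxP {V : normedModType R} m n (M : V -> 'M[R]_(m, n)) dM x v :
  is_derive x v M dM <->
  forall i j, is_derive x v (fun y => M y i j) (dM i j).
Proof.
split=> [[Mx <-] i j|Mx].
  split; first exact: (derivable_mxP M x v).1 Mx i j.
  by rewrite derive_mx // mxE.
have dM' : derivable M x v by apply/derivable_mxP => i j; case: (Mx i j).
by split=> //; rewrite derive_mx //; apply/matrixP => i j; rewrite mxE; case: (Mx i j).
Qed.

Section ScalarRules.
Context {V : normedModType R}.
Implicit Types (f g : V -> R) (x v : V).

Lemma der_add f g x v df dg : is_derive x v f df -> is_derive x v g dg ->
  is_derive x v (fun y => f y + g y) (df + dg).
Proof. by move=> hf hg; exact: is_deriveD. Qed.

Lemma der_opp f x v df : is_derive x v f df ->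
  is_derive x v (fun y => - f y) (- df).
Proof. by move=> hf; exact: is_deriveN. Qed.

Lemma der_mul f g x v df dg : is_derive x v f df -> is_derive x v g dg ->
  is_derive x v (fun y => f y * g y) (df * g x + f x * dg).
Proof.
move=> hf hg; apply: (is_derive_eq (is_deriveM hf hg)).
by rewrite /GRing.scale /=; ring.
Qed.

Lemma der_scale c f x v df : is_derive x v f df ->
  is_derive x v (fun y => c * f y) (c * df).
Proof. by move=> hf; exact: (is_deriveZ c hf). Qed.

Lemma der_sum (I : finType) (P : pred I) (h : I -> V -> R) dh x v :
  (forall i, P i -> is_derive x v (h i) (dh i)) ->
  is_derive x v (fun y => \sum_(i | P i) h i y) (\sum_(i | P i) dh i).
Proof.
move=> H; have -> : (fun y => \sum_(i | P i) h i y) = \sum_(i | P i) h i.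
  by apply/funext => y; rewrite fct_sumE.
by elim/big_ind2 : _ => [|f df g dg|//]; [exact: is_derive_cst|exact: is_deriveD].
Qed.

End ScalarRules.

Lemma der_mulmx {V : normedModType R} m n p (A : V -> 'M[R]_(m, n))
    (B : V -> 'M[R]_(n, p)) dA dB x v :
  is_derive x v A dA -> is_derive x v B dB ->
  is_derive x v (fun y => A y *m B y) (dA *m B x + A x *m dB).
Proof.
move=> /is_derive_mxP hA /is_derive_mxP hB; apply/is_derive_mxP => i j.
have -> : (fun y => (A y *m B y) i j) = (fun y => \sum_k A y i k * B y k j).
  by apply/funext => y; rewrite mxE.
rewrite !mxE -big_split /=; apply: der_sum => k _.
exact: der_mul.
Qed.

Lemma der_trmx {V : normedModType R} m n (A : V -> 'M[R]_(m, n)) dA x v :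
  is_derive x v A dA -> is_derive x v (fun y => (A y)^T) dA^T.
Proof.
move=> /is_derive_mxP hA; apply/is_derive_mxP => i j; rewrite mxE.
have -> : (fun y => (A y)^T i j) = (fun y => A y j i) by apply/funext => y; rewrite mxE.
exact: hA.
Qed.

(** The determinant and the cofactors are polynomials in the entries: any class
    of functions stable under ring operations that contains the entries of a
    matrix contains its determinant and adjugate.  This serves for continuity
    and for derivability. *)
Definition ring_stable (T : Type) (P : (T -> R) -> Prop) :=
  [/\ forall c, P (cst c),
      forall f g, P f -> P g -> P (fun x => f x + g x)
    & forall f g, P f -> P g -> P (fun x => f x * g x)].

Lemma stable_sum (T : Type) (P : (T -> R) -> Prop) (I : finType) (D : pred I)
    (h : I -> T -> R) :
  ring_stable P -> (forall i, D i -> P (h i)) -> P (fun x => \sum_(i | D i) h i x).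
Proof.
move=> [Pc PD _] Ph; have -> : (fun y => \sum_(i | D i) h i y) = \sum_(i | D i) h i.
  by apply/funext => y; rewrite fct_sumE.
by elim/big_ind : _ => [|f g|i Di]; [exact: (Pc 0)|exact: PD|exact: Ph].
Qed.

Lemma stable_mulmx (T : Type) (P : (T -> R) -> Prop) m n p
    (A : T -> 'M[R]_(m, n)) (B : T -> 'M[R]_(n, p)) :
  ring_stable P -> (forall i j, P (fun x => A x i j)) ->
  (forall i j, P (fun x => B x i j)) -> forall i j, P (fun x => (A x *m B x) i j).
Proof.
move=> Ps PA PB i j.
have -> : (fun x => (A x *m B x) i j) = (fun x => \sum_k A x i k * B x k j).
  by apply/funext => y; rewrite mxE.
have [_ _ PM] := Ps; apply: stable_sum => // k _; exact: PM.
Qed.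

Lemma det_stable (T : Type) (P : (T -> R) -> Prop) n (A : T -> 'M[R]_n) :
  ring_stable P -> (forall i j, P (fun x => A x i j)) -> P (fun x => \det (A x)).
Proof.
move=> Ps PA; have [Pc PD PM] := Ps; rewrite /determinant.
have P_prod (I : finType) (h : I -> T -> R) :
    (forall i, P (h i)) -> P (fun x => \prod_i h i x).
  move=> Ph; have -> : (fun y => \prod_i h i y) = \prod_i h i.
    by apply/funext => y; elim/big_ind2 : _ => // a f b g -> ->.
  by elim/big_ind : _ => [|f g|i _]; [exact: (Pc 1)|exact: PM|exact: Ph].
by apply: stable_sum => // s _; apply: PM; [exact: Pc|apply: P_prod].
Qed.

Lemma adj_stable (T : Type) (P : (T -> R) -> Prop) n (A : T -> 'M[R]_n) i j :
  ring_stable P -> (forall i j, P (fun x => A x i j)) ->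
  P (fun x => (\adj (A x)) i j).
Proof.
move=> Ps PA; have [Pc _ PM] := Ps.
have -> : (fun x => (\adj (A x)) i j) =
    (fun x => cst ((-1) ^+ (j + i)) x * \det (row' j (col' i (A x)))).
  by apply/funext => x; rewrite mxE.
apply: PM; first exact: Pc; apply: det_stable => // k l.
have -> : (fun x => (row' j (col' i (A x))) k l) =
    (fun x => A x (lift j k) (lift i l)) by apply/funext => x; rewrite !mxE.
exact: PA.
Qed.

Lemma invmx_entry n (A : 'M[R]_n) i j : A \in unitmx ->
  invmx A i j = (\det A)^-1 * (\adj A) i j.
Proof. by move=> uA; rewrite /invmx uA mxE. Qed.

Lemma continuous_ring_stable (T : topologicalType) (x : T) :
  @ring_stable T (fun f => {for x, continuous f}).
Proof.
by split=> [c|f g|f g]; [exact: cvg_cst|exact: continuousD|exact: continuousM].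
Qed.

Lemma derivable_ring_stable (V : normedModType R) (x v : V) :
  @ring_stable V (fun f => derivable f x v).
Proof.
by split=> [c|f g|f g]; [exact: derivable_cst|exact: derivableD|exact: derivableM].
Qed.

Lemma continuous_invmx (T : topologicalType) n (A : T -> 'M[R]_n) (x : T) :
  {for x, continuous A} -> A x \in unitmx ->
  {for x, continuous (fun y => invmx (A y))}.
Proof.
move=> /cvg_mxP cA uA.
have cdet : {for x, continuous (fun y => \det (A y))}.
  by apply: det_stable => //; exact: continuous_ring_stable.
have det0 : \det (A x) != 0 by rewrite -unitfE -unitmxE.
apply/cvg_mxP => i j; rewrite invmx_entry //.
have H : (\det (A y))^-1 * (\adj (A y)) i j @[y --> x] -->
    (\det (A x))^-1 * (\adj (A x)) i j.
  apply: cvgM; first exact: cvgV.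
  by apply: (@adj_stable _ (fun f => {for x, continuous f})) => //;
    exact: continuous_ring_stable.
apply: cvg_trans H; apply: near_eq_cvg.
have : \forall y \near x, \det (A y) != 0.
  by apply: (cdet [set d | d != 0]); apply: open_nbhs_nbhs; split => //; exact: open_neq.
apply: filterS => y /= dy; rewrite invmx_entry //.
by rewrite unitmxE unitfE.
Qed.

Lemma der_invmx n (A : R -> 'M[R]_n) (dA : 'M[R]_n) (t : R) :
  is_derive t 1 A dA -> A t \in unitmx ->
  is_derive t 1 (fun s => invmx (A s)) (- (invmx (A t) *m dA *m invmx (A t))).
Proof.
move=> hA uA; have /is_derive_mxP hA' := hA.
have dent i j : derivable (fun s => A s i j) t 1 by case: (hA' i j).
have ddet : derivable (fun s => \det (A s)) t 1.
  apply: (@det_stable _ (fun f => derivable f t 1)); last exact: dent.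
  exact: derivable_ring_stable.
have det0 : \det (A t) != 0 by rewrite -unitfE -unitmxE.
have nu : \forall s \near t, A s \in unitmx.
  have cdet : {for t, continuous (fun y => \det (A y))}.
    by apply: differentiable_continuous; apply/derivable1_diffP.
  have : \forall y \near t, \det (A y) != 0.
    by apply: (cdet [set d | d != 0]); apply: open_nbhs_nbhs; split => //; exact: open_neq.
  by apply: filterS => s; rewrite unitmxE unitfE.
have dinv : derivable (fun s => invmx (A s)) t 1.
  apply/derivable_mxP => i j.
  apply: (@near_eq_derivable _ _ _ (fun s => (\det (A s))^-1 * (\adj (A s)) i j)).
    by apply: filterS nu => s us; rewrite invmx_entry.
  apply: derivableM; first exact: derivableV.
  apply: (@adj_stable _ (fun f => derivable f t 1)); last exact: dent.
  exact: derivable_ring_stable.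
have hI := derivableP dinv.
split=> //; have [_ e1] := der_mulmx hA hI.
have : 'D_1 (fun s => A s *m invmx (A s)) t = 0.
  rewrite (near_eq_derive _ (g := cst 1%:M)) ?derive_cst //.
  by apply: filterS nu => s us; rewrite mulmxV.
rewrite e1 => /eqP; rewrite addrC addr_eq0 => /eqP e2.
by rewrite -[LHS](mulKmx uA) e2 mulmxN mulmxA.
Qed.

Lemma der_curve (V W : normedModType R) (F : V -> W) (g : R -> V) (t : R) (dg : V) :
  differentiable F (g t) -> is_derive t 1 g dg ->
  is_derive t 1 (fun s => F (g s)) ('D_dg F (g t)).
Proof.
move=> dF [/derivable1_diffP hg <-].
have dFg : differentiable (F \o g) t by exact: differentiable_comp.
split; first exact/derivable1_diffP.
have -> : 'D_1 (fun s => F (g s)) t = 'd (F \o g) t 1 by rewrite -deriveE.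
by rewrite diff_comp //= -deriveE // -deriveE.
Qed.

Lemma der_line (V W : normedModType R) (F : V -> W) (x v : V) (d : W) :
  is_derive (0 : R) 1 (fun h : R => F (h *: v + x)) d -> is_derive x v F d.
Proof.
move=> [h1 h2]; split; first exact/derivable1P.
rewrite -h2 /derive; set g1 := fun h => h^-1 *: _; set g2 := fun h => h^-1 *: _.
suff -> : g1 = g2 by [].
by apply/funext => h; rewrite /g1 /g2 /= addr0 scale0r add0r [_%:A]mulr1.
Qed.

Lemma der_line_id (V : normedModType R) (x v : V) :
  is_derive (0 : R) 1 (fun h : R => h *: v + x) v.
Proof.
have hZ : is_derive (0 : R) 1 (fun h : R => h *: v) v.
  have dl : differentiable (fun h : R => h *: v) (0 : R) by [].
  split; first exact/derivable1_diffP.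
  rewrite deriveE // diff_val /= ?scale1r //.
have hC : is_derive (0 : R) 1 (fun _ : R => x) 0 by exact: is_derive_cst.
by apply: is_derive_eq (is_deriveD hZ hC) _; rewrite addr0.
Qed.

Lemma derive_basis n (W : normedModType R) (F : 'cV[R]_n -> W) x v :
  differentiable F x ->
  'D_v F x = \sum_l v l 0 *: 'D_(delta_mx l 0) F x.
Proof.
move=> dF; rewrite deriveE //.
have -> : v = \sum_l v l 0 *: delta_mx l 0.
  rewrite [LHS]matrix_sum_delta; apply: eq_bigr => i _.
  by rewrite big_ord1.
rewrite linear_sum /=; apply: eq_bigr => i _.
rewrite linearZ /= -deriveE //; congr (_ *: _).
rewrite summxE (bigD1 i) //= big1 ?addr0 => [|k ki]; last first.
  by rewrite !mxE eq_sym (negbTE ki) mulr0.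
by rewrite !mxE !eqxx mulr1.
Qed.

End MatrixCalculus.

(** * Euclidean norm and quadratic forms *)

Section LinearAlgebra.
Context {R : realType}.

Lemma cvg_mulmx (T : Type) (F : set_system T) {FF : Filter F} m n p
    (f : T -> 'M[R]_(m, n)) (g : T -> 'M[R]_(n, p)) (A : 'M[R]_(m, n)) (B : 'M[R]_(n, p)) :
  f @ F --> A -> g @ F --> B -> (fun x => f x *m g x) @ F --> A *m B.
Proof.
move=> /cvg_mxP fA /cvg_mxP gB; apply/cvg_mxP => i j; rewrite mxE.
have -> : (fun x => (f x *m g x) i j) = (fun x => \sum_k f x i k * g x k j).
  by apply/funext => y; rewrite mxE.
apply: cvg_big => [|k _]; first exact: add_continuous.
exact: cvgM.
Qed.

Lemma cvg_trmx (T : Type) (F : set_system T) {FF : Filter F} m n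
    (f : T -> 'M[R]_(m, n)) (A : 'M[R]_(m, n)) :
  f @ F --> A -> (fun x => (f x)^T) @ F --> A^T.
Proof.
move=> /cvg_mxP fA; apply/cvg_mxP => i j; rewrite mxE.
have -> : (fun y => (f y)^T i j) = (fun y => f y j i) by apply/funext => y; rewrite mxE.
exact: fA.
Qed.

Definition dot n (u v : 'cV[R]_n) : R := (u^T *m v) 0 0.

Lemma dotE n (u v : 'cV[R]_n) : dot u v = \sum_k u k 0 * v k 0.
Proof. by rewrite /dot mxE; apply: eq_bigr => k _; rewrite mxE. Qed.

Lemma dotC n (u v : 'cV[R]_n) : dot u v = dot v u.
Proof. by rewrite !dotE; apply: eq_bigr => k _; rewrite mulrC. Qed.

Lemma dotDr n (u v w : 'cV[R]_n) : dot u (v + w) = dot u v + dot u w.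
Proof. by rewrite /dot mulmxDr mxE. Qed.

Lemma dotNr n (u v : 'cV[R]_n) : dot u (- v) = - dot u v.
Proof. by rewrite /dot mulmxN mxE. Qed.

Lemma dotBr n (u v w : 'cV[R]_n) : dot u (v - w) = dot u v - dot u w.
Proof. by rewrite dotDr dotNr. Qed.

Lemma dotZr n a (u v : 'cV[R]_n) : dot u (a *: v) = a * dot u v.
Proof. by rewrite /dot -scalemxAr mxE. Qed.

Lemma dotDl n (u v w : 'cV[R]_n) : dot (v + w) u = dot v u + dot w u.
Proof. by rewrite ![dot _ u]dotC dotDr. Qed.

Lemma dotBl n (u v w : 'cV[R]_n) : dot (v - w) u = dot v u - dot w u.
Proof. by rewrite ![dot _ u]dotC dotBr. Qed.

Lemma dotZl n a (u v : 'cV[R]_n) : dot (a *: v) u = a * dot v u.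
Proof. by rewrite ![dot _ u]dotC dotZr. Qed.

Lemma dot_sumr n (I : finType) (P : pred I) (u : 'cV[R]_n) (v : I -> 'cV[R]_n) :
  dot u (\sum_(i | P i) v i) = \sum_(i | P i) dot u (v i).
Proof. by rewrite /dot mulmx_sumr summxE. Qed.

Lemma dot_mulmx n m (u : 'cV[R]_n) (A : 'M[R]_(n, m)) (v : 'cV[R]_m) :
  dot u (A *m v) = dot (A^T *m u) v.
Proof. by rewrite /dot trmx_mul trmxK mulmxA. Qed.

Lemma qformE n (A : 'M[R]_n) v : qform A v = dot v (A *m v).
Proof. by rewrite /qform /dot mulmxA. Qed.

Lemma sum_sqr_ge0 n (v : 'cV[R]_n) : 0 <= \sum_k v k 0 ^+ 2.
Proof. by apply: sumr_ge0 => k _; exact: sqr_ge0. Qed.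

Lemma enorm_ge0 n (v : 'cV[R]_n) : 0 <= enorm v.
Proof. exact: sqrtr_ge0. Qed.

Lemma enorm_sqr n (v : 'cV[R]_n) : enorm v ^+ 2 = \sum_k v k 0 ^+ 2.
Proof. by rewrite sqr_sqrtr // sum_sqr_ge0. Qed.

Lemma dotvv n (v : 'cV[R]_n) : dot v v = enorm v ^+ 2.
Proof. by rewrite dotE enorm_sqr; apply: eq_bigr => k _; rewrite expr2. Qed.

Lemma enorm0 n : enorm (0 : 'cV[R]_n) = 0.
Proof. by rewrite /enorm big1 ?sqrtr0 // => k _; rewrite mxE expr0n. Qed.

Lemma enorm_eq0 n (v : 'cV[R]_n) : enorm v = 0 -> v = 0.
Proof.
move=> v0; have : \sum_k v k 0 ^+ 2 = 0 by rewrite -enorm_sqr v0 expr0n.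
move=> /eqP; rewrite psumr_eq0 => [/allP H|k _]; last exact: sqr_ge0.
apply/matrixP => k j; rewrite ord1 mxE; apply/eqP.
by rewrite -sqrf_eq0; apply: H; rewrite mem_index_enum.
Qed.

Lemma enormN n (v : 'cV[R]_n) : enorm (- v) = enorm v.
Proof. by rewrite /enorm; congr Num.sqrt; apply: eq_bigr => k _; rewrite mxE sqrrN. Qed.

Lemma enormZ n a (v : 'cV[R]_n) : enorm (a *: v) = `|a| * enorm v.
Proof.
rewrite /enorm -sqrtr_sqr -sqrtrM ?sqr_ge0 // mulr_sumr; congr Num.sqrt.
by apply: eq_bigr => k _; rewrite mxE exprMn.
Qed.

Lemma entry_le_enorm n (v : 'cV[R]_n) k : `|v k 0| <= enorm v.
Proof.
rewrite -sqrtr_sqr; apply: ler_wsqrtr.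
by rewrite (bigD1 k) //= lerDl sumr_ge0 // => i _; exact: sqr_ge0.
Qed.

Lemma cauchy_schwarz_sqr n (u v : 'cV[R]_n) :
  dot u v ^+ 2 <= enorm u ^+ 2 * enorm v ^+ 2.
Proof.
have [v0|v0] := eqVneq v 0.
  by rewrite v0 -(scale0r (0 : 'cV[R]_n)) dotZr mul0r expr0n /= mulr_ge0 // sqr_ge0.
have a0 : 0 < enorm v ^+ 2.
  rewrite exprn_gt0 // lt_neqAle enorm_ge0 andbT eq_sym.
  by apply: contra v0 => /eqP /enorm_eq0 ->.
have : 0 <= dot (enorm v ^+ 2 *: u - dot u v *: v) (enorm v ^+ 2 *: u - dot u v *: v).
  by rewrite dotvv sqr_ge0.
rewrite dotBl !dotBr !dotZl !dotZr (dotC v u) !dotvv.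
set a := enorm v ^+ 2 in a0 *; set b := dot u v; set c := enorm u ^+ 2.
have -> : a * (a * c) - a * (b * b) - (b * (a * b) - b * (b * a)) =
          a * (c * a - b ^+ 2) by ring.
by rewrite pmulr_rge0 // subr_ge0.
Qed.

Lemma cauchy_schwarz n (u v : 'cV[R]_n) : `|dot u v| <= enorm u * enorm v.
Proof.
rewrite -ler_sqr ?nnegrE ?mulr_ge0 ?enorm_ge0 //.
by rewrite real_normK ?num_real // exprMn cauchy_schwarz_sqr.
Qed.

Lemma ler_enormD n (u v : 'cV[R]_n) : enorm (u + v) <= enorm u + enorm v.
Proof.
rewrite -ler_sqr ?nnegrE ?addr_ge0 ?enorm_ge0 //.
rewrite -dotvv dotDl !dotDr !dotvv (dotC v u).
have := le_trans (ler_norm _) (cauchy_schwarz u v); lra.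
Qed.

Lemma enorm_le_entries n (v : 'cV[R]_n) : enorm v <= \sum_k `|v k 0|.
Proof.
have S0 : 0 <= \sum_k `|v k 0| by apply: sumr_ge0.
rewrite -ler_sqr ?nnegrE ?enorm_ge0 // enorm_sqr expr2 mulr_suml.
apply: ler_sum => k _; rewrite -real_normK ?num_real // expr2.
by rewrite ler_wpM2l // (bigD1 k) //= lerDl sumr_ge0.
Qed.

Lemma qform_scalar n a (v : 'cV[R]_n) : qform a%:M v = a * enorm v ^+ 2.
Proof. by rewrite qformE mul_scalar_mx dotZr dotvv. Qed.

Lemma qformB n (A B : 'M[R]_n) v : qform (A - B) v = qform A v - qform B v.
Proof. by rewrite !qformE mulmxBl dotBr. Qed.

Lemma qform0 n (A : 'M[R]_n) : qform A 0 = 0.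
Proof. by rewrite qformE mulmx0 /dot mulmx0 mxE. Qed.

Lemma loewner_lb n a (A : 'M[R]_n) v : loewner_le a%:M A ->
  a * enorm v ^+ 2 <= qform A v.
Proof. by move=> /(_ v); rewrite qformB qform_scalar subr_ge0. Qed.

Lemma loewner_ub n a (A : 'M[R]_n) v : loewner_le A a%:M ->
  qform A v <= a * enorm v ^+ 2.
Proof. by move=> /(_ v); rewrite qformB qform_scalar subr_ge0. Qed.

Lemma small_step_nonneg (c d : R) : 0 <= d -> 0 <= c ->
  (forall s, 0 <= - (2 * s * c) + s ^+ 2 * d) -> c = 0.
Proof.
move=> d0 c0 /(_ (c / (d + 1))).
have -> : - (2 * (c / (d + 1)) * c) + (c / (d + 1)) ^+ 2 * d =
   - ((c / (d + 1)) ^+ 2 * (d + 2)).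
  by field; rewrite gt_eqF //; lra.
rewrite oppr_ge0 => h.
have /eqP : (c / (d + 1)) ^+ 2 * (d + 2) = 0.
  by apply/eqP; rewrite eq_le h mulr_ge0 ?sqr_ge0 //; lra.
rewrite mulf_eq0 sqrf_eq0 mulf_eq0 invr_eq0 => /orP[/orP[/eqP //|]|] /eqP; lra.
Qed.

(** A positive semidefinite form vanishes only on the kernel of its matrix:
    otherwise it would be negative at [w - s *: (B *m w)] for small [s > 0]. *)
Lemma psd_kernel n (B : 'M[R]_n) w : B^T = B -> (forall v, 0 <= qform B v) ->
  qform B w = 0 -> B *m w = 0.
Proof.
move=> sB pB qw; apply: enorm_eq0; apply/eqP; rewrite -sqrf_eq0; apply/eqP.
set u := B *m w; set c := enorm u ^+ 2; set d := qform B u.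
have d0 : 0 <= d by exact: pB.
have c0 : 0 <= c by exact: sqr_ge0.
have key s : 0 <= - (2 * s * c) + s ^+ 2 * d.
  have := pB (w - s *: u); rewrite qformE mulmxBr -scalemxAr dotBl !dotBr.
  rewrite !dotZl !dotZr -!qformE qw -/u.
  rewrite dot_mulmx sB -/u -/d dotvv -/c; lra.
exact: small_step_nonneg d0 c0 key.
Qed.

(** The maximum of the quadratic form over the unit sphere, which exists by
    compactness, is an eigenvalue by [psd_kernel], hence at most the largest
    one. *)
Lemma qform_le_max_eigenvalue n (A : 'M[R]_n) a v : A^T = A ->
  max_eigenvalue A a -> qform A v <= a * enorm v ^+ 2.
Proof.
move=> sA [_ amax].
have [->|v0] := eqVneq v 0.
  by rewrite qform0 enorm0 expr0n mulr0.
have nz (u : 'cV[R]_n) : u != 0 -> 0 < enorm u.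
  move=> u0; rewrite lt_neqAle enorm_ge0 andbT eq_sym.
  by apply: contra u0 => /eqP /enorm_eq0 ->.
have unit_norm (u : 'cV[R]_n) : u != 0 -> enorm ((enorm u)^-1 *: u) = 1.
  move=> u0; rewrite enormZ ger0_norm ?invr_ge0 ?enorm_ge0 //.
  by rewrite mulVf // gt_eqF // nz.
pose f (w : 'rV[R]_n) := qform A w^T.
pose S := [set w : 'rV[R]_n | dot w^T w^T = 1].
have ctr : continuous (fun w : 'rV[R]_n => w^T).
  by move=> w; apply: (@cvg_trmx _ (nbhs w) _ _ _ id); exact: cvg_id.
have cdot (g : 'rV[R]_n -> 'cV[R]_n) : continuous g ->
    continuous (fun w => dot w^T (g w)).
  move=> cg w; have /cvg_mxP : (fun x : 'rV[R]_n => (x^T)^T *m g x) @ w --> (w^T)^T *m g w.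
    exact: (cvg_mulmx (cvg_trmx (ctr w)) (cg w)).
  exact.
have cf : continuous f.
  rewrite (_ : f = fun w => dot w^T (A *m w^T)); last first.
    by apply/funext => w; rewrite /f qformE.
  by apply: cdot => w; exact: (cvg_mulmx (cvg_cst A) (ctr w)).
have S0 : S !=set0.
  exists ((enorm v)^-1 *: v)^T; rewrite /S /= trmxK dotvv unit_norm // expr1n //.
have cS : compact S.
  apply: bounded_closed_compact.
    exists 1; split; first exact: num_real.
    move=> M M1 w; rewrite /S /= dotvv => nw.
    have n1 : enorm w^T = 1.
      by apply/eqP; rewrite -(eqrXn2 (ltn0Sn 1)) ?enorm_ge0 // nw expr1n.
    rewrite [leLHS]/Num.Def.normr /= mx_normrE; apply: bigmax_le => [|[i j] _ /=].
      exact: ltW (lt_trans ltr01 M1).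
    by rewrite ord1; have := entry_le_enorm w^T j; rewrite mxE n1; lra.
  rewrite (_ : S = (fun w : 'rV[R]_n => dot w^T w^T) @^-1` [set 1]); last by [].
  apply: closed_comp => [w _|]; first exact: cdot.
  exact: closed_eq.
have [w0 w0S wmax] := EVT_max_rV S0 cS (continuous_subspaceT cf).
set w := w0^T; set m := f w0.
have nw : enorm w ^+ 2 = 1 by move: w0S; rewrite inE /S /= dotvv.
have le_m u : qform A u <= m * enorm u ^+ 2.
  have [->|u0] := eqVneq u 0.
    by rewrite qform0 enorm0 expr0n mulr0.
  have := wmax ((enorm u)^-1 *: u)^T; rewrite inE /S /= trmxK dotvv unit_norm //.
  rewrite expr1n => /(_ erefl); rewrite -/m /f trmxK qformE -scalemxAr dotZl dotZr -qformE.
  rewrite mulrA -expr2 exprVn ler_pdivrMl ?exprn_gt0 ?nz //.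
  by rewrite mulrC.
have Bw : (m%:M - A) *m w = 0.
  apply: psd_kernel.
  - by rewrite linearB /= tr_scalar_mx sA.
  - by move=> u; rewrite qformB qform_scalar subr_ge0.
  - by rewrite qformB qform_scalar nw mulr1 subrr.
have eigm : eigenvalue A m.
  apply/eigenvalueP; exists w^T.
    apply: trmx_inj; rewrite trmx_mul sA trmxK linearZ /= trmxK.
    by move: Bw; rewrite mulmxBl mul_scalar_mx => /eqP; rewrite subr_eq0 => /eqP.
  apply/eqP => w00; move: nw.
  by rewrite -[w]trmxK w00 trmx0 enorm0 expr0n => /eqP; rewrite eq_sym oner_eq0.
apply: le_trans (le_m v) _; rewrite ler_wpM2r ?sqr_ge0 //; exact: amax.
Qed.

End LinearAlgebra.

(** * Asymptotic behaviour of functions of time *)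

Section Asymptotics.
Context {R : realType}.
Implicit Types (f g p F V : R -> R) (t s : R).

Lemma near_pinftyP (P : R -> Prop) :
  (\forall t \near +oo, P t) <-> exists T, forall t, T <= t -> P t.
Proof.
split=> [[T [_ TP]]|[T TP]].
  by exists (T + 1) => t Tt; apply: TP; apply: lt_le_trans Tt; rewrite ltrDl.
by exists T; split; [exact: num_real|move=> t Tt; apply: TP; exact: ltW].
Qed.

Lemma is_derive_continuous f df t : is_derive t 1 f df -> {for t, continuous f}.
Proof. by move=> [/derivable1_diffP /differentiable_continuous]. Qed.

Lemma mean_value_ge f df a b c : a <= b ->
  (forall t, a <= t <= b -> {for t, continuous f}) ->
  (forall t, a < t < b -> is_derive t 1 f (df t)) ->
  (forall t, a < t < b -> c <= df t) -> c * (b - a) <= f b - f a.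
Proof.
rewrite le_eqVlt => /orP[/eqP->|ab] cf hf hc; first by rewrite !subrr mulr0.
have hf' t : t \in `]a, b[ -> is_derive t 1 f (df t) by rewrite in_itv; exact: hf.
have cf' : {within `[a, b], continuous f}.
  by apply: continuous_in_subspaceT => t; rewrite inE /= in_itv; exact: cf.
have [t tab ->] := MVT ab hf' cf'.
by rewrite ler_wpM2r ?subr_ge0 ?(ltW ab) // hc //; move: tab; rewrite in_itv.
Qed.

Lemma mean_value_le f df a b c : a <= b ->
  (forall t, a <= t <= b -> {for t, continuous f}) ->
  (forall t, a < t < b -> is_derive t 1 f (df t)) ->
  (forall t, a < t < b -> df t <= c) -> f b - f a <= c * (b - a).
Proof.
move=> ab cf hf hc.
suff : - c * (b - a) <= - f b - - f a by lra.
apply: (@mean_value_ge (fun t => - f t) (fun t => - df t) a b (- c) ab) => t tab.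
- by apply: continuousN; exact: cf.
- exact: der_opp (hf _ tab).
- by rewrite lerN2; exact: hc.
Qed.

Definition vanishing f := f t @[t --> +oo] --> (0 : R).

Definition ebounded f := exists B, \forall t \near +oo, `|f t| <= B.

(** Asymptotic uniform continuity: unlike uniform continuity it is implied by
    convergence, so terms that merely vanish need no modulus of continuity. *)
Definition auc f := forall e, 0 < e ->
  exists2 h, 0 < h & \forall t \near +oo, forall s, t <= s <= t + h -> `|f s - f t| <= e.

(** The regularity shared by all the signals of the loop once the velocities
    vanish.  It is stable under sums and products, which gives it to the computed
    wrench from its ingredients. *)
Definition tame f := ebounded f /\ auc f.

Lemma near_later (P : R -> Prop) : (\forall t \near +oo, P t) ->
  \forall t \near +oo, forall s, t <= s -> P s.
Proof.
move=> /near_pinftyP[T TP]; apply/near_pinftyP; exists T => t Tt s ts.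
by apply: TP; exact: le_trans ts.
Qed.

Lemma vanishingP f :
  vanishing f <-> forall e, 0 < e -> \forall t \near +oo, `|f t| <= e.
Proof. by split=> [/cvgr0Pnorm_le|h]; last apply/cvgr0Pnorm_le. Qed.

Lemma ebounded_cst c : ebounded (cst c).
Proof. by exists `|c|; near=> t. Unshelve. all: by end_near. Qed.

Lemma eboundedD f g : ebounded f -> ebounded g -> ebounded (fun t => f t + g t).
Proof.
move=> [a fa] [b gb]; exists (a + b); near=> t.
by apply: le_trans (ler_normD _ _) _; rewrite lerD //; near: t.
Unshelve. all: by end_near. Qed.

Lemma eboundedM f g : ebounded f -> ebounded g -> ebounded (fun t => f t * g t).
Proof.
move=> [a fa] [b gb]; exists (a * b); near=> t.
by rewrite normrM ler_pM //; near: t.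
Unshelve. all: by end_near. Qed.

Lemma ebounded_ring_stable : ring_stable ebounded.
Proof. by split; [exact: ebounded_cst|exact: eboundedD|exact: eboundedM]. Qed.

Lemma vanishing_ebounded f : vanishing f -> ebounded f.
Proof. by move=> /vanishingP/(_ 1 ltr01); exists 1. Qed.

Lemma vanishingD f g : vanishing f -> vanishing g -> vanishing (fun t => f t + g t).
Proof. by move=> hf hg; rewrite /vanishing -(addr0 (0 : R)); exact: cvgD. Qed.

Lemma vanishingN f : vanishing f -> vanishing (fun t => - f t).
Proof. by move=> hf; rewrite /vanishing -oppr0; exact: cvgN. Qed.

Lemma vanishing0 : vanishing (cst 0).
Proof. exact: cvg_cst. Qed.

Lemma vanishingM f g : vanishing f -> ebounded g -> vanishing (fun t => f t * g t).
Proof.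
move=> /vanishingP hf [B gB]; apply/vanishingP => e e0.
have B0 : 0 < `|B| + 1 by rewrite ltr_wpDl.
near=> t; rewrite normrM.
apply: (@le_trans _ _ (e / (`|B| + 1) * (`|B| + 1))); last by rewrite divfK // gt_eqF.
apply: ler_pM => //; near: t; first by apply: hf; rewrite divr_gt0.
apply: filterS gB => t gt; apply: le_trans gt _.
by apply: le_trans (ler_norm _) _; rewrite lerDl.
Unshelve. all: by end_near. Qed.

Lemma vanishing_squeeze f g : vanishing g ->
  (\forall t \near +oo, `|f t| <= g t) -> vanishing f.
Proof.
move=> /vanishingP hg fg; apply/vanishingP => e e0; near=> t.
apply: (@le_trans _ _ (g t)); first by near: t.
by apply: le_trans (ler_norm _) _; near: t; exact: hg.
Unshelve. all: by end_near. Qed.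

Lemma auc_cst c : auc (cst c).
Proof.
move=> e e0; exists 1 => //; near=> t => s _ /=.
by rewrite subrr normr0 ltW.
Unshelve. all: by end_near. Qed.

Lemma aucD f g : auc f -> auc g -> auc (fun t => f t + g t).
Proof.
move=> hf hg e e0; have e20 : 0 < e / 2 by rewrite divr_gt0.
have [a a0 fa] := hf _ e20; have [b b0 gb] := hg _ e20.
exists (Num.min a b); first by rewrite lt_min a0.
near=> t => s /andP[ts st].
have -> : f s + g s - (f t + g t) = (f s - f t) + (g s - g t) by ring.
apply: le_trans (ler_normD _ _) _; rewrite [leRHS]splitr lerD //.
  by move: s ts st; near: t; apply: filterS fa => t H s ts st; apply: H;
    rewrite ts (le_trans st) // lerD2l ge_min lexx.
by move: s ts st; near: t; apply: filterS gb => t H s ts st; apply: H;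
  rewrite ts (le_trans st) // lerD2l ge_min lexx orbT.
Unshelve. all: by end_near. Qed.

Lemma tameM f g : tame f -> tame g -> tame (fun t => f t * g t).
Proof.
move=> [fB hf] [gB hg]; split; first exact: eboundedM.
move: fB gB => [A fA] [B gB] e e0.
set K := `|A| + `|B| + 1.
have K0 : 0 < K by rewrite ltr_wpDl // addr_ge0.
have eK : 0 < e / K / 2 by rewrite !divr_gt0.
have [a a0 fa] := hf _ eK; have [b b0 gb] := hg _ eK.
exists (Num.min a b); first by rewrite lt_min a0.
near=> t => s /andP[ts st].
have -> : f s * g s - f t * g t = f s * (g s - g t) + (f s - f t) * g t by ring.
have -> : e = K * (e / K / 2) + (e / K / 2) * K by field; rewrite gt_eqF.
have fs : `|f s| <= K.
  apply: (@le_trans _ _ A).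
    by move: s ts st; near: t; apply: filterS (near_later fA) => t H s ts _; exact: H.
  by rewrite /K; have := ler_norm A; have := normr_ge0 B; lra.
have gt : `|g t| <= K.
  apply: (@le_trans _ _ B); first by near: t.
  by rewrite /K; have := ler_norm B; have := normr_ge0 A; lra.
apply: le_trans (ler_normD _ _) _; rewrite !normrM lerD // ler_pM //.
  by move: s ts st {fs}; near: t; apply: filterS gb => t H s ts st; apply: H;
    rewrite ts (le_trans st) // lerD2l ge_min lexx orbT.
by move: s ts st {fs}; near: t; apply: filterS fa => t H s ts st; apply: H;
  rewrite ts (le_trans st) // lerD2l ge_min lexx.
Unshelve. all: by end_near. Qed.

Lemma tameD f g : tame f -> tame g -> tame (fun t => f t + g t).
Proof. by move=> [? ?] [? ?]; split; [exact: eboundedD|exact: aucD]. Qed.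

Lemma tame_ring_stable : ring_stable tame.
Proof.
split; [move=> c; split; [exact: ebounded_cst|exact: auc_cst]|exact: tameD|].
exact: tameM.
Qed.

Lemma tame_vanishing f : vanishing f -> tame f.
Proof.
move=> hf; split; first exact: vanishing_ebounded.
move=> e e0; exists 1 => //.
have /vanishingP/(_ (e / 2)) := hf; rewrite divr_gt0 // => /(_ isT) /near_later hfe.
near=> t => s /andP[ts _].
have H x : t <= x -> `|f x| <= e / 2 by move: x; near: t.
by apply: le_trans (ler_normB _ _) _; rewrite [leRHS]splitr lerD // H.
Unshelve. all: by end_near. Qed.

Lemma auc_lipschitz f df :
  (forall t, 0 < t -> is_derive t 1 f (df t)) -> ebounded df -> auc f.
Proof.
move=> hf [B dB] e e0.
have cf t : 0 < t -> {for t, continuous f} by move=> /hf /is_derive_continuous.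
have B0 : 0 < `|B| + 1 by rewrite ltr_wpDl.
exists (e / (`|B| + 1)); first by rewrite divr_gt0.
have := near_later dB => {}dB.
near=> t => s /andP[ts st].
have t0 : 0 < t by near: t; exact: nbhs_pinfty_gt.
have H x : t < x < s -> `|df x| <= `|B| + 1.
  move=> /andP[/ltW tx _]; apply: (@le_trans _ _ B).
    by move: x tx; near: t.
  by apply: le_trans (ler_norm _) _; rewrite lerDl.
have D x : t < x < s -> is_derive x 1 f (df x).
  by move=> /andP[tx _]; apply: hf; exact: lt_trans tx.
have st' : (`|B| + 1) * (s - t) <= e.
  rewrite -ler_pdivlMl // mulrC; lra.
have {}cf x : t <= x <= s -> {for x, continuous f}.
  by move=> /andP[tx _]; apply: cf; exact: lt_le_trans tx.
have h1 := mean_value_le ts cf D (fun x xts => le_trans (ler_norm _) (H x xts)).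
have h2 := @mean_value_ge f df t s (- (`|B| + 1)) ts cf D.
have {}h2 : - (`|B| + 1) * (s - t) <= f s - f t.
  by apply: h2 => x /H; rewrite ler_norml => /andP[].
rewrite ler_norml; apply/andP; split; lra.
Unshelve. all: by end_near. Qed.

Lemma ebounded_le f g : ebounded g -> (\forall t \near +oo, `|f t| <= g t) -> ebounded f.
Proof.
move=> [B gB] fg; exists B; near=> t; apply: (@le_trans _ _ (g t)); first by near: t.
by apply: le_trans (ler_norm _) _; near: t.
Unshelve. all: by end_near. Qed.

Lemma ebounded_entries n (y : R -> 'cV[R]_n) :
  ebounded (fun t => enorm (y t)) -> forall k, ebounded (fun t => y t k 0).
Proof.
by move=> yb k; apply: ebounded_le yb _; near=> t; exact: entry_le_enorm.
Unshelve. all: by end_near. Qed.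

Lemma ebounded_abs f : ebounded f -> ebounded (fun t => `|f t|).
Proof.
by move=> [B fB]; exists B; near=> t; rewrite normr_id; near: t.
Unshelve. all: by end_near. Qed.

Lemma ebounded_enorm n (y : R -> 'cV[R]_n) :
  (forall k, ebounded (fun t => y t k 0)) -> ebounded (fun t => enorm (y t)).
Proof.
move=> yb; apply: (@ebounded_le _ (fun t => \sum_k `|y t k 0|)).
  by apply: stable_sum ebounded_ring_stable _ => k _; exact: ebounded_abs.
by near=> t; rewrite ger0_norm ?enorm_ge0 // enorm_le_entries.
Unshelve. all: by end_near. Qed.

Lemma vanishing_sum (I : finType) (D : pred I) (h : I -> R -> R) :
  (forall i, D i -> vanishing (h i)) -> vanishing (fun t => \sum_(i | D i) h i t).
Proof.
move=> hv; have -> : (fun t => \sum_(i | D i) h i t) = \sum_(i | D i) h i.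
  by apply/funext => y; rewrite fct_sumE.
by elim/big_ind : _ => [|f g|i Di]; [exact: vanishing0|exact: vanishingD|exact: hv].
Qed.

Lemma vanishing_enorm n (y : R -> 'cV[R]_n) :
  (forall k, vanishing (fun t => y t k 0)) -> vanishing (fun t => enorm (y t)).
Proof.
move=> yv; apply: (@vanishing_squeeze _ (fun t => \sum_k `|y t k 0|)).
  apply: vanishing_sum => k _; apply/vanishingP => e e0.
  by have := (vanishingP _).1 (yv k) e e0; apply: filterS => t; rewrite normr_id.
by near=> t; rewrite ger0_norm ?enorm_ge0 // enorm_le_entries.
Unshelve. all: by end_near. Qed.

Lemma vanishing_mulmx m n l (A : R -> 'M[R]_(m, n)) (B : R -> 'M[R]_(n, l)) :
  (forall i j, ebounded (fun t => A t i j)) ->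
  (forall i j, vanishing (fun t => B t i j)) ->
  forall i j, vanishing (fun t => (A t *m B t) i j).
Proof.
move=> Ab Bv i j.
have -> : (fun t => (A t *m B t) i j) = (fun t => \sum_k B t k j * A t i k).
  by apply/funext => t; rewrite mxE; apply: eq_bigr => k _; rewrite mulrC.
by apply: vanishing_sum => k _; exact: vanishingM.
Qed.

Lemma ebounded_scale c f : ebounded f -> ebounded (fun t => c * f t).
Proof. exact: eboundedM (ebounded_cst c). Qed.

Lemma vanishing_scale c f : vanishing f -> vanishing (fun t => c * f t).
Proof.
move=> fv; have := vanishingM fv (ebounded_cst c); congr vanishing.
by apply/funext => t; rewrite mulrC.
Qed.

Lemma tame_scale c f : tame f -> tame (fun t => c * f t).
Proof. by have [tc _ tM] := tame_ring_stable; exact: tM (tc c). Qed.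

Lemma near_gt0 (P : R -> Prop) : (forall t, 0 < t -> P t) -> \forall t \near +oo, P t.
Proof.
by move=> h; near=> t; apply: h; near: t; exact: nbhs_pinfty_gt.
Unshelve. all: by end_near. Qed.

(** Barbalat's lemma in differential form.  A nonincreasing [V] bounded below
    oscillates arbitrarily little after some time, whereas each late instant
    where [g] is not small costs [V] a fixed amount over a window of fixed
    length, by asymptotic uniform continuity of [g]. *)
Lemma barbalat V dV g k m : 0 < k ->
  (forall t, 0 < t -> is_derive t 1 V (dV t)) ->
  (forall t, 0 < t -> m <= V t) ->
  (\forall t \near +oo, dV t <= - (k * g t ^+ 2)) ->
  auc g -> vanishing g.
Proof.
move=> k0 hV mV dVg ag.
have cV t : 0 < t -> {for t, continuous V} by move=> /hV /is_derive_continuous.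
 apply/vanishingP => e e0.
have e20 : 0 < e / 2 by rewrite divr_gt0.
have [h h0 gh] := ag _ e20.
have [T0 dVT] := (near_pinftyP _).1 dVg.
set T := Num.max T0 1.
have T_gt0 : 0 < T by rewrite lt_max ltr01 orbT.
have dV' t : T <= t -> dV t <= - (k * g t ^+ 2).
  by move=> Tt; apply: dVT; apply: le_trans Tt; rewrite le_max lexx.
have Vdec s t : T <= s -> s <= t -> V t <= V s.
  move=> Ts st.
  have := @mean_value_le V dV s t 0 st; rewrite mul0r subr_le0; apply.
    by move=> x /andP[sx _]; apply: cV; apply: lt_le_trans sx; exact: lt_le_trans Ts.
    by move=> x /andP[sx _]; apply: hV; apply: lt_trans sx; exact: lt_le_trans Ts.
  move=> x /andP[sx _]; apply: le_trans (dV' _ (le_trans Ts (ltW sx))) _.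
  by rewrite oppr_le0 mulr_ge0 ?sqr_ge0 // ltW.
pose A := [set V t | t in [set t | T <= t]].
have Anz : A !=set0 by exists (V T); exists T => //=.
have Alb : has_lbound A.
  by exists m => _ [t /= Tt <-]; apply: mV; exact: lt_le_trans Tt.
set d := k * (e / 2) ^+ 2 * h.
have d0 : 0 < d by rewrite !mulr_gt0.
have [_ [T1 /= TT1 <-] VT1] := inf_adherent d0 (conj Anz Alb).
have Vinf t : T <= t -> inf A <= V t.
  by move=> Tt; apply: ge_inf => //; exists t.
near=> t; rewrite leNgt; apply/negP => ge.
have T1t : T1 <= t by near: t; apply: nbhs_pinfty_ge; exact: num_real.
have Tt : T <= t by exact: le_trans T1t.
have gx x : t <= x <= t + h -> e / 2 <= `|g x|.
  move=> xt; have : `|g x - g t| <= e / 2.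
    by move: x xt {ge}; near: t.
  have := ler_norm (`|g t| - `|g x|); have := ler_dist_dist (g t) (g x).
  rewrite [`|g t - g x|]distrC; lra.
have tth : t <= t + h by rewrite lerDl ltW.
have := @mean_value_le V dV t (t + h) (- (k * (e / 2) ^+ 2)) tth.
have -> : - (k * (e / 2) ^+ 2) * (t + h - t) = - d by rewrite /d; ring.
move=> /(_ _ _ _)/wrap[].
- by move=> x /andP[tx _]; apply: cV; apply: lt_le_trans tx; exact: lt_le_trans Tt.
- by move=> x /andP[tx _]; apply: hV; apply: lt_trans tx; exact: lt_le_trans Tt.
- move=> x /andP[tx xt]; apply: le_trans (dV' _ (le_trans Tt (ltW tx))) _.
  rewrite lerN2 ler_pM2l // -(real_normK (num_real (g x))) ler_sqr ?nnegrE //.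
    by apply: gx; rewrite (ltW tx) (ltW xt).
  exact: ltW.
- have := Vinf _ (le_trans Tt tth); have := Vdec _ _ TT1 T1t; lra.
Unshelve. all: by end_near. Qed.

Definition mtame m l (A : R -> 'M[R]_(m, l)) := forall i j, tame (fun t => A t i j).

Lemma mtame_mul m l o (A : R -> 'M[R]_(m, l)) (B : R -> 'M[R]_(l, o)) :
  mtame A -> mtame B -> mtame (fun t => A t *m B t).
Proof. by move=> At Bt; apply: stable_mulmx tame_ring_stable At Bt. Qed.

Lemma mtame_tr m l (A : R -> 'M[R]_(m, l)) : mtame A -> mtame (fun t => (A t)^T).
Proof.
move=> At i j; have -> : (fun t => (A t)^T i j) = (fun t => A t j i).
  by apply/funext => t; rewrite mxE.
exact: At.
Qed.

Lemma mtame_add m l (A B : R -> 'M[R]_(m, l)) :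
  mtame A -> mtame B -> mtame (fun t => A t + B t).
Proof.
move=> At Bt i j; have -> : (fun t => (A t + B t) i j) = (fun t => A t i j + B t i j).
  by apply/funext => t; rewrite mxE.
exact: tameD (At i j) (Bt i j).
Qed.

Lemma mtame_scale m l c0 (A : R -> 'M[R]_(m, l)) :
  mtame A -> mtame (fun t => c0 *: A t).
Proof.
move=> At i j; have -> : (fun t => (c0 *: A t) i j) = (fun t => c0 * A t i j).
  by apply/funext => t; rewrite mxE.
exact: tame_scale (At i j).
Qed.

Lemma mtame_opp m l (A : R -> 'M[R]_(m, l)) : mtame A -> mtame (fun t => - A t).
Proof.
move=> /(mtame_scale (-1)); congr mtame.
by apply/funext => t; rewrite scaleN1r.
Qed.

Lemma mtame_sub m l (A B : R -> 'M[R]_(m, l)) :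
  mtame A -> mtame B -> mtame (fun t => A t - B t).
Proof. by move=> At Bt; apply: mtame_add At (mtame_opp Bt). Qed.

(** If [p] vanishes while its derivative would be bounded below whenever [F]
    exceeds a level slightly under [c], then [F] cannot exceed [c] late: being
    asymptotically uniformly continuous, [F] would stay above that level for a
    fixed duration, and [p] would move by a fixed amount. *)
Lemma eventually_le_of_vanishing F p dp c eta :
  (forall t, 0 < t -> is_derive t 1 p (dp t)) -> vanishing p ->
  auc F -> 0 < eta ->
  (\forall t \near +oo, c - eta <= F t -> eta <= dp t) ->
  \forall t \near +oo, F t <= c.
Proof.
move=> hp /vanishingP p0 aF eta0 Fdp.
have [h h0 Fh] := aF _ eta0.
have d0 : 0 < eta * h / 4 by rewrite !mulr_gt0 // invr_gt0.
have p0' := near_later (p0 _ d0); have Fdp' := near_later Fdp.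
near=> t; rewrite leNgt; apply/negP => cF.
have t0 : 0 < t by near: t; exact: nbhs_pinfty_gt.
have tth : t <= t + h by rewrite lerDl ltW.
have := @mean_value_ge p dp t (t + h) eta tth.
move=> /(_ _ _ _)/wrap[].
- move=> x /andP[tx _]; apply: is_derive_continuous (hp x _); exact: lt_le_trans tx.
- by move=> x /andP[tx _]; apply: hp; exact: lt_trans tx.
- move=> x /andP[tx xt]; have Fx : `|F x - F t| <= eta.
    have : t <= x <= t + h by rewrite (ltW tx) (ltW xt).
    by move: x {tx xt}; near: t.
  have /(_ _ (ltW tx)) H : forall x, t <= x -> c - eta <= F x -> eta <= dp x.
    by near: t.
  by apply: H; move: Fx; rewrite ler_norml => /andP[]; lra.
- have H x : t <= x -> `|p x| <= eta * h / 4 by move: x; near: t.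
  have := H _ (lexx t); have := H _ tth; rewrite !ler_norml.
  by move=> /andP[a1 a2] /andP[b1 b2]; have := mulr_gt0 eta0 h0; lra.
Unshelve. all: by end_near. Qed.

Lemma left_limit_le f c t : {for t, continuous f} -> 0 < t ->
  (forall s, 0 <= s < t -> f s <= c) -> f t <= c.
Proof.
move=> cf t0 H; rewrite leNgt; apply/negP => ft.
have : \forall s \near t, c < f s.
  by apply: (cf [set u | c < u]); apply: open_nbhs_nbhs; split => //; exact: open_gt.
move=> /nbhs_ballP[d /= d0 Hd].
pose s := Num.max 0 (t - d / 2).
have st : 0 <= s < t by rewrite le_max lexx /= gt_max t0 /=; lra.
have : c < f s.
  apply: Hd; rewrite /ball /= ger0_norm; last by case/andP: st => _ /ltW; rewrite subr_ge0.
  have : t - d / 2 <= s by rewrite le_max lexx orbT.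
  lra.
by rewrite ltNge H.
Qed.

(** Continuity argument: at the infimum of the exit times the bounds hold by
    hypothesis, and then persist for a while. *)
Lemma first_exit (I : finType) (D : I -> R -> R) b :
  (forall i, continuous (D i)) -> (forall i, D i 0 < b) ->
  (forall t, 0 < t -> (forall s, 0 <= s < t -> forall i, D i s < b) ->
     forall i, D i t < b) ->
  forall t, 0 <= t -> forall i, D i t < b.
Proof.
move=> cD D0 H t1 t10 i1; rewrite ltNge; apply/negP => Db1.
pose A := [set t | 0 <= t /\ exists i, b <= D i t].
have Anz : A !=set0 by exists t1; split => //; exists i1.
have Alb : has_lbound A by exists 0 => t [].
set T := inf A.
have T0 : 0 <= T by apply: lb_le_inf => // t [].
have before s : 0 <= s < T -> forall i, D i s < b.
  move=> /andP[s0 sT] i; rewrite ltNge; apply/negP => bD.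
  have : T <= s by apply: ge_inf => //; split => //; exists i.
  by rewrite leNgt sT.
have DT : forall i, D i T < b.
  by move: T0; rewrite le_eqVlt => /orP[/eqP <- //|T0]; exact: H.
have : \forall s \near T, forall i, D i s < b.
  apply: (@filter_forall _ _ (fun i s => D i s < b) (nbhs T)) => i.
  apply: (cD i T [set u | u < b]); apply: open_nbhs_nbhs.
  by split; [exact: open_lt|exact: DT].
move=> /nbhs_ballP[d /= d0 Hd].
have [t [t0 [i bD]] tT] := inf_adherent d0 (conj Anz Alb).
have Tt : T <= t by apply: ge_inf => //; split => //; exists i.
have : D i t < b.
  by apply: Hd; rewrite /ball /= distrC ger0_norm ?subr_ge0 //; move: tT; rewrite -/T; lra.
by rewrite ltNge bD.
Qed.

End Asymptotics.

(** * The potential and the attraction it exerts *)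

Section PotentialCalculus.
Context {R : realType}.

Lemma der_enorm_sqr {V : normedModType R} n (y : V -> 'cV[R]_n) dy x v :
  is_derive x v y dy ->
  is_derive x v (fun s => enorm (y s) ^+ 2) (2 * dot (y x) dy).
Proof.
move=> /is_derive_mxP hy.
have -> : (fun s => enorm (y s) ^+ 2) = (fun s => \sum_k y s k 0 * y s k 0).
  by apply/funext => s; rewrite enorm_sqr; apply: eq_bigr => k _; rewrite expr2.
have -> : 2 * dot (y x) dy = \sum_k (dy k 0 * y x k 0 + y x k 0 * dy k 0).
  by rewrite dotE mulr_sumr; apply: eq_bigr => k _; ring.
by apply: der_sum => k _; apply: der_mul; exact: hy.
Qed.

Lemma continuous_enorm_sqr n : continuous (fun z : 'cV[R]_n => enorm z ^+ 2).
Proof.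
move=> z; rewrite (_ : (fun z : 'cV[R]_n => _) = fun z => dot z z); last first.
  by apply/funext => y; rewrite dotvv.
have /cvg_mxP : (fun x : 'cV[R]_n => x^T *m x) @ z --> z^T *m z.
  have h : id @ z --> z by exact: cvg_id.
  exact: (cvg_mulmx (cvg_trmx h) h).
by move=> /(_ 0 0).
Qed.

Lemma dot_delta n (y : 'cV[R]_n) k : dot y (delta_mx k 0) = y k 0.
Proof.
rewrite dotE (bigD1 k) //= big1 ?addr0 => [|i ik]; first by rewrite mxE !eqxx mulr1.
by rewrite mxE (negbTE ik) mulr0.
Qed.

Variables (n : nat) (r : R) (phi : R -> R -> R) (sigma nu : R -> R).
Hypothesis hpot : potential n r phi sigma nu.
Hypothesis hr : 0 < r.
Variable Q : R.
Hypothesis hQ : 0 < Q.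

Let phi1 := derive1n 1 (phi Q).
Let phi2 := derive1n 2 (phi Q).

Lemma enorm_sqr_le (y : 'cV[R]_n) : enorm y <= r -> 0 <= enorm y ^+ 2 <= r ^+ 2.
Proof. by move=> yr; rewrite sqr_ge0 ler_sqr ?nnegrE ?enorm_ge0 // ltW. Qed.

Lemma der_phi k u : 0 <= u <= r ^+ 2 ->
  is_derive u 1 (derive1n k (phi Q)) (derive1n k.+1 (phi Q) u).
Proof.
move=> hu; rewrite derive1nS derive1E; apply: derivableP.
exact: pot_smooth hpot _ _ _ _ _.
Qed.

Lemma slope_bounds (y : 'cV[R]_n) : enorm y <= r -> 0 <= phi1 (enorm y ^+ 2) < sigma Q.
Proof. by move=> yr; apply: (pot_slope hpot hQ); rewrite enorm_ge0. Qed.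

Lemma phi2_bounded : exists B, forall u, 0 <= u <= r ^+ 2 -> `|phi2 u| <= B.
Proof.
have r2 : 0 <= r ^+ 2 by exact: sqr_ge0.
have cphi2 : {within `[0, r ^+ 2], continuous (fun u => `|phi2 u|)}.
  apply: continuous_in_subspaceT => u; rewrite inE /= in_itv /= => hu.
  apply: continuous_comp; last exact: norm_continuous.
  apply: differentiable_continuous; apply/derivable1_diffP.
  exact: pot_smooth hpot _ _ _ _ _.
have [u0 _ H] := EVT_max r2 cphi2.
by exists (`|phi2 u0|) => u hu; apply: H; rewrite in_itv.
Qed.

Lemma der_psi {y : R -> 'cV[R]_n} {dy : 'cV[R]_n} {t : R} : is_derive t 1 y dy ->
  enorm (y t) <= r ->
  is_derive t 1 (fun s => psi_vec phi Q (y s))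
    (dot ((2 * phi1 (enorm (y t) ^+ 2)) *: y t) dy).
Proof.
move=> hy yr; have hu := enorm_sqr_le yr.
have h := @is_derive1_comp _ _ (fun s => enorm (y s) ^+ 2) t _ _
  (der_phi 0 hu) (der_enorm_sqr hy).
apply: is_derive_eq h _; rewrite dotZl /phi1 mulrA; congr (_ * _); exact: mulrC.
Qed.

Lemma partial_psi (z p v : 'cV[R]_n) : enorm (z - p) <= r ->
  is_derive z v (fun y => psi_vec phi Q (y - p))
    (dot ((2 * phi1 (enorm (z - p) ^+ 2)) *: (z - p)) v).
Proof.
move=> zr; apply: der_line.
have hl : is_derive (0 : R) 1 (fun h : R => h *: v + z - p) v.
  apply: is_derive_eq (is_deriveD (der_line_id z v) (is_derive_cst (- p) _ _)) _.
  by rewrite addr0.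
have := der_psi hl; rewrite /= scale0r add0r; exact.
Qed.

Lemma grad_psi (z p : 'cV[R]_n) : enorm (z - p) <= r ->
  grad (fun y => psi_vec phi Q (y - p)) z =
  (2 * phi1 (enorm (z - p) ^+ 2)) *: (z - p).
Proof.
move=> zr; apply/matrixP => k j; rewrite ord1 mxE.
by have [_ ->] := partial_psi (delta_mx k 0) zr; rewrite dot_delta.
Qed.

Definition psi_hess (y : 'cV[R]_n) : 'M[R]_n :=
  (2 * phi1 (enorm y ^+ 2))%:M + (4 * phi2 (enorm y ^+ 2)) *: (y *m y^T).

Lemma psi_hess_mul (y w : 'cV[R]_n) : psi_hess y *m w =
  (2 * phi1 (enorm y ^+ 2)) *: w + (4 * phi2 (enorm y ^+ 2) * dot y w) *: y.
Proof.
rewrite mulmxDl mul_scalar_mx -scalemxAl -mulmxA; congr (_ + _).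
rewrite -[RHS]scalerA; congr (_ *: _).
by rewrite [y^T *m w]mx11_scalar mul_mx_scalar.
Qed.

Lemma psi_hess_sym y : (psi_hess y)^T = psi_hess y.
Proof. by rewrite linearD linearZ /= tr_scalar_mx trmx_mul trmxK. Qed.

(** Differentiating along a curve serves twice: along the motion of a link, for
    the derivative of the coordination error, and along the coordinate lines, for
    the Hessian. *)
Lemma der_grad_psi {y : R -> 'cV[R]_n} {dy : 'cV[R]_n} {t : R} : is_derive t 1 y dy ->
  enorm (y t) <= r ->
  is_derive t 1 (fun s => (2 * phi1 (enorm (y s) ^+ 2)) *: y s)
    (psi_hess (y t) *m dy).
Proof.
move=> hy yr; have hu := enorm_sqr_le yr.
have h : is_derive t 1 (phi1 \o (fun s => enorm (y s) ^+ 2))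
    (phi2 (enorm (y t) ^+ 2) * (2 * dot (y t) dy)).
  by apply: is_derive1_comp; [exact: (der_phi 1 hu)|exact: der_enorm_sqr].
rewrite psi_hess_mul; apply/is_derive_mxP => k j; rewrite ord1.
have hk := (is_derive_mxP _ _ _ _).1 hy k 0.
have -> : (fun s => ((2 * phi1 (enorm (y s) ^+ 2)) *: y s) k 0) =
    (fun s => 2 * (phi1 (enorm (y s) ^+ 2) * y s k 0)).
  by apply/funext => s; rewrite mxE mulrA.
apply: is_derive_eq (der_scale 2 (der_mul h hk)) _; rewrite /= !mxE.
by set a : R := phi1 _; set b : R := phi2 _; ring.
Qed.

Lemma hess_psi (y : 'cV[R]_n) : enorm y < r ->
  hess (psi_vec phi Q (n := n)) y = psi_hess y.
Proof.
move=> yr; apply/matrixP => k l; rewrite mxE.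
have nearr : \forall z \near y, enorm z < r.
  have : \forall z \near y, enorm z ^+ 2 < r ^+ 2.
    have yr2 : enorm y ^+ 2 < r ^+ 2 by rewrite ltr_sqr ?nnegrE ?enorm_ge0 // ltW.
    apply: (@continuous_enorm_sqr n y [set u | u < r ^+ 2]).
    by apply: open_nbhs_nbhs; split => //; exact: open_lt.
  by apply: filterS => z; rewrite ltr_sqr ?nnegrE ?enorm_ge0 // ltW.
have e : \forall z \near y, 'D_(delta_mx l 0) (psi_vec phi Q (n := n)) z =
    ((2 * phi1 (enorm z ^+ 2)) *: z) l 0.
  apply: filterS nearr => z zr.
  have := @partial_psi z 0 (delta_mx l 0); rewrite subr0 => /(_ (ltW zr)).
  have -> : (fun y : 'cV[R]_n => psi_vec phi Q (y - 0)) = psi_vec phi Q (n := n).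
    by apply/funext => w; rewrite subr0.
  by move=> [_ ->]; rewrite dot_delta.
rewrite (near_eq_derive _ e).
have hl := der_line_id y (delta_mx k 0).
have := der_grad_psi hl; rewrite /= scale0r add0r => /(_ (ltW yr)) h.
have h' : is_derive y (delta_mx k 0)
    (fun z : 'cV[R]_n => (2 * phi1 (enorm z ^+ 2)) *: z) (psi_hess y *m delta_mx k 0).
  exact: (@der_line _ _ _ (fun z : 'cV[R]_n => (2 * phi1 (enorm z ^+ 2)) *: z)).
have [_ ->] := (is_derive_mxP _ _ _ _).1 h' l 0.
rewrite -{1}psi_hess_sym mxE (bigD1 k) //= big1 => [|i ik].
  by rewrite !mxE !eqxx mulr1 addr0.
by rewrite [delta_mx _ _ _ _]mxE (negbTE ik) mulr0.
Qed.

(** Along a ray the Hessian is the derivative of [d * phi' (d ^ 2)], so that its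
    positive definiteness makes the attraction between two systems increase
    with their distance. *)
Lemma attraction_incr d1 d2 : (0 < n)%N -> 0 <= d1 -> d1 < d2 -> d2 < r ->
  d1 * phi1 (d1 ^+ 2) < d2 * phi1 (d2 ^+ 2).
Proof.
move=> n0 d10 d12 d2r; pose k0 := Ordinal n0.
have sq d : d1 <= d <= d2 -> 0 <= d ^+ 2 <= r ^+ 2.
  by move=> /andP[? ?]; rewrite sqr_ge0 ler_sqr ?nnegrE; lra.
have hd d : d1 <= d <= d2 -> is_derive d 1 (fun d => d * phi1 (d ^+ 2))
    (phi1 (d ^+ 2) + 2 * d ^+ 2 * phi2 (d ^+ 2)).
  move=> hd; have hsq : is_derive d 1 (fun d : R => d ^+ 2) (2 * d).
    by apply: is_derive_eq (der_mul (is_derive_id d 1) (is_derive_id d 1)) _; lra.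
  have h : is_derive d 1 (phi1 \o (fun d : R => d ^+ 2)) (phi2 (d ^+ 2) * (2 * d)).
    by apply: is_derive1_comp; first exact: (der_phi 1 (sq _ hd)).
  apply: is_derive_eq (der_mul (is_derive_id d 1) h) _ => /=.
  by set a : R := phi1 _; set b : R := phi2 _; ring.
have pos d : d1 < d < d2 -> 0 < phi1 (d ^+ 2) + 2 * d ^+ 2 * phi2 (d ^+ 2).
  move=> /andP[dd1 dd2].
  have [y yd] : exists y : 'cV[R]_n, enorm y = d.
    exists (d *: delta_mx k0 0); rewrite enormZ ger0_norm; last lra.
    have -> : enorm (delta_mx k0 0 : 'cV[R]_n) = 1; last by rewrite mulr1.
    apply/eqP; rewrite -(eqrXn2 (ltn0Sn 1)) ?enorm_ge0 // -dotvv dot_delta.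
    by rewrite mxE !eqxx expr1n.
  have yr : enorm y < r by rewrite yd; lra.
  have [/(_ y)] := pot_hess hpot hQ (ltW yr).
  have y0 : y != 0 by apply/eqP => y0; move: yd; rewrite y0 enorm0; lra.
  rewrite y0 hess_psi // => /(_ isT) + _.
  rewrite qformE psi_hess_mul dotDr !dotZr dotvv yd.
  set a : R := phi1 _; set b : R := phi2 _.
  have -> : 2 * a * d ^+ 2 + 4 * b * d ^+ 2 * d ^+ 2 =
    (2 * d ^+ 2) * (a + 2 * d ^+ 2 * b) by ring.
  by rewrite pmulr_rgt0 // mulr_gt0 // exprn_gt0 //; lra.
have hd' d : d \in `]d1, d2[ -> is_derive d 1 (fun d => d * phi1 (d ^+ 2))
    (phi1 (d ^+ 2) + 2 * d ^+ 2 * phi2 (d ^+ 2)).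
  by rewrite in_itv /= => /andP[? ?]; apply: hd; lra.
have cont : {within `[d1, d2], continuous (fun d => d * phi1 (d ^+ 2))}.
  apply: derivable_within_continuous => d; rewrite in_itv /= => hd12.
  by have [] := hd _ hd12.
have [d dd] := MVT d12 hd' cont.
have := pos d; move: dd; rewrite in_itv /= => dd /(_ dd) p e.
by rewrite -subr_gt0 e mulr_gt0 // subr_gt0.
Qed.

Lemma attraction_lower_bound eps (y : 'cV[R]_n) : (0 < n)%N -> 0 < eps ->
  eps <= enorm y -> enorm y < r ->
  0 < eps * phi1 (eps ^+ 2) <= enorm y * phi1 (enorm y ^+ 2).
Proof.
move=> n0 e0 ey yr; apply/andP; split.
  rewrite -[ltLHS](mul0r (phi1 (0 ^+ 2))).
  by apply: attraction_incr => //; exact: le_lt_trans yr.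
move: ey; rewrite le_eqVlt => /orP[/eqP-> //|ey].
by apply: ltW; apply: attraction_incr => //; exact: ltW.
Qed.

End PotentialCalculus.

(** * Periodic functions of the joint angles *)

Section PeriodicFunctions.
Context {R : realType}.

(** Uniform continuity on a compact set, where only one of the two points has to
    lie in the set; near-covering compactness is applied to the translations. *)
Lemma compact_unif_continuous (V : normedModType R) (f : V -> R) (K : set V) :
  compact K -> continuous f -> forall e, 0 < e ->
  exists2 d, 0 < d & forall x y, K x -> `|y - x| < d -> `|f y - f x| <= e.
Proof.
move=> cK cf e e0.
have : \forall h \near (0 : V), K `<=` (fun x => `|f (x + h) - f x| <= e).
  apply: ((compact_near_coveringP K).1 cK) => x Kx.
  have ck : (fun p : V * V => `|f (p.1 + p.2) - f p.1|) @ (x, 0) --> `|f (x + 0) - f x|.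
    apply: cvg_norm; apply: cvgB.
      apply: (@cvg_comp _ _ _ (fun p : V * V => p.1 + p.2) f); last exact: cf.
      by apply: cvgD; [exact: cvg_fst|exact: cvg_snd].
    by apply: (@cvg_comp _ _ _ (@fst V V) f); [exact: cvg_fst|exact: cf].
  have h : \forall p \near (x, 0 : V), `|f (p.1 + p.2) - f p.1| <= e.
    apply: (ck [set u | u <= e]); rewrite addr0 subrr normr0.
    have : nbhs (0 : R) [set u | u < e].
      by apply: open_nbhs_nbhs; split => //; exact: open_lt.
    by apply: filterS => u /ltW.
  exact: h.
move=> /nbhs_normP[d /= d0 H]; exists d => // x y Kx yx.
have := H (y - x); rewrite /ball_ /= sub0r normrN => /(_ yx x Kx).
by rewrite [x + _]addrC subrK.
Qed.

Lemma box_compact n (a b : R) :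
  compact [set v : 'cV[R]_n | forall i, v i 0 \in `[a, b]].
Proof.
have -> : [set v : 'cV[R]_n | forall i, v i 0 \in `[a, b]] =
    trmx @` [set v : 'rV[R]_n | forall i, v ord0 i \in `[a, b]].
  rewrite predeqE => v; split=> [vab|[w wab <-] i]; last by rewrite mxE; exact: wab.
  by exists v^T; rewrite ?trmxK // => i; rewrite mxE; exact: vab.
apply: continuous_compact.
  apply: continuous_subspaceT => w.
  by apply: (@cvg_trmx _ _ (nbhs w) _ _ _ id); exact: cvg_id.
apply: (@rV_compact _ _ (fun=> `[a, b]%classic)) => _; exact: segment_compact.
Qed.

Lemma periodic2pi_int n (T : Type) (f : 'cV[R]_n -> T) q l (z : int) :
  periodic2pi f -> f (q + (z%:~R * (2 * pi)) *: delta_mx l 0) = f q.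
Proof.
move=> pf; have pn q' (k : nat) : f (q' + (k%:R * (2 * pi)) *: delta_mx l 0) = f q'.
  elim: k => [|k IH]; first by rewrite mul0r scale0r addr0.
  by rewrite -[k.+1]addn1 natrD mulrDl mul1r scalerDl addrA pf.
case: z => k; first exact: pn.
rewrite NegzE mulrNz mulNr scaleNr -[LHS](pn _ k.+1).
by rewrite -addrA addNr addr0.
Qed.

(** Joint angles may wind without bound; reduction modulo [2 pi] restores
    compactness.  The translation [c] is returned, rather than the reduced
    configuration, because two neighbouring configurations must be reduced by
    the same one. *)
Lemma periodic2pi_box n (q : 'cV[R]_n) : exists c : 'cV[R]_n,
  (forall i, (q + c) i 0 \in `[0, 2 * pi]) /\
  forall (T : Type) (f : 'cV[R]_n -> T), periodic2pi f -> forall q', f (q' + c) = f q'.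
Proof.
pose P : R := 2 * pi; have P0 : 0 < P by rewrite mulr_gt0 // pi_gt0.
pose z i := - Num.floor (q i 0 / P).
exists (\sum_i ((z i)%:~R * P) *: delta_mx i 0); split.
  move=> i; rewrite mxE summxE (bigD1 i) //= big1 ?addr0 => [|k ki]; last first.
    by rewrite !mxE eq_sym (negbTE ki) mulr0.
  rewrite !mxE !eqxx mulr1 /z.
  have := floor_le (q i 0 / P); have := floorD1_gt (q i 0 / P).
  rewrite intrD ltr_pdivrMr // ler_pdivlMr // mulrNz in_itv /= => h1 h2.
  apply/andP; split; first lra.
  by rewrite -/P; lra.
move=> T f pf q'; elim/big_ind : _ q' => [q'|u v fu fv q'|i _ q'].
- by rewrite addr0.
- by rewrite addrA fv fu.
- exact: periodic2pi_int.
Qed.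

Section Joint.
Variables (n m : nat) (f : 'cV[R]_n * 'cV[R]_m -> R).
Hypothesis cf : continuous f.
Hypothesis pf : forall w, periodic2pi (fun q => f (q, w)).

Let box K := [set v : 'cV[R]_n | forall i, v i 0 \in `[0, 2 * pi]] `*`
             [set w : 'cV[R]_m | forall i, w i 0 \in `[- K, K]].

Let box_cpt K : compact (box K).
Proof. by apply: compact_setX; exact: box_compact. Qed.

Lemma periodic_bounded (K : R) : exists B, forall (q : 'cV[R]_n) (w : 'cV[R]_m),
  (forall i, `|w i 0| <= K) -> `|f (q, w)| <= B.
Proof.
have [B [_ fB]] := compact_bounded (continuous_compact (continuous_subspaceT cf) (@box_cpt K)).
exists (B + 1) => q w wK; have [c [qc pc]] := periodic2pi_box q.
rewrite -(pc _ _ (pf w)); apply: fB; first by rewrite ltrDl.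
exists (q + c, w) => //; split => //= i; rewrite in_itv /= -ler_norml; exact: wK.
Qed.

Lemma periodic_unif (K e : R) : 0 < e -> exists2 d, 0 < d &
  forall (q : 'cV[R]_n) (w : 'cV[R]_m) (q' : 'cV[R]_n) (w' : 'cV[R]_m),
  (forall i, `|w i 0| <= K) ->
  (forall i, `|q' i 0 - q i 0| <= d) -> (forall i, `|w' i 0 - w i 0| <= d) ->
  `|f (q', w') - f (q, w)| <= e.
Proof.
move=> e0; have [d d0 H] := compact_unif_continuous (@box_cpt K) cf e0.
exists (d / 2); first by rewrite divr_gt0.
move=> q w q' w' wK qq ww; have [c [qc pc]] := periodic2pi_box q.
rewrite -(pc _ _ (pf w)) -(pc _ _ (pf w')).
apply: H; first by split => //= i; rewrite in_itv /= -ler_norml; exact: wK.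
have d2 : d / 2 < d by lra.
have mxlt p (u : 'cV[R]_p) : (forall i, `|u i 0| <= d / 2) -> `|u| < d.
  move=> ud; apply: le_lt_trans d2.
  rewrite [leLHS]/Num.Def.normr /= mx_normrE; apply: bigmax_le => [|[i j] _ /=].
    by rewrite divr_ge0 // ltW.
  by rewrite ord1.
rewrite prod_normE gt_max /=; apply/andP; split; apply: mxlt => i; rewrite !mxE.
  have -> : q' i 0 + c i 0 - (q i 0 + c i 0) = q' i 0 - q i 0 by ring.
  exact: qq.
exact: ww.
Qed.

Lemma finite_min (I : finType) (d : I -> R) : (forall i, 0 < d i) ->
  exists2 d0, 0 < d0 & forall i, d0 <= d i.
Proof.
move=> dp; exists (\big[Num.min/1]_i d i).
  by elim/big_ind : _ => // x y x0 y0; rewrite lt_min x0.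
by move=> i; exact: bigmin_le_cond.
Qed.

Lemma finite_max (I : finType) (d : I -> R) : exists B, forall i, d i <= B.
Proof.
exists (\sum_i `|d i|) => i; apply: le_trans (ler_norm _) _.
by rewrite (bigD1 i) //= lerDl sumr_ge0.
Qed.

(** Periodicity plays the part of boundedness for the joint angles [q], which
    may wind forever. *)
Lemma tame_periodic (q : R -> 'cV[R]_n) (w : R -> 'cV[R]_m) :
  (forall i, auc (fun t => q t i 0)) -> (forall i, tame (fun t => w t i 0)) ->
  tame (fun t => f (q t, w t)).
Proof.
move=> qa wt.
have [K wK] : exists K, forall i, \forall t \near +oo, `|w t i 0| <= K.
  have /choice [B HB] : forall i, exists B, \forall t \near +oo, `|w t i 0| <= B.
    by move=> i; have [] := wt i.
  have [K HK] := finite_max B; exists K => i.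
  by apply: filterS (HB i) => t h; exact: le_trans (HK i).
have {}wK : \forall t \near +oo, forall i, `|w t i 0| <= K.
  by apply: filter_forall => i; exact: wK.
split.
  have [B HB] := periodic_bounded K; exists B.
  by apply: filterS wK => t; exact: HB.
move=> e e0; have [d d0 H] := periodic_unif K e0.
have /choice [a Ha] : forall i, exists h, 0 < h /\ \forall t \near +oo,
    forall s, t <= s <= t + h -> `|q s i 0 - q t i 0| <= d.
  by move=> i; have [h h0 ?] := qa i _ d0; exists h.
have /choice [b Hb] : forall i, exists h, 0 < h /\ \forall t \near +oo,
    forall s, t <= s <= t + h -> `|w s i 0 - w t i 0| <= d.
  by move=> i; have [_ wa] := wt i; have [h h0 ?] := wa _ d0; exists h.
have [a0 a00 a0a] := finite_min (fun i => (Ha i).1).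
have [b0 b00 b0b] := finite_min (fun i => (Hb i).1).
exists (Num.min a0 b0); first by rewrite lt_min a00.
have Qn : \forall t \near +oo, forall i s, t <= s <= t + a i -> `|q s i 0 - q t i 0| <= d.
  by apply: filter_forall => i; have [] := Ha i.
have Wn : \forall t \near +oo, forall i s, t <= s <= t + b i -> `|w s i 0 - w t i 0| <= d.
  by apply: filter_forall => i; have [] := Hb i.
near=> t => s /andP[ts st].
have tq : forall i s, t <= s <= t + a i -> `|q s i 0 - q t i 0| <= d by near: t.
have tw : forall i s, t <= s <= t + b i -> `|w s i 0 - w t i 0| <= d by near: t.
have st' : s <= t + a0 /\ s <= t + b0.
  by split; apply: le_trans st _; rewrite lerD2l ge_min lexx ?orbT.
apply: H => [|i|i]; first by near: t.
  by apply: tq; rewrite ts (le_trans st'.1) // lerD2l.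
by apply: tw; rewrite ts (le_trans st'.2) // lerD2l.
Unshelve. all: by end_near. Qed.

End Joint.

Lemma tame_periodic1 n (f : 'cV[R]_n -> R) (q : R -> 'cV[R]_n) :
  continuous f -> periodic2pi f -> (forall i, auc (fun t => q t i 0)) ->
  tame (fun t => f (q t)).
Proof.
move=> cf pf qa; pose g (z : 'cV[R]_n * 'cV[R]_0) := f z.1.
have cg : continuous g.
  by move=> z; apply: (@cvg_comp _ _ _ fst f); [exact: cvg_fst|exact: cf].
have := @tame_periodic n 0 g cg (fun w => pf) q (fun=> 0) qa.
by apply; case.
Qed.

End PeriodicFunctions.

(** * Kinematics and task-space dynamics of a manipulator *)

Lemma derive_periodic (R : realType) n (W : normedModType R) (F : 'cV[R]_n -> W) v :
  periodic2pi F -> periodic2pi (fun q => 'D_v F q).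
Proof.
move=> pF q l; set c := (2 * pi) *: delta_mx l 0; rewrite /derive.
have -> // : (fun h => h^-1 *: ((F \o shift (q + c)) (h *: v) - F (q + c))) =
    (fun h => h^-1 *: ((F \o shift q) (h *: v) - F q)).
by apply/funext => h /=; rewrite addrA !pF.
Qed.

Section Manipulator.
Context {R : realType}.
Variables (n : nat) (S : el_system R n).
Hypothesis hmodel : revolute_model S.
Implicit Types (q dq v : 'cV[R]_n) (th : 'cV[R]_(npar S)).

Lemma fkin_differentiable q : differentiable (fkin S) q.
Proof. by have [] := fkin_C2 hmodel. Qed.

Lemma dfkin_differentiable v q : differentiable (fun x => 'D_v (fkin S) x) q.
Proof. by have [_ /(_ v) []] := fkin_C2 hmodel. Qed.

Lemma ddfkin_continuous v w : continuous (fun x => 'D_w (fun y => 'D_v (fkin S) y) x).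
Proof. by have [_ /(_ v) [_ /(_ w)]] := fkin_C2 hmodel. Qed.

Lemma jac_continuous : continuous (J S).
Proof.
move=> q; suff : {for q, continuous (J S)} by [].
apply/continuous_mxP => k l.
have -> : (fun x => J S x k l) = (fun x => ('D_(delta_mx l 0) (fkin S) x) k 0).
  by apply/funext => x; rewrite mxE.
have c := differentiable_continuous (dfkin_differentiable (delta_mx l 0) q).
exact: ((continuous_mxP _ _).1 c k 0).
Qed.

Lemma der_jac_entry q v k l : is_derive q v (fun x => J S x k l)
  (('D_v (fun x => 'D_(delta_mx l 0) (fkin S) x) q) k 0).
Proof.
have -> : (fun x => J S x k l) = (fun x => ('D_(delta_mx l 0) (fkin S) x) k 0).
  by apply/funext => x; rewrite mxE.
have h := derivableP (diff_derivable (v := v) (dfkin_differentiable (delta_mx l 0) q)).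
exact: ((is_derive_mxP _ _ _ _).1 h k 0).
Qed.

Lemma Jdot_entry q v k l :
  Jdot S q v k l = ('D_v (fun x => 'D_(delta_mx l 0) (fkin S) x) q) k 0.
Proof.
pose D : 'M[R]_n := \matrix_(k, l) ('D_v (fun x => 'D_(delta_mx l 0) (fkin S) x) q) k 0.
have h : is_derive q v (J S) D.
  by apply/is_derive_mxP => i j; rewrite mxE; exact: der_jac_entry.
by rewrite /Jdot; case: h => _ ->; rewrite mxE.
Qed.

Lemma der_jac_curve {q : R -> 'cV[R]_n} {dq : 'cV[R]_n} {t : R} : is_derive t 1 q dq ->
  is_derive t 1 (fun s => J S (q s)) (Jdot S (q t) dq).
Proof.
move=> hq; apply/is_derive_mxP => k l; rewrite Jdot_entry.
have -> : (fun s => J S (q s) k l) = (fun s => ('D_(delta_mx l 0) (fkin S) (q s)) k 0).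
  by apply/funext => x; rewrite mxE.
have h := der_curve (dfkin_differentiable (delta_mx l 0) (q t)) hq.
exact: ((is_derive_mxP _ _ _ _).1 h k 0).
Qed.

Lemma Jdot_expand q v k l :
  Jdot S q v k l = \sum_m v m 0 * Jdot S q (delta_mx m 0) k l.
Proof.
rewrite [LHS]Jdot_entry (derive_basis v (dfkin_differentiable (delta_mx l 0) q)) summxE.
by apply: eq_bigr => m _; rewrite mxE -Jdot_entry.
Qed.

Lemma Jdot_continuous v k l : continuous (fun q => Jdot S q v k l).
Proof.
have -> : (fun q => Jdot S q v k l) =
    (fun q => ('D_v (fun x => 'D_(delta_mx l 0) (fkin S) x) q) k 0).
  by apply/funext => q; rewrite Jdot_entry.
by move=> q; exact: ((continuous_mxP _ _).1 (@ddfkin_continuous (delta_mx l 0) v q) k 0).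
Qed.

Lemma Jdot_periodic v : periodic2pi (fun q => Jdot S q v).
Proof. exact: derive_periodic (J_periodic hmodel). Qed.

Lemma der_fkin_curve {q : R -> 'cV[R]_n} {dq : 'cV[R]_n} {t : R} : is_derive t 1 q dq ->
  is_derive t 1 (fun s => fkin S (q s)) (J S (q t) *m dq).
Proof.
move=> hq; have h := der_curve (fkin_differentiable (q t)) hq.
apply: is_derive_eq h _; rewrite (derive_basis dq (fkin_differentiable (q t))).
apply/matrixP => k j; rewrite ord1 summxE mxE; apply: eq_bigr => l _.
by rewrite !mxE mulrC.
Qed.

Lemma der_tinertia_curve th {q : R -> 'cV[R]_n} {dq : 'cV[R]_n} {t : R} :
  is_derive t 1 q dq -> J S (q t) \in unitmx ->
  is_derive t 1 (fun s => tinertia th (q s)) ('D_dq (tinertia th) (q t)).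
Proof.
move=> hq uJ.
pose D : 'M[R]_n := - (invmx (J S (q t)) *m Jdot S (q t) dq *m invmx (J S (q t))).
pose E := (D^T *m inertia th (q t) + (invmx (J S (q t)))^T *m 'D_dq (inertia th) (q t))
  *m invmx (J S (q t)) + (invmx (J S (q t)))^T *m inertia th (q t) *m D.
(* The same formula holds along any curve through [q t] with velocity [dq]; the
   straight line gives the directional derivative. *)
have key (g : R -> 'cV[R]_n) s : g s = q t -> is_derive s 1 g dq ->
    is_derive s 1 (fun x => tinertia th (g x)) E.
  move=> gs hg; have hJ := der_jac_curve hg; rewrite gs in hJ.
  have uJ' : J S (g s) \in unitmx by rewrite gs.
  have := der_invmx hJ uJ'; rewrite gs -/D => hI.
  have [dM _] := inertia_C1 hmodel th.
  have := der_curve (dM (g s)) hg; rewrite gs => hM.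
  by have := der_mulmx (der_mulmx (der_trmx hI) hM) hI; rewrite gs.
have h0 : is_derive (q t) dq (tinertia th) E.
  by apply: der_line; apply: key; [rewrite scale0r add0r|exact: der_line_id].
by case: h0 => _ ->; exact: key.
Qed.

Lemma tinertia_continuous_curve th (q : R -> 'cV[R]_n) t :
  {for t, continuous q} -> J S (q t) \in unitmx ->
  {for t, continuous (fun s => tinertia th (q s))}.
Proof.
move=> cq uJ.
have cI : {for t, continuous (fun s => invmx (J S (q s)))}.
  apply: (@continuous_invmx _ _ _ (fun s => J S (q s)) t _ uJ).
  apply: (@continuous_comp _ _ _ q (J S)) cq _.
  exact: jac_continuous.
have [dM _] := inertia_C1 hmodel th.
have cM : {for t, continuous (fun s => inertia th (q s))}.
  apply: (@continuous_comp _ _ _ q (inertia th)) cq _.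
  exact: differentiable_continuous (dM (q t)).
exact: (cvg_mulmx (cvg_mulmx (cvg_trmx cI) cM) cI).
Qed.

Lemma task_space_dynamics th q dq ddq f : J S q \in unitmx ->
  inertia th q *m ddq + coriolis th q dq *m dq + gravity th q = (J S q)^T *m f ->
  tinertia th q *m (Jdot S q dq *m dq + J S q *m ddq)
    + tcoriolis th q dq *m (J S q *m dq) + tgravity th q = f.
Proof.
move=> uJ eq1.
have uJT : (J S q)^T \in unitmx by rewrite unitmx_tr.
have -> : f = (invmx (J S q))^T *m ((J S q)^T *m f) by rewrite trmx_inv mulKmx.
rewrite -eq1 !mulmxDr /tinertia /tcoriolis mulmxBl -!mulmxA !(mulKmx uJ).
have cancel (x y z w : 'cV[R]_n) : x + y + (z - x) + w = y + z + w.
  by rewrite (addrC x) -(addrA y) (addrC x) subrK.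
exact: cancel.
Qed.

Variables (lam1 lam2 c : R) (gamma : 'cV[R]_n).
Hypothesis hprop : el_properties S lam1 lam2 c gamma.

Lemma tinertia_sym q : (tinertia (theta S) q)^T = tinertia (theta S) q.
Proof.
have [l1 [l2 [_ _ /(_ q) [sM _ _]]]] := inertia_bounds hprop.
by rewrite /tinertia !trmx_mul trmxK sM mulmxA.
Qed.

Lemma tinertia_solve_bound q (a b : 'cV[R]_n) : region S q ->
  tinertia (theta S) q *m a = b -> enorm a <= enorm b / lam1.
Proof.
move=> qr e; have l0 := lam1_gt0 hprop.
have [_ /loewner_lb h _] := tinertia_bounds hprop qr.
have := h a; rewrite qformE e => h1.
have := le_trans h1 (le_trans (ler_norm _) (cauchy_schwarz a b)).
have [->|a0] := eqVneq a 0; first by rewrite enorm0 divr_ge0 ?enorm_ge0 // ltW.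
have {}a0 : 0 < enorm a.
  by rewrite lt_neqAle enorm_ge0 andbT eq_sym; apply: contra a0 => /eqP/enorm_eq0->.
rewrite expr2 mulrA [lam1 * _]mulrC -mulrA ler_pM2l // => h2.
by rewrite ler_pdivlMr // mulrC.
Qed.

(** [M] is bounded below and [J^-T M J^-1] above, which keeps the operating
    region away from the singularities. *)
Lemma invjac_bounded : exists B, forall q, region S q ->
  forall i j, `|invmx (J S q) i j| <= B.
Proof.
have [l1 [l2 [l10 _ Mb]]] := inertia_bounds hprop.
exists (Num.sqrt (lam2 / l1)) => q qr i j.
pose y : 'cV[R]_n := delta_mx j 0.
have y1 : enorm y ^+ 2 = 1 by rewrite -dotvv dot_delta mxE !eqxx.
have -> : invmx (J S q) i j = (invmx (J S q) *m y) i 0.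
  rewrite mxE (bigD1 j) //= big1 ?addr0 => [|k kj]; first by rewrite mxE !eqxx mulr1.
  by rewrite mxE (negbTE kj) mulr0.
apply: le_trans (entry_le_enorm _ _) _; apply: ler_wsqrtr.
rewrite -enorm_sqr ler_pdivlMr // mulrC.
have [_ /loewner_lb h1 _] := Mb q; apply: le_trans (h1 _) _.
have [_ _ /loewner_ub h2] := tinertia_bounds hprop qr; have := h2 y.
rewrite y1 mulr1; apply: le_trans.
by rewrite !qformE /tinertia -!mulmxA dot_mulmx [X in _ <= X]dot_mulmx trmxK -dot_mulmx.
Qed.

(** The derivative of [M] is symmetric, so the skew-symmetry of [dM/dt - 2 C]
    determines it from [C]. *)
Lemma der_tinertia_split {q : R -> 'cV[R]_n} {dq : 'cV[R]_n} {t : R} :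
  region S (q t) -> is_derive t 1 q dq ->
  is_derive t 1 (fun s => tinertia (theta S) (q s))
    (tcoriolis (theta S) (q t) dq + (tcoriolis (theta S) (q t) dq)^T).
Proof.
move=> qr hq; have uJ := region_nonsingular hprop qr.
have h := der_tinertia_curve (theta S) hq uJ.
refine (is_derive_eq h _).
have sD : ('D_dq (tinertia (theta S)) (q t))^T = 'D_dq (tinertia (theta S)) (q t).
  have [_ e1] := der_trmx h; have [_ e2] := h; rewrite -e1 -[RHS]e2; congr ('D_1 _ t).
  by apply/funext => s; exact: tinertia_sym.
have := tinertia_skew hprop dq qr; rewrite /Defs.skew linearB linearZ /= sD => e.
set C := tcoriolis _ _ _ in e *; set D := 'D_dq _ _ in e *.
have e2 : 2 *: D = 2 *: (C + C^T).
  rewrite scalerDr; apply/eqP; rewrite -subr_eq0.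
  move/eqP: e; rewrite -subr_eq0 => /eqP e.
  rewrite -[X in _ == X]e scaler_nat mulr2n; apply/eqP.
  by apply/matrixP => i j; rewrite !mxE; ring.
by apply: (scalerI (_ : (2 : R) != 0)) e2; rewrite pnatr_eq0.
Qed.

End Manipulator.

(** * Projection of the parameter estimates *)

Section Projection.
Context {R : realType}.
Variable delta : R.
Hypothesis hdelta : 0 < delta.
Implicit Types lb ub th w : R.

(** The projection only removes from the update a component that points out of
    the box; a parameter lying outside the guard bands is therefore not moved
    away from. *)
Lemma proj1_correct lb ub th th0 w : lb + delta <= th0 <= ub - delta ->
  (th - th0) * proj1 lb ub delta th w <= (th - th0) * w.
Proof.
move=> /andP[h1 h2]; rewrite /proj1.
have ups0 u : 0 <= u -> 0 <= Num.min 1 (u / delta).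
  by move=> u0; rewrite le_min ler01 divr_ge0 // ltW.
case: ifP => [/andP[/andP[a1 a2] w0]|_].
  have := ups0 (lb + delta - th); rewrite subr_ge0 -/(ups_lb lb delta th).
  move=> /(_ a2) u0.
  rewrite -subr_ge0 -mulrBr; apply: mulr_le0; first lra.
  by rewrite mulrBl mul1r opprB addrCA subrr addr0 mulr_ge0_le0 // ltW.
case: ifP => [/andP[/andP[a1 a2] w0]|_]; last exact: lexx.
have := ups0 (th - ub + delta); rewrite -/(ups_ub ub delta th).
move=> /(_ _)/wrap[]; first lra.
move=> u0; rewrite -subr_ge0 -mulrBr; apply: mulr_ge0; first lra.
by rewrite mulrBl mul1r opprB addrCA subrr addr0 mulr_ge0 // ltW.
Qed.

Lemma proj1_norm lb ub th w : `|proj1 lb ub delta th w| <= `|w|.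
Proof.
rewrite /proj1.
have ups1 u : 0 <= u -> `|1 - Num.min 1 (u / delta)| <= 1.
  move=> u0; have : 0 <= Num.min 1 (u / delta) by rewrite le_min ler01 divr_ge0 // ltW.
  have : Num.min 1 (u / delta) <= 1 by rewrite ge_min lexx.
  by move=> a b; rewrite ger0_norm; lra.
case: ifP => [/andP[/andP[a1 a2] w0]|_].
  by rewrite normrM ler_piMl // ups1 // subr_ge0.
case: ifP => [/andP[/andP[a1 a2] w0]|_]; last exact: lexx.
by rewrite normrM ler_piMl // ups1 //; lra.
Qed.

End Projection.

(** * The closed loop *)

Lemma der_qform (R : realType) n (A : R -> 'M[R]_n) (dA : 'M[R]_n)
    (y : R -> 'cV[R]_n) (dy : 'cV[R]_n) (t : R) :
  is_derive t 1 A dA -> is_derive t 1 y dy -> (A t)^T = A t ->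
  is_derive t 1 (fun s => qform (A s) (y s))
    (2 * dot (y t) (A t *m dy) + dot (y t) (dA *m y t)).
Proof.
move=> hA hy sA.
have h := (is_derive_mxP _ _ _ _).1 (der_mulmx (der_mulmx (der_trmx hy) hA) hy) 0 0.
apply: is_derive_eq h _; rewrite mulmxDl -!mulmxA [LHS]mxE [X in X + _]mxE.
rewrite -/(dot dy (A t *m y t)) -/(dot (y t) (dA *m y t)) -/(dot (y t) (A t *m dy)).
have -> : dot dy (A t *m y t) = dot (y t) (A t *m dy) by rewrite dot_mulmx sA dotC.
ring.
Qed.

(** The arithmetic of the dissipation of one system: the adaptation absorbs the
    parametric error [F], and the weight [(a * m)^-1] makes the damping of the
    sliding variable [sv = v2 + a * ev] return the power [ev] received from the
    potential. *)
Lemma power_balance (R : realType) (a m b F sv v2 ev tp kh s2 : R) :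
  0 < a -> 0 < m -> sv = v2 + a * ev -> b * tp <= - F ->
  2^-1 * ((a * m)^-1 * (2 * (F - kh * s2 - m * sv) + b * (2 * tp))) + ev
  <= - (a^-1 * v2 + kh * (a * m)^-1 * s2).
Proof.
move=> a0 m0 -> h.
have h' : (a * m)^-1 * (F + b * tp) <= 0.
  by rewrite pmulr_rle0 ?invr_gt0 ?mulr_gt0 //; lra.
rewrite -subr_le0 (_ : _ - _ = (a * m)^-1 * (F + b * tp)) //.
by field; rewrite !gt_eqF.
Qed.

Lemma periodic2pi_entry (R : realType) n m p (A : 'cV[R]_n -> 'M[R]_(m, p)) k l :
  periodic2pi A -> periodic2pi (fun q => A q k l).
Proof. by move=> pA q a; rewrite pA. Qed.

Section ClosedLoop.
Context {R : realType}.
Variables (n N : nat) (S : 'I_N -> el_system R n).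
Variables (lam1 lam2 c : 'I_N -> R) (gamma : 'I_N -> 'cV[R]_n).
Hypothesis hmodel : forall i, revolute_model (S i).
Hypothesis hprop : forall i,
  el_properties (S i) (lam1 i) (lam2 i) (c i) (gamma i).
Variables (r : R) (phi : R -> R -> R) (sigma nu : R -> R).
Hypothesis hr : 0 < r.
Hypothesis hpot : potential n r phi sigma nu.
Variables (Q alpha : R) (mu kappa beta : 'I_N -> R).
Hypothesis hQ : 0 < Q.
Hypothesis halpha : 0 < alpha.
Hypothesis hmu : forall i, 0 < mu i.
Hypothesis hkappa : forall i, 0 < kappa i.
Hypothesis hbeta : forall i, 0 < beta i.
Variable delta : R.
Hypothesis hdelta : 0 < delta.
Hypothesis hguard : forall i k,
  theta_lb (S i) k 0 + delta <= theta (S i) k 0 <= theta_ub (S i) k 0 - delta.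
Variables (E0 : rel 'I_N) (X : trajectory S).
Hypothesis Esym : symmetric E0.
Hypothesis Eirr : irreflexive E0.
Hypothesis hloop : closed_loop E0 phi Q alpha mu kappa beta delta X.
Hypothesis q_continuous : forall i, continuous (tq X i).
Hypothesis dq_continuous : forall i, continuous (tdq X i).
Hypothesis that_continuous : forall i, continuous (that X i).
Hypothesis X_region : forall i t, region (S i) (tq X i t).
Implicit Types (i j : 'I_N) (t s : R).

Local Notation x_ := (pos X).
Local Notation v_ := (vel X).
Local Notation rel_ := (relpos X).
Local Notation e_ := (err E0 phi Q X).
Local Notation de_ := (derr E0 phi Q X).
Local Notation s_ := (slide E0 phi Q alpha X).
Local Notation Phi_ := (Phi E0 phi Q alpha X).
Local Notation omega_ := (omega E0 phi Q alpha beta X).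
Local Notation fhat_ := (fhat E0 phi Q alpha mu kappa X).
Local Notation M_ i t := (tinertia (theta (S i)) (tq X i t)).
Local Notation C_ i t := (tcoriolis (theta (S i)) (tq X i t) (tdq X i t)).
Local Notation g_ i t := (tgravity (theta (S i)) (tq X i t)).
Local Notation phi1 := (derive1n 1 (phi Q)).
Local Notation psi_ i j t := (psi_vec phi Q (rel_ i j t)).

Definition acc i t := Jdot (S i) (tq X i t) (tdq X i t) *m tdq X i t
  + J (S i) (tq X i t) *m tddq X i t.

Definition tilde i t := that X i t - theta (S i).

Definition connected_at t := forall i j, E0 i j -> enorm (rel_ i j t) < r.

Lemma der_pos i t : 0 < t -> is_derive t 1 (x_ i) (v_ i t).
Proof. by move=> t0; have h := der_fkin_curve (hmodel i) (q_deriv hloop i t0); exact: h. Qed.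

Lemma der_relpos i j t : 0 < t -> is_derive t 1 (rel_ i j) (v_ i t - v_ j t).
Proof. by move=> t0; apply: is_deriveB; exact: der_pos. Qed.

Lemma jac_along_continuous i : continuous (fun t => J (S i) (tq X i t)).
Proof.
move=> t; apply: (@continuous_comp _ _ _ (tq X i) (J (S i))); first exact: q_continuous.
exact: jac_continuous.
Qed.

Lemma pos_continuous i : continuous (x_ i).
Proof.
move=> t; apply: (@continuous_comp _ _ _ (tq X i) (fkin (S i))); first exact: q_continuous.
exact: differentiable_continuous (fkin_differentiable (hmodel i) _).
Qed.

Lemma relpos_continuous i j : continuous (rel_ i j).
Proof. by move=> t; apply: cvgB; exact: pos_continuous. Qed.

Lemma vel_continuous i : continuous (v_ i).
Proof.
by move=> t; exact: (cvg_mulmx (@jac_along_continuous i t) (@dq_continuous i t)).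
Qed.

Lemma der_vel i t : 0 < t -> is_derive t 1 (v_ i) (acc i t).
Proof.
move=> t0; have hJ := der_jac_curve (hmodel i) (q_deriv hloop i t0).
exact: (der_mulmx hJ (dq_deriv hloop i t0)).
Qed.

Lemma connected_nbr t i j : connected_at t -> j \in nbrs E0 i ->
  enorm (rel_ i j t) < r.
Proof. by move=> ct; rewrite inE => ji; apply: ct; rewrite Esym. Qed.

Lemma relpos_sym i j t : rel_ j i t = - rel_ i j t.
Proof. by rewrite /relpos opprB. Qed.

(** The gradient of the potential of one link, written out: it is the term of
    [err] for that link as long as the link is within the communication radius. *)
Definition pull i j t := (2 * phi1 (enorm (rel_ i j t) ^+ 2)) *: rel_ i j t.

Lemma errE i t : connected_at t -> e_ i t = \sum_(j in nbrs E0 i) pull i j t.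
Proof.
move=> ct; apply: eq_bigr => j ij.
by rewrite (grad_psi hpot) // ltW // connected_nbr.
Qed.

Lemma pull_sym i j t : pull j i t = - pull i j t.
Proof. by rewrite /pull relpos_sym enormN scalerN. Qed.

(** The radius bounds being strict, the explicit form of [err] holds around [t]
    as well, so that it can be differentiated. *)
Lemma near_connected t : connected_at t -> \forall s \near t, connected_at s.
Proof.
move=> ct.
suff : \forall s \near t, forall i j, E0 i j -> enorm (rel_ i j s) < r by [].
apply: (@filter_forall _ _
  (fun i s => forall j, E0 i j -> enorm (rel_ i j s) < r) (nbhs t)) => i.
apply: (@filter_forall _ _ (fun j s => E0 i j -> enorm (rel_ i j s) < r) (nbhs t)) => j.
have [Eij|nE] := boolP (E0 i j); last by near=> s.
have cn : {for t, continuous (fun s => enorm (rel_ i j s) ^+ 2)}.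
  apply: (@continuous_comp _ _ _ (rel_ i j) (fun z => enorm z ^+ 2)).
    exact: relpos_continuous.
  exact: continuous_enorm_sqr.
have lt2 s : (enorm (rel_ i j s) ^+ 2 < r ^+ 2) = (enorm (rel_ i j s) < r).
  by rewrite ltr_sqr ?nnegrE ?enorm_ge0 // ltW.
have : \forall s \near t, enorm (rel_ i j s) ^+ 2 < r ^+ 2.
  apply: (cn [set u | u < r ^+ 2]); apply: open_nbhs_nbhs; split; first exact: open_lt.
  by rewrite /= lt2; exact: ct.
by apply: filterS => s; rewrite lt2.
Unshelve. all: by end_near. Qed.

Lemma der_err i t : 0 < t -> connected_at t -> is_derive t 1 (e_ i) (de_ i t).
Proof.
move=> t0 ct.
apply: (@near_eq_is_derive _ _ _ (fun s => \sum_(j in nbrs E0 i) pull i j s)).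
  by apply: filterS (near_connected ct) => s cs; rewrite errE.
apply/is_derive_mxP => k l.
have -> : (fun s => (\sum_(j in nbrs E0 i) pull i j s) k l) =
    (fun s => \sum_(j in nbrs E0 i) pull i j s k l).
  by apply/funext => s; rewrite summxE.
rewrite summxE; apply: der_sum => j ij.
have rij := connected_nbr ct ij.
have h := der_grad_psi hpot hr hQ (der_relpos i j t0) (ltW rij).
rewrite (hess_psi hpot hr hQ rij).
exact: ((is_derive_mxP _ _ _ _).1 h k l).
Qed.

Lemma err_continuous i t : connected_at t -> {for t, continuous (e_ i)}.
Proof.
move=> ct.
have h : {for t, continuous (fun s => \sum_(j in nbrs E0 i) pull i j s)}.
  apply: cvg_big => [|j ij]; first exact: add_continuous.
  apply: cvgZ; last exact: relpos_continuous.
  apply: cvgM; first exact: cvg_cst.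
  apply: (@continuous_comp _ _ _ (fun s => enorm (rel_ i j s) ^+ 2) phi1).
    apply: (@continuous_comp _ _ _ (rel_ i j) (fun z => enorm z ^+ 2)).
      exact: relpos_continuous.
    exact: continuous_enorm_sqr.
  apply: is_derive_continuous; apply: (der_phi hpot hQ 1).
  by apply: (enorm_sqr_le hr); apply: ltW; exact: connected_nbr.
suff : e_ i s @[s --> t] --> e_ i t by [].
rewrite (errE i ct); apply: cvg_trans h; apply: near_eq_cvg.
by apply: filterS (near_connected ct) => s cs; rewrite errE.
Qed.

Lemma actual_gain i t : 0 <= t -> exists kh,
  [/\ 0 < kh <= kappa i,
      tf X i t = Phi_ i t *m that X i t - kh *: s_ i t - mu i *: v_ i t
    & within_limits S i (fhat_ i t) -> kh = kappa i].
Proof.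
move=> t0; have [_ h1 h2] := actuation hloop i t0.
have [wl|nwl] := pselect (within_limits S i (fhat_ i t)).
  by exists (kappa i); split => //; [rewrite hkappa /= lexx|exact: h1].
by have [kh kh0 fe] := h2 nwl; exists kh; split.
Qed.

Lemma task_dynamics i t : 0 < t ->
  M_ i t *m acc i t + C_ i t *m v_ i t + g_ i t = tf X i t.
Proof.
move=> t0; apply: task_space_dynamics; last exact: (dynamics hloop i t0).
have h := region_nonsingular (hprop i) (X_region i t); exact: h.
Qed.

(** The regressor is evaluated at the reference velocity [- alpha * err], for
    which the tracking error is exactly the sliding variable. *)
Lemma slide_dynamics i t : 0 < t ->
  M_ i t *m (acc i t + alpha *: de_ i t) + C_ i t *m s_ i t =
  tf X i t - Phi_ i t *m theta (S i).
Proof.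
move=> t0; rewrite -(task_dynamics i t0).
rewrite /Phi -(linear_param (hprop i) _ _ _ _ (X_region i t)).
rewrite /slide !mulmxDr !mulmxN.
set a := M_ i t *m acc i t; set b := _ *m (alpha *: _).
set d := C_ i t *m v_ i t; set f := C_ i t *m (alpha *: _).
by apply/matrixP => k l; rewrite ![in LHS]mxE ![in RHS]mxE; ring.
Qed.

Lemma adaptation_decrease i t :
  (beta i)^-1 * dot (tilde i t)
     (Defs.proj (theta_lb (S i)) (theta_ub (S i)) delta (that X i t) (omega_ i t))
  <= - dot (s_ i t) (Phi_ i t *m tilde i t).
Proof.
have -> : - dot (s_ i t) (Phi_ i t *m tilde i t) =
    (beta i)^-1 * dot (tilde i t) (omega_ i t).
  rewrite /omega dotNr dotZr mulrN mulrA mulVf ?gt_eqF // mul1r.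
  by rewrite dot_mulmx dotC.
rewrite ler_pM2l ?invr_gt0 // !dotE; apply: ler_sum => k _.
rewrite /tilde !mxE; apply: (proj1_correct hdelta); exact: hguard.
Qed.

Lemma der_slide i t : 0 < t -> connected_at t ->
  is_derive t 1 (s_ i) (acc i t + alpha *: de_ i t).
Proof.
move=> t0 ct; have h := is_deriveD (der_vel i t0) (is_deriveZ alpha (der_err i t0 ct)).
exact: h.
Qed.

Lemma slide_continuous i t : connected_at t -> {for t, continuous (s_ i)}.
Proof.
move=> ct; apply: cvgD; first exact: vel_continuous.
by apply: cvgZr; exact: err_continuous.
Qed.

Lemma der_tilde i t : 0 < t -> is_derive t 1 (tilde i)
  (Defs.proj (theta_lb (S i)) (theta_ub (S i)) delta (that X i t) (omega_ i t)).
Proof.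
move=> t0; have h := is_deriveB (adaptation hloop i t0) (is_derive_cst (theta (S i)) t 1).
by apply: is_derive_eq h _; rewrite subr0.
Qed.

Lemma tilde_continuous i : continuous (tilde i).
Proof. by move=> t; apply: cvgB; [exact: that_continuous|exact: cvg_cst]. Qed.

(** * The Lyapunov function *)

(** Kinetic energy of the sliding variables, estimation error and potential of
    the links, weighted so that the power exchanged through the potential is
    exactly balanced by the damping terms. *)
Definition lyapunov t :=
  2^-1 * (\sum_i (alpha * mu i)^-1 * (qform (M_ i t) (s_ i t)
                                      + (beta i)^-1 * enorm (tilde i t) ^+ 2))
  + 2^-1 * (\sum_i \sum_(j in nbrs E0 i) psi_ i j t).

Lemma der_kinetic i t kh : 0 < t -> connected_at t ->
  tf X i t = Phi_ i t *m that X i t - kh *: s_ i t - mu i *: v_ i t ->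
  is_derive t 1 (fun s => qform (M_ i s) (s_ i s))
    (2 * (dot (s_ i t) (Phi_ i t *m tilde i t) - kh * enorm (s_ i t) ^+ 2
          - mu i * dot (s_ i t) (v_ i t))).
Proof.
move=> t0 ct fE.
have hM := der_tinertia_split (hmodel i) (hprop i) (X_region i t) (q_deriv hloop i t0).
have h := der_qform hM (der_slide i t0 ct) (tinertia_sym (hprop i) _).
apply: is_derive_eq h _.
have -> : dot (s_ i t) ((C_ i t + (C_ i t)^T) *m s_ i t) = 2 * dot (s_ i t) (C_ i t *m s_ i t).
  rewrite mulmxDl dotDr [X in _ + X]dot_mulmx trmxK [X in _ + X]dotC; ring.
rewrite -mulrDr -dotDr (slide_dynamics i t0) fE; congr (2 * _).
rewrite -dotvv -!dotZr -!dotBr /tilde mulmxBr; congr dot.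
by rewrite addrAC; congr (_ - _); rewrite addrAC.
Qed.

(** The two ends of a link are pulled by opposite forces, so each link is counted
    once from either side. *)
Lemma pull_power t (y : 'I_N -> 'cV[R]_n) :
  2^-1 * (\sum_i \sum_(j in nbrs E0 i) dot (pull i j t) (y i - y j)) =
  \sum_i dot (\sum_(j in nbrs E0 i) pull i j t) (y i).
Proof.
have e1 : \sum_i \sum_(j in nbrs E0 i) dot (pull i j t) (y i - y j) =
    (\sum_i \sum_(j in nbrs E0 i) dot (pull i j t) (y i)) -
    (\sum_i \sum_(j in nbrs E0 i) dot (pull i j t) (y j)).
  rewrite -sumrB; apply: eq_bigr => i _; rewrite -sumrB; apply: eq_bigr => j _.
  by rewrite dotBr.
have e2 : \sum_i \sum_(j in nbrs E0 i) dot (pull i j t) (y j) =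
    - \sum_i \sum_(j in nbrs E0 i) dot (pull i j t) (y i).
  rewrite (exchange_big_dep predT) //= -sumrN; apply: eq_bigr => j _.
  rewrite -sumrN; apply: eq_big => [i|i _]; first by rewrite !inE Esym.
  by rewrite pull_sym dotC dotNr dotC.
rewrite e1 e2 opprK -mulr2n -[X in 2^-1 * X]mulr_natl mulKf ?pnatr_eq0 //.
by apply: eq_bigr => i _; rewrite dotC dot_sumr; apply: eq_bigr => j _; rewrite dotC.
Qed.

Lemma der_lyapunov t (kh : 'I_N -> R) : 0 < t -> connected_at t ->
  (forall i, tf X i t = Phi_ i t *m that X i t - kh i *: s_ i t - mu i *: v_ i t) ->
  is_derive t 1 lyapunov ('D_1 lyapunov t) /\
  'D_1 lyapunov t <= - \sum_i (alpha^-1 * enorm (v_ i t) ^+ 2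
                               + kh i * (alpha * mu i)^-1 * enorm (s_ i t) ^+ 2).
Proof.
move=> t0 ct fE.
pose P i := Defs.proj (theta_lb (S i)) (theta_ub (S i)) delta (that X i t) (omega_ i t).
pose k i := (alpha * mu i)^-1 *
  (2 * (dot (s_ i t) (Phi_ i t *m tilde i t) - kh i * enorm (s_ i t) ^+ 2
        - mu i * dot (s_ i t) (v_ i t)) + (beta i)^-1 * (2 * dot (tilde i t) (P i))).
have h1 i : is_derive t 1 (fun s => (alpha * mu i)^-1 * (qform (M_ i s) (s_ i s)
     + (beta i)^-1 * enorm (tilde i s) ^+ 2)) (k i).
  apply: der_scale; apply: der_add; first exact: der_kinetic (fE i).
  by apply: der_scale; apply: der_enorm_sqr; exact: der_tilde.
have h2 i j : j \in nbrs E0 i ->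
    is_derive t 1 (fun s => psi_ i j s) (dot (pull i j t) (v_ i t - v_ j t)).
  move=> ij; apply: (der_psi hpot hr hQ); first exact: der_relpos.
  exact: ltW (connected_nbr ct ij).
have hV : is_derive t 1 lyapunov (2^-1 * (\sum_i k i) +
    2^-1 * (\sum_i \sum_(j in nbrs E0 i) dot (pull i j t) (v_ i t - v_ j t))).
  have hA := der_sum (P := predT) (fun i _ => h1 i).
  have hB := der_sum (P := predT) (fun i _ => der_sum (h2 i)).
  exact: (der_add (der_scale 2^-1 hA) (der_scale 2^-1 hB)).
case: (hV) => dV VE; split; first exact: derivableP.
rewrite VE (pull_power t (fun i => v_ i t)) -sumrN mulr_sumr -big_split /=.
apply: ler_sum => i _.
rewrite -(errE i ct) /k.
have a0 := halpha; have m0 := hmu i.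
have sv : dot (s_ i t) (v_ i t) = enorm (v_ i t) ^+ 2 + alpha * dot (e_ i t) (v_ i t).
  by rewrite /slide dotDl dotZl dotvv.
exact: (power_balance _ _ a0 m0 sv (adaptation_decrease i t)).
Qed.

Lemma lyapunov_term_ge0 t i : connected_at t ->
  0 <= lam1 i * enorm (s_ i t) ^+ 2 <= qform (M_ i t) (s_ i t).
Proof.
move=> ct; apply/andP; split.
  by rewrite mulr_ge0 ?sqr_ge0 // ltW // (lam1_gt0 (hprop i)).
by have [_ /loewner_lb h _] := tinertia_bounds (hprop i) (X_region i t).
Qed.

Lemma psi_ge0 t i j : connected_at t -> j \in nbrs E0 i -> 0 <= psi_ i j t.
Proof.
move=> ct ij; have rij := connected_nbr ct ij.
have [p0 p1] := pot_posdef hpot hQ.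
have [d0|d0] := eqVneq (enorm (rel_ i j t)) 0; first by rewrite /psi_vec d0 p0.
by apply/ltW/p1; rewrite lt_neqAle eq_sym d0 enorm_ge0 ltW.
Qed.

Lemma lyapunov_parts t i : connected_at t ->
  2^-1 * ((alpha * mu i)^-1 * (lam1 i * enorm (s_ i t) ^+ 2
    + (beta i)^-1 * enorm (tilde i t) ^+ 2)) <= lyapunov t /\
  forall j, E0 i j -> psi_ i j t <= lyapunov t.
Proof.
move=> ct.
have am0 k : 0 < (alpha * mu k)^-1 by rewrite invr_gt0 mulr_gt0.
have W0 k : 0 <= lam1 k * enorm (s_ k t) ^+ 2 + (beta k)^-1 * enorm (tilde k t) ^+ 2 <=
    qform (M_ k t) (s_ k t) + (beta k)^-1 * enorm (tilde k t) ^+ 2.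
  have /andP[h1 h2] := lyapunov_term_ge0 k ct.
  have h3 : 0 <= (beta k)^-1 * enorm (tilde k t) ^+ 2.
    by rewrite mulr_ge0 ?sqr_ge0 // invr_ge0 ltW.
  by rewrite addr_ge0 //= lerD2r.
have W1 k : 0 <= (alpha * mu k)^-1 *
    (qform (M_ k t) (s_ k t) + (beta k)^-1 * enorm (tilde k t) ^+ 2).
  by have /andP[a b] := W0 k; rewrite mulr_ge0 ?(le_trans a b) // ltW.
have P0 k : 0 <= \sum_(j in nbrs E0 k) psi_ k j t.
  by apply: sumr_ge0 => j kj; exact: psi_ge0.
split.
  rewrite -[leLHS]addr0 lerD //; last by rewrite mulr_ge0 ?sumr_ge0 // invr_ge0.
  rewrite ler_pM2l ?invr_gt0 // (bigD1 i) //= -[leLHS]addr0 lerD ?sumr_ge0 //.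
  by rewrite ler_pM2l //; have /andP[] := W0 i.
move=> j Eij; have ij : i != j by apply: contraTneq Eij => ->; rewrite Eirr.
rewrite -[leLHS]add0r lerD //; first by rewrite mulr_ge0 ?sumr_ge0 // invr_ge0.
have half k l : E0 k l -> psi_ k l t <= \sum_(l in nbrs E0 k) psi_ k l t.
  move=> kl; have lk : l \in nbrs E0 k by rewrite inE Esym.
  by rewrite (bigD1 l) //= lerDl sumr_ge0 // => m /andP[km _]; exact: psi_ge0.
have psiC : psi_ j i t = psi_ i j t by rewrite /psi_vec relpos_sym enormN.
have : psi_ i j t + psi_ j i t <= \sum_k \sum_(l in nbrs E0 k) psi_ k l t.
  rewrite (bigD1 i) //=; apply: lerD; first exact: half.
  apply: le_trans (half j i _) _; first by rewrite Esym.
  rewrite [leRHS](bigD1 j) /=; last by rewrite eq_sym.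
  by rewrite lerDl sumr_ge0.
by rewrite psiC; lra.
Qed.

Lemma psi_continuous i j t : enorm (rel_ i j t) <= r ->
  {for t, continuous (fun s => psi_ i j s)}.
Proof.
move=> rij; apply: (@continuous_comp _ _ _ (fun s => enorm (rel_ i j s) ^+ 2) (phi Q)).
  apply: (@continuous_comp _ _ _ (rel_ i j) (fun z => enorm z ^+ 2)).
    exact: relpos_continuous.
  exact: continuous_enorm_sqr.
by apply: is_derive_continuous; apply: (der_phi hpot hQ 0); exact: enorm_sqr_le.
Qed.

Lemma lyapunov_continuous t : connected_at t -> {for t, continuous lyapunov}.
Proof.
move=> ct.
suff : lyapunov s @[s --> t] --> lyapunov t by [].
have cM i : {for t, continuous (fun s => M_ i s)}.
  apply: (tinertia_continuous_curve (hmodel i)); first exact: q_continuous.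
  have h := region_nonsingular (hprop i) (X_region i t); exact: h.
have cq i : {for t, continuous (fun s => qform (M_ i s) (s_ i s))}.
  have cs := @slide_continuous i t ct.
  exact: ((continuous_mxP _ _).1 (cvg_mulmx (cvg_mulmx (cvg_trmx cs) (cM i)) cs) 0 0).
apply: cvgD; apply: cvgM; try exact: cvg_cst.
  apply: cvg_big => [|i _]; first exact: add_continuous.
  apply: cvgM; first exact: cvg_cst.
  apply: cvgD; first exact: cq.
  apply: cvgM; first exact: cvg_cst.
  apply: (@continuous_comp _ _ _ (tilde i) (fun z => enorm z ^+ 2)).
    exact: tilde_continuous.
  exact: continuous_enorm_sqr.
apply: cvg_big => [|i _]; first exact: add_continuous.
apply: cvg_big => [|j ij]; first exact: add_continuous.
exact: psi_continuous (ltW (connected_nbr ct ij)).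
Qed.
(** * Preservation of the links *)

Lemma lyapunov_nonincreasing a b : 0 <= a -> a <= b ->
  (forall t, a <= t <= b -> connected_at t) -> lyapunov b <= lyapunov a.
Proof.
move=> a0 ab ct; rewrite -subr_le0 -[leRHS](mul0r (b - a)).
have H t : a < t < b -> is_derive t 1 lyapunov ('D_1 lyapunov t) /\ 'D_1 lyapunov t <= 0.
  move=> /andP[at_ tb]; have t0 : 0 < t by exact: le_lt_trans at_.
  have /choice [kh Hkh] := fun i => actual_gain i (ltW t0).
  have ctt : connected_at t by apply: ct; rewrite !ltW.
  have [|h1 h2] := @der_lyapunov t kh t0 ctt; first by move=> i; have [] := Hkh i.
  split=> //; apply: le_trans h2 _; rewrite oppr_le0; apply: sumr_ge0 => i _.
  have [/andP[k0 _] _ _] := Hkh i.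
  apply: addr_ge0; apply: mulr_ge0; rewrite ?sqr_ge0 //; first by rewrite invr_ge0 ltW.
  by rewrite mulr_ge0 ?(ltW k0) // invr_ge0 mulr_ge0 // ltW.
apply: mean_value_le ab _ (fun t tab => (H t tab).1) (fun t tab => (H t tab).2).
by move=> t tab; apply: lyapunov_continuous; exact: ct.
Qed.

(** The initial energy is estimated through the largest eigenvalue of the initial
    inertia and the size of the box containing both the parameters and their
    estimates. *)
Lemma lyapunov_initial (lam20 : 'I_N -> R) :
  (forall i, max_eigenvalue (M_ i 0) (lam20 i)) ->
  lyapunov 0 <= 2^-1 * (\sum_i (alpha * mu i)^-1
      * (lam20 i * enorm (s_ i 0) ^+ 2
         + (beta i)^-1 * enorm (theta_ub (S i) - theta_lb (S i)) ^+ 2))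
    + 2^-1 * (\sum_i \sum_(j in nbrs E0 i) psi_ i j 0).
Proof.
move=> hlam; rewrite lerD2r ler_pM2l ?invr_gt0 //; apply: ler_sum => i _.
rewrite ler_pM2l ?invr_gt0 ?mulr_gt0 //; apply: lerD.
  by apply: qform_le_max_eigenvalue => //; exact: tinertia_sym (hprop i) _.
rewrite ler_pM2l ?invr_gt0 // !enorm_sqr; apply: ler_sum => k _.
have [lb_th th_ub] := theta_in_box (hprop i); have [lb_ini ini_ub] := that_init hloop i.
rewrite !mxE -(real_normK (num_real (_ - theta (S i) k 0))).
rewrite ler_sqr ?nnegrE // ?ler_norml.
  by have := lb_th k; have := th_ub k; have := lb_ini k; have := ini_ub k; lra.
by have := lb_th k; have := th_ub k; lra.
Qed.

Hypothesis connected0 : connected_at 0.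
Hypothesis lyapunov0 : lyapunov 0 < psi phi Q r.

(** A link reaching the radius [r] would carry alone the potential [psi r], more
    than the energy available. *)
Lemma stays_connected t : 0 <= t -> connected_at t.
Proof.
pose D (p : 'I_N * 'I_N) s := if E0 p.1 p.2 then enorm (rel_ p.1 p.2 s) ^+ 2 else 0.
have sq u : 0 <= u -> (u ^+ 2 < r ^+ 2) = (u < r).
  by move=> u0; rewrite ltr_sqr ?nnegrE // ltW.
have DP s : connected_at s <-> forall p, D p s < r ^+ 2.
  split=> [cs [i j]|H i j Eij].
    rewrite /D /=; case: ifP => Eij; last by rewrite exprn_gt0.
    by rewrite sq ?enorm_ge0 //; exact: cs.
  by have := H (i, j); rewrite /D /= Eij sq ?enorm_ge0.
have cD p : continuous (D p).
  case: p => i j u; rewrite /D /=; case: (E0 i j); last exact: cvg_cst.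
  apply: (@continuous_comp _ _ _ (rel_ i j) (fun z => enorm z ^+ 2)).
    exact: relpos_continuous.
  exact: continuous_enorm_sqr.
move=> t0; apply/DP; move: t t0; apply: (first_exit cD) => [|t t0 H p]; first exact/DP.
have cs s : 0 <= s < t -> connected_at s by move=> st; apply/DP; exact: H.
case: p => i j; rewrite /D /=; case: ifP => Eij; last by rewrite exprn_gt0.
have rij : enorm (rel_ i j t) <= r.
  have : enorm (rel_ i j t) ^+ 2 <= r ^+ 2.
    apply: (@left_limit_le _ (fun s => enorm (rel_ i j s) ^+ 2)) t0 _ => [|s st].
      apply: (@continuous_comp _ _ _ (rel_ i j) (fun z => enorm z ^+ 2)).
        exact: relpos_continuous.
      exact: continuous_enorm_sqr.
    by apply: ltW; rewrite sq ?enorm_ge0 //; exact: cs.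
  by rewrite ler_sqr ?nnegrE ?enorm_ge0 // ltW.
have psi_le : psi_ i j t <= lyapunov 0.
  apply: left_limit_le (psi_continuous rij) t0 _ => s /andP[s0 st].
  have css u : 0 <= u <= s -> connected_at u.
    by move=> /andP[u0 us]; apply: cs; rewrite u0 (le_lt_trans us).
  have [_ /(_ j Eij) h] := lyapunov_parts i (css s (introT andP (conj s0 (lexx s)))).
  by apply: le_trans h _; exact: lyapunov_nonincreasing.
rewrite sq ?enorm_ge0 // lt_neqAle rij andbT; apply/eqP => e.
by move: psi_le; rewrite leNgt /psi_vec e lyapunov0.
Qed.
(** * The velocities vanish *)

Lemma lyapunov_decreases t : 0 <= t -> lyapunov t < psi phi Q r.
Proof.
move=> t0; apply: le_lt_trans lyapunov0; apply: lyapunov_nonincreasing => // s /andP[s0 _].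
exact: stays_connected.
Qed.

Lemma sigma_gt0 : 0 < sigma Q.
Proof.
have := pot_slope hpot hQ (d := 0); rewrite lexx ltW // => /(_ isT) /andP[h1 h2].
exact: le_lt_trans h2.
Qed.

Definition slide_bound i := Num.sqrt (2 * alpha * mu i * psi phi Q r / lam1 i).

Lemma slide_le i t : 0 <= t -> enorm (s_ i t) <= slide_bound i.
Proof.
move=> t0; have [h _] := lyapunov_parts i (stays_connected t0).
have {h} := le_lt_trans h (lyapunov_decreases t0).
have l0 := lam1_gt0 (hprop i).
have b0 : 0 <= (beta i)^-1 * enorm (tilde i t) ^+ 2.
  by rewrite mulr_ge0 ?sqr_ge0 // invr_ge0 ltW.
rewrite mulrA -invfM ltr_pdivrMl ?mulr_gt0 // => h.
apply: ler_wsqrtr; rewrite -enorm_sqr ler_pdivlMr // mulrC.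
have -> : 2 * alpha * mu i * psi phi Q r = (alpha * mu i) * 2 * psi phi Q r by ring.
by lra.
Qed.

Lemma tilde_ebounded i k : ebounded (fun t => tilde i t k 0).
Proof.
apply: (@ebounded_entries _ _ (tilde i)).
exists (Num.sqrt (beta i * (2 * (alpha * mu i) * psi phi Q r))).
apply: near_gt0 => t /ltW t0; rewrite ger0_norm ?enorm_ge0 //.
have [h _] := lyapunov_parts i (stays_connected t0).
have {h} := le_lt_trans h (lyapunov_decreases t0).
have s0 : 0 <= lam1 i * enorm (s_ i t) ^+ 2.
  by rewrite mulr_ge0 ?sqr_ge0 // ltW // (lam1_gt0 (hprop i)).
rewrite mulrA -invfM ltr_pdivrMl ?mulr_gt0 // => h.
apply: ler_wsqrtr; rewrite -enorm_sqr -ler_pdivrMl //.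
by rewrite [2 * _]mulrC; lra.
Qed.

Lemma slide_ebounded i k : ebounded (fun t => s_ i t k 0).
Proof.
apply: (@ebounded_entries _ _ (s_ i)); exists (slide_bound i).
by apply: near_gt0 => t /ltW t0; rewrite ger0_norm ?enorm_ge0 // slide_le.
Qed.

Lemma err_ebounded i k : ebounded (fun t => e_ i t k 0).
Proof.
exists (\sum_(j in nbrs E0 i) 2 * sigma Q * r); apply: near_gt0 => t /ltW t0.
have ct := stays_connected t0; rewrite (errE i ct) summxE.
apply: le_trans (ler_norm_sum _ _ _) _; apply: ler_sum => j ij.
have rij := connected_nbr ct ij.
have /andP[p0 p1] := slope_bounds hpot hQ (ltW rij).
rewrite mxE normrM ger0_norm; last by rewrite mulr_ge0.
apply: ler_pM => //; first by rewrite mulr_ge0.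
  by rewrite ler_pM2l // ltW.
by apply: le_trans (entry_le_enorm _ _) _; exact: ltW.
Qed.

Lemma velE i t : v_ i t = s_ i t - alpha *: e_ i t.
Proof. by rewrite /slide addrK. Qed.

Lemma vel_ebounded i k : ebounded (fun t => v_ i t k 0).
Proof.
have -> : (fun t => v_ i t k 0) = (fun t => s_ i t k 0 + - alpha * e_ i t k 0).
  by apply/funext => t; rewrite velE !mxE mulNr.
by apply: eboundedD (slide_ebounded i k) _; apply: ebounded_scale; exact: err_ebounded.
Qed.

Lemma hess_ebounded i j k l : j \in nbrs E0 i ->
  ebounded (fun t => hess (@psi_vec R n phi Q) (rel_ i j t) k l).
Proof.
move=> ij; have [B HB] := phi2_bounded hpot hQ.
exists (2 * sigma Q + 4 * B * r ^+ 2); apply: near_gt0 => t /ltW t0.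
have rij := connected_nbr (stays_connected t0) ij.
have /andP[p0 p1] := slope_bounds hpot hQ (ltW rij).
have u0 := HB _ (enorm_sqr_le hr (ltW rij)).
rewrite (hess_psi hpot hr hQ rij).
move: (rel_ i j t) rij p0 p1 u0 => y rij p0 p1 u0; rewrite !mxE.
apply: le_trans (ler_normD _ _) _; apply: lerD.
  case: (k == l); rewrite ?mulr1n ?mulr0n ?normr0.
    by rewrite ger0_norm ?mulr_ge0 // ler_pM2l // ltW.
  by rewrite mulr_ge0 // ltW // sigma_gt0.
have yk m : `|y m 0| <= r by apply: le_trans (entry_le_enorm _ _) (ltW rij).
rewrite big_ord1 !mxE !normrM; apply: ler_pM; rewrite ?mulr_ge0 //.
  by rewrite [`|4|]ger0_norm // ler_pM2l.
by rewrite [leRHS]expr2; apply: ler_pM => //; exact: yk.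
Qed.

Lemma derrE i k : (fun t => de_ i t k 0) = (fun t => \sum_(j in nbrs E0 i)
  (hess (@psi_vec R n phi Q) (rel_ i j t) *m (v_ i t - v_ j t)) k 0).
Proof. by apply/funext => t; rewrite summxE. Qed.

Lemma derr_ebounded i k : ebounded (fun t => de_ i t k 0).
Proof.
rewrite derrE; apply: stable_sum ebounded_ring_stable _ => j ij.
apply: (@stable_mulmx _ _ ebounded n n 1
  (fun t => hess (@psi_vec R n phi Q) (rel_ i j t)) (fun t => v_ i t - v_ j t)).
- exact: ebounded_ring_stable.
- by move=> a b; exact: hess_ebounded.
move=> a b; rewrite ord1.
have -> : (fun t => (v_ i t - v_ j t) a 0) = (fun t => v_ i t a 0 + -1 * v_ j t a 0).
  by apply/funext => t; rewrite !mxE mulN1r.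
by apply: eboundedD (vel_ebounded i a) _; apply: ebounded_scale; exact: vel_ebounded.
Qed.

(** Both the wrench and gravity are bounded in task space and the inertia is
    bounded below. *)
Lemma acc_ebounded i k : ebounded (fun t => acc i t k 0).
Proof.
apply: (@ebounded_entries _ _ (acc i)).
pose b t := tf X i t - (C_ i t *m v_ i t + g_ i t).
have bb : ebounded (fun t => enorm (b t)).
  apply: ebounded_enorm => {}k.
  have -> : (fun t => b t k 0) = (fun t => tf X i t k 0 +
      -1 * ((C_ i t *m v_ i t) k 0 + g_ i t k 0)).
    have entry (x y z : 'cV[R]_n) : (x - (y + z)) k 0 = x k 0 + -1 * (y k 0 + z k 0).
      by rewrite !mxE mulN1r.
    by apply/funext => t; exact: entry.
  apply: eboundedD.
    exists (fbar (S i) k 0); apply: near_gt0 => t /ltW t0.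
    by have [wl _ _] := actuation hloop i t0; exact: wl.
  apply: ebounded_scale; apply: eboundedD.
    apply: (@ebounded_entries _ _ (fun t => C_ i t *m v_ i t)).
    have vb := ebounded_enorm (vel_ebounded i).
    apply: ebounded_le (ebounded_scale (c i) (eboundedM vb vb)) _.
    apply: near_gt0 => t _; rewrite ger0_norm ?enorm_ge0 //.
    have := tcoriolis_bound (hprop i) (tdq X i t) (v_ i t) (X_region i t).
    by rewrite mulrA.
  exists (gamma i k 0); apply: near_gt0 => t _.
  have h := tgravity_bound (hprop i) k (X_region i t); exact: h.
apply: ebounded_le (ebounded_scale (lam1 i)^-1 bb) _.
apply: near_gt0 => t t0; rewrite ger0_norm ?enorm_ge0 // mulrC.
apply: (tinertia_solve_bound (hprop i) (X_region i t)).
by rewrite /b -(task_dynamics i t0) -[X in X - _]addrA addrK.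
Qed.

Lemma der_entry m (y : R -> 'cV[R]_m) dy t k : is_derive t 1 y dy ->
  is_derive t 1 (fun s => y s k 0) (dy k 0).
Proof. by move=> h; exact: ((is_derive_mxP _ _ _ _).1 h k 0). Qed.

Lemma lyapunov_dissipates : exists kh : R -> 'I_N -> R,
  [/\ forall t, 0 < t -> is_derive t 1 lyapunov ('D_1 lyapunov t),
      forall t, 0 < t -> 'D_1 lyapunov t <=
        - \sum_i (alpha^-1 * enorm (v_ i t) ^+ 2
                  + kh t i * (alpha * mu i)^-1 * enorm (s_ i t) ^+ 2)
    & forall t, 0 < t -> forall i, [/\ 0 < kh t i <= kappa i,
         tf X i t = Phi_ i t *m that X i t - kh t i *: s_ i t - mu i *: v_ i t
       & within_limits S i (fhat_ i t) -> kh t i = kappa i]].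
Proof.
have /choice [kh Hkh] : forall t, exists kh : 'I_N -> R, 0 < t -> forall i,
    [/\ 0 < kh i <= kappa i,
         tf X i t = Phi_ i t *m that X i t - kh i *: s_ i t - mu i *: v_ i t
       & within_limits S i (fhat_ i t) -> kh i = kappa i].
  move=> t; have [t0|t0] := ltP 0 t; last first.
    by exists (fun=> 0).
  have /choice [kh Hkh] := fun i => actual_gain i (ltW t0).
  by exists kh => _; exact: Hkh.
exists kh; split=> // t t0.
all: have [|h1 h2] := @der_lyapunov t (kh t) t0 (stays_connected (ltW t0)); last by [].
all: by move=> i; have [] := Hkh t t0 i.
Qed.

Lemma lyapunov_ge0 t : 0 < t -> 0 <= lyapunov t.
Proof.
move=> t0; have ct := stays_connected (ltW t0); rewrite addr_ge0 // mulr_ge0 ?invr_ge0 //.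
  apply: sumr_ge0 => i _; have /andP[a b] := lyapunov_term_ge0 i ct.
  apply: mulr_ge0; first by rewrite invr_ge0 mulr_ge0 // ltW.
  apply: addr_ge0; first exact: le_trans a b.
  by rewrite mulr_ge0 ?sqr_ge0 // invr_ge0 ltW.
by apply: sumr_ge0 => i _; apply: sumr_ge0 => j ij; exact: psi_ge0.
Qed.

(** The damping makes [lyapunov] pay for the velocity, whose variations are
    limited by [acc_ebounded]. *)
Lemma vel_vanishing i k : vanishing (fun t => v_ i t k 0).
Proof.
have [kh [hV dV Hkh]] := lyapunov_dissipates.
apply: (@barbalat _ lyapunov (fun t => 'D_1 lyapunov t) _ alpha^-1 0).
- by rewrite invr_gt0; exact: halpha.
- exact: lyapunov_ge0.
- apply: near_gt0 => t t0; apply: le_trans (dV t t0) _; rewrite lerN2.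
  have pos j : 0 <= alpha^-1 * enorm (v_ j t) ^+ 2
                  + kh t j * (alpha * mu j)^-1 * enorm (s_ j t) ^+ 2.
    have [/andP[k0 _] _ _] := Hkh t t0 j.
    apply: addr_ge0; apply: mulr_ge0; rewrite ?sqr_ge0 //; first by rewrite invr_ge0 ltW.
    by rewrite mulr_ge0 ?(ltW k0) // invr_ge0 mulr_ge0 // ltW.
  rewrite (bigD1 i) //=; apply: ler_wpDr; first by apply: sumr_ge0 => j _; exact: pos.
  apply: ler_wpDr.
    have [/andP[k0 _] _ _] := Hkh t t0 i.
    by rewrite mulr_ge0 ?sqr_ge0 // mulr_ge0 ?(ltW k0) // invr_ge0 mulr_ge0 // ltW.
  rewrite ler_pM2l ?invr_gt0 // -(real_normK (num_real (v_ i t k 0))).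
  by rewrite ler_sqr ?nnegrE ?enorm_ge0 // entry_le_enorm.
apply: (@auc_lipschitz _ _ (fun t => acc i t k 0)); last exact: acc_ebounded.
by move=> t t0; apply: (@der_entry _ (v_ i)); exact: der_vel.
Qed.

Lemma derr_vanishing i k : vanishing (fun t => de_ i t k 0).
Proof.
rewrite derrE; apply: vanishing_sum => j ij.
apply: (@vanishing_mulmx _ n n 1
  (fun t => hess (@psi_vec R n phi Q) (rel_ i j t)) (fun t => v_ i t - v_ j t)).
  by move=> a b; exact: hess_ebounded.
move=> a b; rewrite ord1.
have -> : (fun t => (v_ i t - v_ j t) a 0) = (fun t => v_ i t a 0 + -1 * v_ j t a 0).
  by apply/funext => t; rewrite !mxE mulN1r.
by apply: vanishingD (vel_vanishing i a) _; apply: vanishing_scale; exact: vel_vanishing.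
Qed.

Lemma jac_unit i t : J (S i) (tq X i t) \in unitmx.
Proof. by have h := region_nonsingular (hprop i) (X_region i t); exact: h. Qed.

Lemma invjac_ebounded i k l : ebounded (fun t => invmx (J (S i) (tq X i t)) k l).
Proof.
have [B HB] := invjac_bounded (hprop i); exists B; apply: near_gt0 => t _.
exact: HB (X_region i t) k l.
Qed.

Lemma dq_vanishing i k : vanishing (fun t => tdq X i t k 0).
Proof.
have -> : (fun t => tdq X i t k 0) =
    (fun t => (invmx (J (S i) (tq X i t)) *m v_ i t) k 0).
  by apply/funext => t; rewrite /vel mulKmx // jac_unit.
apply: (@vanishing_mulmx _ n n 1 (fun t => invmx (J (S i) (tq X i t))) (v_ i)).
  by move=> a b; exact: invjac_ebounded.
by move=> a b; rewrite ord1; exact: vel_vanishing.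
Qed.

Lemma q_auc i k : auc (fun t => tq X i t k 0).
Proof.
apply: (@auc_lipschitz _ _ (fun t => tdq X i t k 0)).
  by move=> t t0; apply: (@der_entry _ (tq X i)); exact: (q_deriv hloop).
exact: vanishing_ebounded (dq_vanishing i k).
Qed.

Lemma Jdot_vanishing i k l :
  vanishing (fun t => Jdot (S i) (tq X i t) (tdq X i t) k l).
Proof.
have -> : (fun t => Jdot (S i) (tq X i t) (tdq X i t) k l) = (fun t =>
    \sum_m tdq X i t m 0 * Jdot (S i) (tq X i t) (delta_mx m 0) k l).
  by apply/funext => t; exact: (Jdot_expand (hmodel i)).
apply: vanishing_sum => m _; apply: vanishingM (dq_vanishing i m) _.
have [] // : tame (fun t => Jdot (S i) (tq X i t) (delta_mx m 0) k l).
apply: (@tame_periodic1 _ n (fun q => Jdot (S i) q (delta_mx m 0) k l)); last exact: q_auc.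
  exact: (Jdot_continuous (hmodel i)).
by apply: periodic2pi_entry; exact: (Jdot_periodic (hmodel i)).
Qed.

Lemma invjac_tame i k l : tame (fun t => invmx (J (S i) (tq X i t)) k l).
Proof.
split; first exact: invjac_ebounded.
pose D t : 'M[R]_n := invmx (J (S i) (tq X i t)) *m
  Jdot (S i) (tq X i t) (tdq X i t) *m invmx (J (S i) (tq X i t)).
apply: (@auc_lipschitz _ _ (fun t => -1 * D t k l)).
  move=> t t0; have hJ := der_jac_curve (hmodel i) (q_deriv hloop i t0).
  have h := (is_derive_mxP _ _ _ _).1 (der_invmx hJ (jac_unit i t)) k l.
  by apply: is_derive_eq h _; rewrite mxE mulN1r.
apply: ebounded_scale.
apply: (@stable_mulmx _ _ ebounded n n n (fun t => invmx (J (S i) (tq X i t)) *m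
  Jdot (S i) (tq X i t) (tdq X i t)) (fun t => invmx (J (S i) (tq X i t)))).
- exact: ebounded_ring_stable.
- apply: (@stable_mulmx _ _ ebounded n n n (fun t => invmx (J (S i) (tq X i t)))
    (fun t => Jdot (S i) (tq X i t) (tdq X i t))).
  + exact: ebounded_ring_stable.
  + exact: invjac_ebounded.
  + by move=> a b; exact: vanishing_ebounded (Jdot_vanishing i a b).
- exact: invjac_ebounded.
Qed.

Lemma mtame_invjac i : mtame (fun t => invmx (J (S i) (tq X i t))).
Proof. exact: invjac_tame. Qed.

Lemma mtame_inertia i (th : 'cV[R]_(npar (S i))) : mtame (fun t => inertia th (tq X i t)).
Proof.
move=> k l; apply: (@tame_periodic1 _ n (fun q => inertia th q k l)); last exact: q_auc.
  have [dM _] := inertia_C1 (hmodel i) th.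
  move=> q; apply: (continuous_mxP _ _).1; exact: differentiable_continuous (dM q).
by apply: periodic2pi_entry; exact: (inertia_periodic (hmodel i)).
Qed.

Lemma mtame_coriolis i (th : 'cV[R]_(npar (S i))) :
  mtame (fun t => coriolis th (tq X i t) (tdq X i t)).
Proof.
move=> k l.
apply: (@tame_periodic _ n n (fun z => coriolis th z.1 z.2 k l)).
- move=> z; have h : {for z, continuous (fun z => coriolis th z.1 z.2)}.
    exact: (coriolis_C0 (hmodel i)).
  exact: ((continuous_mxP _ _).1 h k l).
- move=> w; apply: (@periodic2pi_entry _ _ _ _ (fun q => coriolis th q w)).
  exact: (coriolis_periodic (hmodel i)).
- exact: q_auc.
- by move=> a; apply: tame_vanishing; exact: dq_vanishing.
Qed.

Lemma mtame_gravity i (th : 'cV[R]_(npar (S i))) : mtame (fun t => gravity th (tq X i t)).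
Proof.
move=> k l; apply: (@tame_periodic1 _ n (fun q => gravity th q k l)); last exact: q_auc.
  by move=> q; apply: (continuous_mxP _ _).1; exact: (gravity_C0 (hmodel i)).
by apply: periodic2pi_entry; exact: (gravity_periodic (hmodel i)).
Qed.

Lemma mtame_Jdot i : mtame (fun t => Jdot (S i) (tq X i t) (tdq X i t)).
Proof. by move=> k l; apply: tame_vanishing; exact: Jdot_vanishing. Qed.

Lemma mtame_tinertia i (th : 'cV[R]_(npar (S i))) : mtame (fun t => tinertia th (tq X i t)).
Proof.
have hI := mtame_invjac i.
exact: (mtame_mul (mtame_mul (mtame_tr hI) (mtame_inertia th)) hI).
Qed.

Lemma mtame_tcoriolis i (th : 'cV[R]_(npar (S i))) :
  mtame (fun t => tcoriolis th (tq X i t) (tdq X i t)).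
Proof.
have hI := mtame_invjac i; apply: mtame_sub.
  exact: (mtame_mul (mtame_mul (mtame_tr hI) (mtame_coriolis th)) hI).
exact: (mtame_mul (mtame_mul (mtame_tinertia th) (mtame_Jdot i)) hI).
Qed.

Lemma mtame_tgravity i (th : 'cV[R]_(npar (S i))) : mtame (fun t => tgravity th (tq X i t)).
Proof. exact: (mtame_mul (mtame_tr (mtame_invjac i)) (mtame_gravity th)). Qed.

Lemma mtame_derr i : mtame (de_ i).
Proof. by move=> k l; rewrite ord1; apply: tame_vanishing; exact: derr_vanishing. Qed.

Lemma mtame_err i : mtame (e_ i).
Proof.
move=> k l; rewrite ord1; split; first exact: err_ebounded.
apply: (@auc_lipschitz _ _ (fun t => de_ i t k 0)); last exact: derr_ebounded.
move=> t t0; apply: (@der_entry _ (e_ i)); apply: der_err => //.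
exact: stays_connected (ltW t0).
Qed.

Lemma mtame_vel i : mtame (v_ i).
Proof. by move=> k l; rewrite ord1; apply: tame_vanishing; exact: vel_vanishing. Qed.

Lemma mtame_slide i : mtame (s_ i).
Proof. exact: (mtame_add (mtame_vel i) (mtame_scale alpha (mtame_err i))). Qed.

(** By the linear parameterization at the basis parameter vectors, the columns
    of the regressor are built from the continuous periodic terms of the model. *)
Lemma mtame_Phi i : mtame (Phi_ i).
Proof.
move=> k m; pose th : 'cV[R]_(npar (S i)) := delta_mx m 0.
have -> : (fun t => Phi_ i t k m) = (fun t =>
    (tinertia th (tq X i t) *m (- (alpha *: de_ i t))
     + tcoriolis th (tq X i t) (tdq X i t) *m (- (alpha *: e_ i t))
     + tgravity th (tq X i t)) k 0).
  apply/funext => t; rewrite (linear_param (hprop i) _ _ _ _ (X_region i t)).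
  rewrite -/(Phi_ i t) [RHS]mxE (bigD1 m) //= big1 ?addr0 => [|a am].
    by rewrite mxE !eqxx mulr1.
  by rewrite mxE (negbTE am) mulr0.
have h1 := mtame_mul (mtame_tinertia th) (mtame_opp (mtame_scale alpha (mtame_derr i))).
have h2 := mtame_mul (mtame_tcoriolis th) (mtame_opp (mtame_scale alpha (mtame_err i))).
exact: (mtame_add (mtame_add h1 h2) (mtame_tgravity th)).
Qed.

Lemma mtame_that i : mtame (that X i).
Proof.
move=> k l; rewrite ord1; split.
  have -> : (fun t => that X i t k 0) = (fun t => tilde i t k 0 + cst (theta (S i) k 0) t).
    by apply/funext => t; rewrite /tilde !mxE /= subrK.
  have h := eboundedD (tilde_ebounded k) (ebounded_cst (theta (S i) k 0)); exact: h.
pose P t := Defs.proj (theta_lb (S i)) (theta_ub (S i)) delta (that X i t) (omega_ i t).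
apply: (@auc_lipschitz _ _ (fun t => P t k 0)).
  by move=> t t0; apply: (@der_entry _ (that X i)); exact: (adaptation hloop).
have ob : ebounded (fun t => omega_ i t k 0).
  have h := mtame_opp (mtame_scale (beta i)
    (mtame_mul (mtame_tr (@mtame_Phi i)) (mtame_slide i))).
  by have [] := h k 0.
apply: ebounded_le (ebounded_abs ob) _; apply: near_gt0 => t _.
by rewrite mxE; exact: proj1_norm.
Qed.

Lemma mtame_fhat i : mtame (fhat_ i).
Proof.
exact: (mtame_sub (mtame_sub (mtame_mul (@mtame_Phi i) (@mtame_that i))
  (mtame_scale (kappa i) (mtame_slide i))) (mtame_scale (mu i) (mtame_vel i))).
Qed.

(** * Saturation ends and the positions agree *)

Lemma der_momentum i t : 0 < t -> is_derive t 1 (fun s => M_ i s *m v_ i s)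
  ((C_ i t)^T *m v_ i t + (tf X i t - g_ i t)).
Proof.
move=> t0.
have hM := der_tinertia_split (hmodel i) (hprop i) (X_region i t) (q_deriv hloop i t0).
apply: is_derive_eq (der_mulmx hM (der_vel i t0)) _.
by rewrite mulmxDl -(task_dynamics i t0) addrK -addrA addrCA [X in _ + X]addrC.
Qed.

Lemma momentum_vanishing i k : vanishing (fun t => (M_ i t *m v_ i t) k 0).
Proof.
apply: (@vanishing_mulmx _ n n 1 (fun t => M_ i t) (v_ i)).
  by move=> a b; have [] := mtame_tinertia (theta (S i)) a b.
by move=> a b; rewrite ord1; exact: vel_vanishing.
Qed.

Lemma coriolis_force_vanishing i k : vanishing (fun t => ((C_ i t)^T *m v_ i t) k 0).
Proof.
apply: (@vanishing_mulmx _ n n 1 (fun t => (C_ i t)^T) (v_ i)).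
  by move=> a b; have [] := mtame_tr (mtame_tcoriolis (theta (S i))) a b.
by move=> a b; rewrite ord1; exact: vel_vanishing.
Qed.

Hypothesis hslack : forall i k, gamma i k 0 + kappa i * slide_bound i < fbar (S i) k 0.

(** Saturation cannot last.  The applied wrench differs from the computed one
    by at most [kappa i * slide_bound i], so that a computed wrench close to the
    limit would dominate gravity by a fixed margin and build up momentum, which
    vanishes. *)
Lemma eventually_within_limits i :
  \forall t \near +oo, within_limits S i (fhat_ i t).
Proof.
have [kh [_ _ Hkh]] := lyapunov_dissipates.
apply: (@filter_forall _ _
  (fun k t => `|fhat_ i t k 0| <= fbar (S i) k 0) (pinfty_nbhs R)) => k.
pose b := slide_bound i.
pose eta := (fbar (S i) k 0 - gamma i k 0 - kappa i * b) / 3.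
have eta0 : 0 < eta by rewrite divr_gt0 //; have := hslack i k; rewrite -/b; lra.
have fE t : 0 < t -> exists2 d, 0 <= d <= kappa i &
    tf X i t k 0 = fhat_ i t k 0 + d * s_ i t k 0.
  move=> t0; have [/andP[k0 k1] -> _] := Hkh t t0 i.
  exists (kappa i - kh t i); first by lra.
  by rewrite /fhat !mxE; ring.
have sb t : 0 < t -> `|s_ i t k 0| <= b.
  by move=> t0; apply: le_trans (entry_le_enorm _ _) (slide_le i (ltW t0)).
have gb t : `|g_ i t k 0| <= gamma i k 0.
  have h := tgravity_bound (hprop i) k (X_region i t); exact: h.
have Cv : \forall t \near +oo, `|((C_ i t)^T *m v_ i t) k 0| <= eta.
  by apply: (vanishingP _).1 (coriolis_force_vanishing i k) _ eta0.
have [_ Fauc] := @mtame_fhat i k 0.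
have fdiff t : 0 < t -> `|tf X i t k 0 - fhat_ i t k 0| <= kappa i * b.
  move=> t0; have [d /andP[d0 d1] ->] := fE t t0.
  rewrite addrAC subrr add0r normrM ger0_norm //.
  by apply: ler_pM => //; exact: sb.
have dp t : 0 < t -> is_derive t 1 (fun s => (M_ i s *m v_ i s) k 0)
    (((C_ i t)^T *m v_ i t) k 0 + (tf X i t k 0 - g_ i t k 0)).
  move=> t0; have h := (is_derive_mxP _ _ _ _).1 (der_momentum i t0) k 0.
  apply: is_derive_eq h _.
  have entry (x y z : 'cV[R]_n) : (x + (y - z)) k 0 = x k 0 + (y k 0 - z k 0).
    by rewrite !mxE.
  exact: entry.
have etaE : 3 * eta = fbar (S i) k 0 - gamma i k 0 - kappa i * b.
  by rewrite /eta mulrC divfK // pnatr_eq0.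
have upper : \forall t \near +oo, fhat_ i t k 0 <= fbar (S i) k 0.
  apply: (eventually_le_of_vanishing dp (momentum_vanishing i k) Fauc eta0).
  near=> t => F; have t0 : 0 < t by near: t; exact: nbhs_pinfty_gt.
  have C1 : `|((C_ i t)^T *m v_ i t) k 0| <= eta by near: t.
  have := fdiff t t0; have := gb t; move: C1; rewrite !ler_norml.
  by move=> /andP[? ?] /andP[? ?] /andP[? ?]; lra.
have lower : \forall t \near +oo, - fhat_ i t k 0 <= fbar (S i) k 0.
  have dp' t : 0 < t -> is_derive t 1 (fun s => - (M_ i s *m v_ i s) k 0)
      (- (((C_ i t)^T *m v_ i t) k 0 + (tf X i t k 0 - g_ i t k 0))).
    by move=> t0; exact: der_opp (dp t t0).
  have pv := vanishingN (momentum_vanishing i k).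
  have Fauc' : auc (fun t => - fhat_ i t k 0).
    have [_] := @mtame_opp _ _ _ _ (@mtame_fhat i) k 0.
    by congr auc; apply/funext => t; rewrite [LHS]mxE.
  apply: (eventually_le_of_vanishing dp' pv Fauc' eta0).
  near=> t => F; have t0 : 0 < t by near: t; exact: nbhs_pinfty_gt.
  have C1 : `|((C_ i t)^T *m v_ i t) k 0| <= eta by near: t.
  have := fdiff t t0; have := gb t; move: C1; rewrite !ler_norml.
  by move=> /andP[? ?] /andP[? ?] /andP[? ?]; lra.
near=> t; rewrite ler_norml; apply/andP; split; last by near: t.
by rewrite lerNl; near: t.
Unshelve. all: by end_near. Qed.

(** Without saturation the gain of the sliding variable is [kappa i], and the
    argument for the velocities applies to it. *)
Lemma slide_vanishing i k : vanishing (fun t => s_ i t k 0).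
Proof.
have [kh [hV dV Hkh]] := lyapunov_dissipates.
pose kc := kappa i * (alpha * mu i)^-1.
have am0 : 0 < (alpha * mu i)^-1 by rewrite invr_gt0 mulr_gt0.
have [_ sauc] := @mtame_slide i k 0.
apply: (@barbalat _ lyapunov (fun t => 'D_1 lyapunov t) _ kc 0) => //.
- by rewrite mulr_gt0.
- exact: lyapunov_ge0.
near=> t; have t0 : 0 < t by near: t; exact: nbhs_pinfty_gt.
have wl : within_limits S i (fhat_ i t) by near: t; exact: eventually_within_limits.
apply: le_trans (dV t t0) _; rewrite lerN2.
have pos j : 0 <= alpha^-1 * enorm (v_ j t) ^+ 2 /\
    0 <= kh t j * (alpha * mu j)^-1 * enorm (s_ j t) ^+ 2.
  have [/andP[k0 _] _ _] := Hkh t t0 j; split.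
    by rewrite mulr_ge0 ?sqr_ge0 // invr_ge0 ltW.
  by rewrite mulr_ge0 ?sqr_ge0 // mulr_ge0 ?(ltW k0) // invr_ge0 mulr_ge0 // ltW.
rewrite (bigD1 i) //=; apply: ler_wpDr.
  by apply: sumr_ge0 => j _; have [? ?] := pos j; exact: addr_ge0.
apply: ler_wpDl; first by have [] := pos i.
have [_ _ ->] := Hkh t t0 i; last exact: wl.
rewrite ler_pM2l ?mulr_gt0 // -(real_normK (num_real (s_ i t k 0))).
by rewrite ler_sqr ?nnegrE ?enorm_ge0 // entry_le_enorm.
Unshelve. all: by end_near. Qed.

Lemma err_vanishing i k : vanishing (fun t => e_ i t k 0).
Proof.
have -> : (fun t => e_ i t k 0) = (fun t => alpha^-1 * (s_ i t k 0 + -1 * v_ i t k 0)).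
  apply/funext => t; rewrite /slide.
  have entry (x y : 'cV[R]_n) : y k 0 = alpha^-1 * ((x + alpha *: y) k 0 + -1 * x k 0).
    by rewrite !mxE; field; rewrite gt_eqF.
  exact: entry.
apply: vanishing_scale; apply: vanishingD (slide_vanishing i k) _.
by apply: vanishing_scale; exact: vel_vanishing.
Qed.

Hypothesis E0_connected : forall i j, connect E0 i j.

Lemma connected_ind (P : 'I_N -> 'I_N -> Prop) : (forall i, P i i) ->
  (forall i j k, P i j -> E0 j k -> P i k) -> forall i j, P i j.
Proof.
move=> P0 PE i j; have /connectP [p] := E0_connected i j.
elim/last_ind: p j => [|p k IH] j /=; first by move=> _ ->.
rewrite rcons_path last_rcons => /andP[ip pk] ->.
by apply: PE pk; exact: IH.
Qed.

Lemma relpos_trans i j k t : rel_ i k t = rel_ i j t + rel_ j k t.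
Proof. by rewrite /relpos addrA subrK. Qed.

Lemma relpos_refl i t : rel_ i i t = 0.
Proof. by rewrite /relpos subrr. Qed.

Lemma relpos_ebounded i j : ebounded (fun t => enorm (rel_ i j t)).
Proof.
move: i j; apply: connected_ind => [i|i j k Pij Ejk].
  by exists 0; near=> t; rewrite relpos_refl enorm0 normr0.
have rb : ebounded (cst r) by exact: ebounded_cst.
apply: ebounded_le (eboundedD Pij rb) _; apply: near_gt0 => t /ltW t0.
rewrite ger0_norm ?enorm_ge0 // (relpos_trans i j k).
by apply: le_trans (ler_enormD _ _) _; rewrite lerD2l ltW //; exact: stays_connected.
Unshelve. all: by end_near. Qed.

(** As the forces [pull] are opposite along each link, the work of the errors
    [err] along the displacements to a common reference system is the sum over
    the links of the work of the attraction. *)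
Lemma attraction_vanishing i j : E0 i j ->
  vanishing (fun t => phi1 (enorm (rel_ i j t) ^+ 2) * enorm (rel_ i j t) ^+ 2).
Proof.
move=> Eij; pose T t := \sum_k enorm (e_ k t) * enorm (rel_ k i t).
have Tv : vanishing T.
  apply: vanishing_sum => k _.
  exact: vanishingM (vanishing_enorm (err_vanishing k)) (relpos_ebounded k i).
apply: (vanishing_squeeze Tv); apply: near_gt0 => t /ltW t0.
have ct := stays_connected t0.
have pos k l : E0 k l -> 0 <= phi1 (enorm (rel_ k l t) ^+ 2) * enorm (rel_ k l t) ^+ 2.
  move=> kl; have /andP[p0 _] := slope_bounds hpot hQ (ltW (ct k l kl)).
  by rewrite mulr_ge0 ?sqr_ge0.
rewrite ger0_norm ?pos //.
have work : \sum_k \sum_(l in nbrs E0 k)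
    phi1 (enorm (rel_ k l t) ^+ 2) * enorm (rel_ k l t) ^+ 2 =
    \sum_k dot (e_ k t) (rel_ k i t).
  under [RHS]eq_bigr => k _ do rewrite (errE k ct).
  rewrite -(pull_power t (fun k => rel_ k i t)) mulr_sumr; apply: eq_bigr => k _.
  rewrite mulr_sumr; apply: eq_bigr => l _.
  have -> : rel_ k i t - rel_ l i t = rel_ k l t.
    by rewrite (relpos_trans k l i) addrK.
  by rewrite /pull dotZl dotvv !mulrA mulVf ?mul1r // pnatr_eq0.
apply: (@le_trans _ _ (\sum_k dot (e_ k t) (rel_ k i t))); last first.
  by apply: ler_sum => k _; exact: le_trans (ler_norm _) (cauchy_schwarz _ _).
have ji : j \in nbrs E0 i by rewrite inE Esym.
have pos' k l : l \in nbrs E0 k ->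
    0 <= phi1 (enorm (rel_ k l t) ^+ 2) * enorm (rel_ k l t) ^+ 2.
  by rewrite inE Esym => kl; exact: pos.
rewrite -work (bigD1 i) //= (bigD1 j) //= -addrA lerDl addr_ge0 //.
  by apply: sumr_ge0 => l /andP[il _]; exact: pos'.
by apply: sumr_ge0 => k _; apply: sumr_ge0 => l kl; exact: pos'.
Qed.

(** The attraction increases with the distance, so it can vanish only together
    with it. *)
Lemma link_vanishing i j : (0 < n)%N -> E0 i j -> vanishing (fun t => enorm (rel_ i j t)).
Proof.
move=> n0 Eij; apply/vanishingP => eps eps0.
have [epsr|reps] := ltP eps r; last first.
  apply: near_gt0 => t /ltW t0; rewrite ger0_norm ?enorm_ge0 //.
  by apply: ltW; apply: lt_le_trans reps; exact: stays_connected.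
have h0 : 0 < eps * phi1 (eps ^+ 2).
  rewrite -[ltLHS](mul0r (phi1 (0 ^+ 2))).
  exact: (attraction_incr hpot hr hQ n0).
have m0 : 0 < eps * (eps * phi1 (eps ^+ 2)) / 2 by rewrite divr_gt0 // mulr_gt0.
have hv := (vanishingP _).1 (attraction_vanishing Eij) _ m0.
near=> t; have t0 : 0 <= t by near: t; apply: nbhs_pinfty_ge; exact: num_real.
have rij := stays_connected t0 Eij.
rewrite ger0_norm ?enorm_ge0 // leNgt; apply/negP => far.
have /andP[_ h] := attraction_lower_bound hpot hr hQ n0 eps0 (ltW far) rij.
have : `|phi1 (enorm (rel_ i j t) ^+ 2) * enorm (rel_ i j t) ^+ 2|
    <= eps * (eps * phi1 (eps ^+ 2)) / 2 by near: t.
move/(le_trans (ler_norm _)).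
have : eps * (eps * phi1 (eps ^+ 2)) <=
    phi1 (enorm (rel_ i j t) ^+ 2) * enorm (rel_ i j t) ^+ 2.
  rewrite expr2 [leRHS]mulrC -mulrA; apply: ler_pM => //; try exact: ltW.
move=> a b; have := le_trans a b.
move: (eps * _) m0 => m m0'; lra.
Unshelve. all: by end_near. Qed.

Lemma relpos_vanishing i j : (0 < n)%N -> vanishing (fun t => enorm (rel_ i j t)).
Proof.
move=> n0; move: i j; apply: connected_ind => [i|i j k Pij Ejk].
  rewrite (_ : (fun t => _) = cst 0); first exact: vanishing0.
  by apply/funext => t; rewrite relpos_refl enorm0.
apply: (vanishing_squeeze (vanishingD Pij (link_vanishing n0 Ejk))).
near=> t; rewrite ger0_norm ?enorm_ge0 // (relpos_trans i j k).
exact: ler_enormD.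
Unshelve. all: by end_near. Qed.

End ClosedLoop.

(** * Motions defined from time 0 on *)

Section Clamp.
Context {R : realType}.

Lemma clamp_continuous (T : topologicalType) (f : R -> T) :
  {within `[0, +oo[%classic, continuous f} -> continuous (fun t : R => f (Num.max 0 t)).
Proof.
move=> /subspace_continuousP cf t.
have t0 : `[0, +oo[%classic (Num.max 0 t) by rewrite /= in_itv /= andbT le_max lexx.
have cm : {for t, continuous (fun s : R => Num.max 0 s)}.
  by apply: continuous_max; [exact: cvg_cst|exact: cvg_id].
move=> A /(cf _ t0) fA; have := cm _ fA; rewrite !nbhs_filterE /=.
by apply: filterS => s; apply; rewrite /= in_itv /= andbT le_max lexx.
Qed.

Lemma clamp_derive (V : normedModType R) (f : R -> V) (df : V) (t : R) : 0 < t ->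
  is_derive t 1 f df -> is_derive t 1 (fun s : R => f (Num.max 0 s)) df.
Proof.
move=> t0; apply: near_eq_is_derive.
have : \forall s \near t, 0 < s by apply: open_nbhs_nbhs; split => //; exact: open_gt.
by apply: filterS => s s0; rewrite max_r // ltW.
Qed.

(** Freezing the motion before time 0 turns the one-sided continuity at 0 into
    continuity on the whole line. *)
Definition clamp (n N : nat) (S : 'I_N -> el_system R n) (X : trajectory S) :=
  @Trajectory R n N S
    (fun i t => tq X i (Num.max 0 t)) (fun i t => tdq X i (Num.max 0 t))
    (fun i t => tddq X i (Num.max 0 t)) (fun i t => that X i (Num.max 0 t))
    (fun i t => tf X i (Num.max 0 t)).

Lemma clamp_closed_loop (n N : nat) (S : 'I_N -> el_system R n) E0 phi (Q alpha : R)
    mu kappa beta delta (X : trajectory S) :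
  closed_loop E0 phi Q alpha mu kappa beta delta X ->
  closed_loop E0 phi Q alpha mu kappa beta delta (clamp X).
Proof.
move=> h.
have ge0 (t : R) : 0 <= Num.max 0 t by rewrite le_max lexx.
have gt0 (t : R) : 0 < t -> 0 < Num.max 0 t by rewrite lt_max orbC => ->.
have maxE (t : R) : 0 < t -> Num.max 0 t = t by move=> t0; rewrite max_r // ltW.
split.
- by move=> i t _; exact: (in_region h i (ge0 t)).
- by move=> i; apply: continuous_subspaceT; apply: clamp_continuous; exact: (q_cont h).
- by move=> i; apply: continuous_subspaceT; apply: clamp_continuous; exact: (dq_cont h).
- by move=> i; apply: continuous_subspaceT; apply: clamp_continuous; exact: (that_cont h).
- by move=> i t t0; apply: clamp_derive => //=; rewrite maxE //; exact: (q_deriv h i t0).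
- by move=> i t t0; apply: clamp_derive => //=; rewrite maxE //; exact: (dq_deriv h i t0).
- by move=> i t t0; exact: (dynamics h i (gt0 t t0)).
- by move=> i t t0; exact: (actuation h i (ge0 t)).
- move=> i t t0; apply: clamp_derive => //.
  by have := adaptation h i (gt0 t t0); rewrite {1}maxE.
- by move=> i; rewrite /= maxxx; exact: (that_init h i).
Qed.

End Clamp.

Theorem theorem2 (R : realType) (n N : nat) (S : 'I_N -> el_system R n)
  (* constants of the standing properties and of A.1 *)
  (lam1 lam2 c : 'I_N -> R) (gamma : 'I_N -> 'cV[R]_n)
  (hmodel : forall i, revolute_model (S i))
  (hprop : forall i,
     el_properties (S i) (lam1 i) (lam2 i) (c i) (gamma i))
  (* potential *)
  (r : R) (hr : 0 < r)
  (phi : R -> R -> R) (sigma nu : R -> R)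
  (hpot : potential n r phi sigma nu)
  (* gains *)
  (Q alpha : R) (mu kappa beta : 'I_N -> R)
  (hQ : 0 < Q) (halpha : 0 < alpha) (hmu : forall i, 0 < mu i)
  (hkappa : forall i, 0 < kappa i) (hbeta : forall i, 0 < beta i)
  (* projection band; the true parameters lie outside it *)
  (delta : R) (hdelta : 0 < delta)
  (hdelta_box : forall i k,
     delta < (theta_ub (S i) k 0 - theta_lb (S i) k 0) / 2)
  (hguard : forall i k,
     theta_lb (S i) k 0 + delta <= theta (S i) k 0
       <= theta_ub (S i) k 0 - delta)
  (* communication graph and closed-loop trajectory *)
  (E : R -> rel 'I_N) (X : trajectory S)
  (hsym : forall t, 0 <= t -> symmetric (E t))
  (hirr : forall t, 0 <= t -> irreflexive (E t))
  (hA2 : forall i j, ~~ E 0 j i -> forall t, 0 <= t -> ~~ E t j i)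
  (hA3 : forall i j t, 0 <= t -> E t i j -> enorm (relpos X i j t) < r)
  (hA4c : forall i j, connect (E 0) i j)
  (hA4d : exists2 eps, 0 < eps < r &
     forall i j, E 0 i j -> enorm (relpos X i j 0) <= r - eps)
  (hloop : closed_loop (E 0) phi Q alpha mu kappa beta delta X)
  (* condition (a) *)
  (ha : forall i k,
     let d := #|nbrs (E 0) i|%:R in
     let b := Num.sqrt (2 * alpha * mu i * psi phi Q r / lam1 i) in
     ((2 * nu Q * lam2 i + c i * r * sigma Q) * alpha * d + mu i)
       * (b + alpha * sigma Q * r * d)
     + gamma i k 0 + kappa i * b < fbar (S i) k 0)
  (* condition (b) *)
  (lam20 : 'I_N -> R)
  (hlam20 : forall i,
     max_eigenvalue (tinertia (theta (S i)) (tq X i 0)) (lam20 i))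
  (hb : 2^-1 * (\sum_i (alpha * mu i)^-1
          * (lam20 i * enorm (slide (E 0) phi Q alpha X i 0) ^+ 2
             + (beta i)^-1 * enorm (theta_ub (S i) - theta_lb (S i)) ^+ 2))
        + 2^-1 * (\sum_i \sum_(j in nbrs (E 0) i)
                    psi phi Q (enorm (relpos X i j 0)))
        < psi phi Q r) :
  (forall i j, E 0 i j -> forall t, 0 <= t -> enorm (relpos X i j t) < r) /\
  (forall i j, relpos X i j t @[t --> +oo] --> (0 : 'cV[R]_n)).

Proof.
have [n0|n0] := posnP n.
  subst n; split=> [i j _ t _|i j].
    by rewrite (flatmx0 (relpos X i j t)) enorm0.
  rewrite (_ : (fun t => _) = cst 0); first exact: cvg_cst.
  by apply/funext => t; rewrite (flatmx0 (relpos X i j t)).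
have [eps /andP[eps0 epsr] hA4] := hA4d.
have Esym := hsym 0 (lexx 0); have Eirr := hirr 0 (lexx 0).
have hloop' := clamp_closed_loop hloop.
have cq i : continuous (tq (clamp X) i).
  by apply: clamp_continuous; exact: (q_cont hloop).
have cdq i : continuous (tdq (clamp X) i).
  by apply: clamp_continuous; exact: (dq_cont hloop).
have cth i : continuous (that (clamp X) i).
  by apply: clamp_continuous; exact: (that_cont hloop).
have reg i t : region (S i) (tq (clamp X) i t).
  by apply: (in_region hloop); rewrite le_max lexx.
have relE i j t : 0 <= t -> relpos (clamp X) i j t = relpos X i j t.
  by move=> t0; rewrite -[in RHS](max_r t0).
have conn0 : connected_at r (E 0) (clamp X) 0.
  by move=> i j Eij; rewrite relE //; apply: le_lt_trans (hA4 i j Eij) _; lra.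
have V0 : lyapunov phi Q alpha mu beta (E 0) (clamp X) 0 < psi phi Q r.
  have hlam i : max_eigenvalue (tinertia (theta (S i)) (tq (clamp X) i 0)) (lam20 i).
    by rewrite /= maxxx.
  apply: le_lt_trans (lyapunov_initial hprop halpha hmu hbeta hloop' hlam) _.
  pose bound (t : R) := 2^-1 * (\sum_i (alpha * mu i)^-1
      * (lam20 i * enorm (slide (E 0) phi Q alpha X i t) ^+ 2
         + (beta i)^-1 * enorm (theta_ub (S i) - theta_lb (S i)) ^+ 2))
    + 2^-1 * (\sum_i \sum_(j in nbrs (E 0) i) psi phi Q (enorm (relpos X i j t))).
  have : bound (Num.max 0 0) < psi phi Q r by rewrite maxxx.
  exact.
split.
  move=> i j Eij t t0; rewrite -relE //.
  exact: (stays_connected hmodel hprop hr hpot hQ halpha hmu hkappa hbeta hdelta hguard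
    Esym Eirr hloop' cq cdq cth reg conn0 V0 t0 Eij).
have slack i k : gamma i k 0 + kappa i * slide_bound lam1 r phi Q alpha mu i < fbar (S i) k 0.
  have := ha i k; apply: le_lt_trans.
  rewrite -/(slide_bound lam1 r phi Q alpha mu i) -addrA lerDr.
  have sig0 := sigma_gt0 hr hpot hQ.
  have nu0 : 0 <= nu Q.
    have z : enorm (0 : 'cV[R]_n) <= r by rewrite enorm0 ltW.
    have [pd le_nu] := pot_hess hpot hQ z.
    pose y : 'cV[R]_n := delta_mx (Ordinal n0) 0.
    have y1 : enorm y ^+ 2 = 1 by rewrite -dotvv dot_delta mxE !eqxx.
    have y0 : y != 0.
      apply/eqP => y0; move: y1; rewrite y0 enorm0 expr0n /= => /eqP.
      by rewrite eq_sym oner_eq0.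
    by have := lt_le_trans (pd y y0) (loewner_ub y le_nu); rewrite y1 mulr1 => /ltW.
  have l2 := lam2_gt0 (hprop i); have c0 := c_gt0 (hprop i).
  have d0 : 0 <= #|nbrs (E 0) i|%:R :> R by [].
  have m0 := ltW (hmu i); have a0 := ltW halpha; have r0 := ltW hr.
  apply: mulr_ge0; apply: addr_ge0 => //; last by rewrite !mulr_ge0 // ltW.
    apply: mulr_ge0 => //; apply: mulr_ge0 => //.
    by apply: addr_ge0; rewrite !mulr_ge0 // ltW.
  exact: sqrtr_ge0.
move=> i j.
have rv := relpos_vanishing hmodel hprop hr hpot hQ halpha hmu hkappa hbeta hdelta hguard
  Esym Eirr hloop' cq cdq cth reg conn0 V0 slack hA4c i j n0.
apply/cvg_mxP => k l; rewrite mxE ord1.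
apply: (vanishing_squeeze rv); apply: near_gt0 => t t0.
rewrite -(relE i j t (ltW t0)); exact: entry_le_enorm.
Qed.
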